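(* Let $d\ge2$, $\max\{d-2,0\}\le\alpha<d$, $\gamma\ge1$, $\nu>0$. For every $M>0$ and $h_{min}>0$ there exists $\lambda_0\in(0,1)$ such that the following holds for every $0<\lambda<\lambda_0$. Let $(h,u)$ be a global classical solution of the damped Euler–Riesz system in symmetric form (system (S$_\gamma$) of the context) satisfying the neutrality condition, and assume that (i) $\inf_{(x,t)\in\mathbb T^d\times\mathbb R_+}h(x,t)+\sigma\ge h_{min}>0$ (this condition is required only when $\gamma>1$), and (ii) $h,u\in L^\infty(\mathbb T^d\times\mathbb R_+)$, with $\|h\|_{L^\infty(\mathbb T^d\times\mathbb R_+)},\|u\|_{L^\infty(\mathbb T^d\times\mathbb R_+)}\le M$. Then there exist $C,\mu>0$ independent of $t$ such that $$\|(h,u)(t)\|_{L^2}\le Ce^{-C\mu t}\qquad\text{for all }t\ge0.$$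
   Context: $\mathbb T^d=\mathbb R^d/\mathbb Z^d$ is the periodic domain with total measure $1$, and $\mathbb R_+=[0,\infty)$. $\Lambda^s=(-\Delta)^{s/2}$ is the Fourier multiplier with symbol $(2\pi|n|)^s$, $n\in\mathbb Z^d$; for $s<0$ it acts on mean-zero functions. $\|(h,u)\|_{L^2}^2:=\|h\|_{L^2}^2+\|u\|_{L^2}^2$ on $\mathbb T^d$. A global classical solution is a pair that is (at least) $\mathcal C^1$ on $\mathbb T^d\times\mathbb R_+$, sufficiently regular, and satisfies the equations pointwise for all times. System (S$_\gamma$), for $h=h(x,t)\in\mathbb R$, $u=u(x,t)\in\mathbb R^d$, $x\in\mathbb T^d$, $t>0$: If $\gamma>1$, put $N=\frac{2}{\gamma-1}$, $\sigma=\gamma^{1/2}N$; the system is $$\partial_t h+u\cdot\nabla h+\tfrac1N(h+\sigma)\nabla\cdot u=0,$$ $$\partial_t u+u\cdot\nabla u+\tfrac1N(h+\sigma)\nabla h=-\nu u+\sigma^{-N}\lambda\nabla\Lambda^{\alpha-d}\{(h+\sigma)^N-\sigma^N\},$$ and the neutrality condition is $\int_{\mathbb T^d}(h+\sigma)^N\,dx=\sigma^N$ for all times. If $\gamma=1$, the system is $$\partial_t h+u\cdot\nabla h+\nabla\cdot u=0,\qquad \partial_t u+u\cdot\nabla u+\nabla h=-\nu u+\lambda\nabla\Lambda^{\alpha-d}(e^h-1),$$ and the neutrality condition is $\int_{\mathbb T^d}e^h\,dx=1$ for all times. *)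

(* Defs.v *)
From HB Require Import structures.
From mathcomp Require Import all_boot all_order all_algebra.
From mathcomp Require Import all_classical all_reals all_analysis.
From mathcomp Require Import complex.

Set Implicit Arguments.
Unset Strict Implicit.
Unset Printing Implicit Defensive.

Import Order.TTheory GRing.Theory Num.Theory.
Import numFieldNormedType.Exports.

Local Open Scope classical_set_scope.
Local Open Scope ring_scope.

(* Functions on the torus R^d/Z^d are Z^d-periodic functions on 'rV[R]_d, and
   functions of (x, t) are curried with time first; only their values at
   times t >= 0 are ever used. *)

Section Torus.
Context {R : realType}.

Definition lattice d (n : 'rV[int]_d) : 'rV[R]_d :=
  map_mx (fun z : int => z%:~R) n.

Definition Zperiodic d (T : Type) (f : 'rV[R]_d -> T) : Prop :=
  forall (x : 'rV[R]_d) (k : 'rV[int]_d), f (x + lattice k) = f x.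

(* The library norm on 'rV[R]_d is the maximum norm; |.| is Euclidean here. *)
Definition dotp d (x y : 'rV[R]_d) : R := \sum_(i < d) x 0 i * y 0 i.
Definition enorm d (x : 'rV[R]_d) : R := Num.sqrt (dotp x x).

(* Integral over R^d/Z^d: iterated Lebesgue integral over the unit cube,
   applied below to continuous integrands only. *)
Fixpoint torus_int d : ('rV[R]_d -> R) -> R :=
  match d with
  | 0 => fun f => f 0
  | d'.+1 => fun f => \int[lebesgue_measure]_(s in `[0, 1])
      torus_int (fun y : 'rV[R]_d' => f (row_mx (s%:M : 'M[R]_1) y))
  end.

(* \int f(x) e^{- 2 i pi n.x} dx for real-valued f *)
Definition fourier_coef d (f : 'rV[R]_d -> R) (n : 'rV[int]_d) : R[i] :=
  Complex (torus_int (fun x => f x * cos (2 * pi * dotp (lattice n) x)))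
          (- torus_int (fun x => f x * sin (2 * pi * dotp (lattice n) x))).

(* [is_Lambda s f g] : g = Lambda^s f, as continuous functions on the torus.
   For s < 0 the function f has to have mean zero; as 0 `^ s = 0 for s != 0,
   the condition at n = 0 then says that g has mean zero. *)
Definition is_Lambda d (s : R) (f g : 'rV[R]_d -> R) : Prop :=
  [/\ Zperiodic g, continuous g,
      s < 0 -> torus_int f = 0
    & forall n : 'rV[int]_d,
        fourier_coef g n =
        Complex ((2 * pi * enorm (lattice n)) `^ s) 0 * fourier_coef f n].

Definition L2norm d (h : 'rV[R]_d -> R) (u : 'rV[R]_d -> 'rV[R]_d) : R :=
  Num.sqrt (torus_int (fun x => h x ^+ 2) + torus_int (fun x => enorm (u x) ^+ 2)).

End Torus.

Section SpaceTime.
Context {R : realType}.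

Definition dt d (f : R -> 'rV[R]_d -> R) (t : R) (x : 'rV[R]_d) : R :=
  derive1 (fun s => f s x) t.

Definition dx d (i : 'I_d) (f : 'rV[R]_d -> R) (x : 'rV[R]_d) : R :=
  'D_(delta_mx 0 i) f x.

Definition divergence d (u : 'rV[R]_d -> 'rV[R]_d) (x : 'rV[R]_d) : R :=
  \sum_(i < d) dx i (fun y => u y 0 i) x.

(* v . grad f *)
Definition advect d (v : 'rV[R]_d) (f : 'rV[R]_d -> R) (x : 'rV[R]_d) : R :=
  \sum_(i < d) v 0 i * dx i f x.

Definition continuous_t_ge0 d (f : R -> 'rV[R]_d -> R) : Prop :=
  {within [set p : R * 'rV[R]_d | 0 <= p.1],
    continuous (fun p : R * 'rV[R]_d => f p.1 p.2)}.

(* C^1 up to and including t = 0: the derivatives extend continuously to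
   t = 0, so that ft 0 is the one-sided time derivative. *)
Definition C1_t_ge0 d (f : R -> 'rV[R]_d -> R) : Prop :=
  exists (ft : R -> 'rV[R]_d -> R) (fx : 'I_d -> R -> 'rV[R]_d -> R),
    [/\ continuous_t_ge0 f, continuous_t_ge0 ft,
        forall i, continuous_t_ge0 (fx i),
        forall (t : R) x, 0 < t -> is_derive t 1 (fun s => f s x) (ft t x)
      & forall (i : 'I_d) (t : R) (x : 'rV[R]_d), 0 <= t -> is_derive x (delta_mx 0 i) (f t) (fx i t x)].

(* L^oo norm and essential infimum over (x, t), for continuous functions *)
Definition Linfty_norm d (f : R -> 'rV[R]_d -> R) : \bar R :=
  ereal_sup [set `|f p.1 p.2|%:E | p in [set p : R * 'rV[R]_d | 0 <= p.1]].

Definition inf_t_ge0 d (f : R -> 'rV[R]_d -> R) : \bar R :=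
  ereal_inf [set (f p.1 p.2)%:E | p in [set p : R * 'rV[R]_d | 0 <= p.1]].

End SpaceTime.

Section EulerRiesz.
Context {R : realType}.

Definition Nexp (gamma : R) : R := 2 / (gamma - 1).
Definition sigma (gamma : R) : R := gamma `^ (2^-1) * Nexp gamma.

(* The system for gamma > 1; phi is Lambda^(alpha - d) ((h + sigma)^N - sigma^N),
   uniquely determined by its Fourier coefficients. *)
Definition system_gt1 d (gamma alpha nu lambda : R)
    (h : R -> 'rV[R]_d -> R) (u : R -> 'rV[R]_d -> 'rV[R]_d) : Prop :=
  let N := Nexp gamma in
  let sig := sigma gamma in
  forall t : R, 0 < t ->
  exists phi : 'rV[R]_d -> R,
    [/\ is_Lambda (alpha - d%:R) (fun x => (h t x + sig) `^ N - sig `^ N) phi,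
        forall (x : 'rV[R]_d) (i : 'I_d), derivable phi x (delta_mx 0 i),
        forall x, dt h t x + advect (u t x) (h t) x
                  + N^-1 * (h t x + sig) * divergence (u t) x = 0
      & forall x i,
          dt (fun s y => u s y 0 i) t x + advect (u t x) (fun y => u t y 0 i) x
            + N^-1 * (h t x + sig) * dx i (h t) x
          = - nu * u t x 0 i + sig `^ (- N) * lambda * dx i phi x].

Definition neutral_gt1 d (gamma : R) (h : R -> 'rV[R]_d -> R) : Prop :=
  forall t : R, 0 <= t ->
    torus_int (fun x => (h t x + sigma gamma) `^ Nexp gamma)
    = sigma gamma `^ Nexp gamma.

(* The system for gamma = 1; phi is Lambda^(alpha - d) (e^h - 1). *)
Definition system_eq1 d (alpha nu lambda : R)
    (h : R -> 'rV[R]_d -> R) (u : R -> 'rV[R]_d -> 'rV[R]_d) : Prop :=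
  forall t : R, 0 < t ->
  exists phi : 'rV[R]_d -> R,
    [/\ is_Lambda (alpha - d%:R) (fun x => expR (h t x) - 1) phi,
        forall (x : 'rV[R]_d) (i : 'I_d), derivable phi x (delta_mx 0 i),
        forall x, dt h t x + advect (u t x) (h t) x + divergence (u t) x = 0
      & forall x i,
          dt (fun s y => u s y 0 i) t x + advect (u t x) (fun y => u t y 0 i) x
            + dx i (h t) x
          = - nu * u t x 0 i + lambda * dx i phi x].

Definition neutral_eq1 d (h : R -> 'rV[R]_d -> R) : Prop :=
  forall t : R, 0 <= t -> torus_int (fun x => expR (h t x)) = 1.

Definition euler_riesz_system d (gamma alpha nu lambda : R)
    (h : R -> 'rV[R]_d -> R) (u : R -> 'rV[R]_d -> 'rV[R]_d) : Prop :=
  if gamma == 1 then system_eq1 alpha nu lambda h u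
  else system_gt1 gamma alpha nu lambda h u.

Definition neutral d (gamma : R) (h : R -> 'rV[R]_d -> R) : Prop :=
  if gamma == 1 then neutral_eq1 h else neutral_gt1 gamma h.

Definition global_classical_solution d (gamma alpha nu lambda : R)
    (h : R -> 'rV[R]_d -> R) (u : R -> 'rV[R]_d -> 'rV[R]_d) : Prop :=
  [/\ forall t : R, 0 <= t -> Zperiodic (h t) /\ Zperiodic (u t),
      C1_t_ge0 h,
      forall i, C1_t_ge0 (fun t x => u t x 0 i)
    & euler_riesz_system gamma alpha nu lambda h u].

End EulerRiesz.

(* Main.v *)
(* With f = rho - 1, m = rho u and phi = Lambda^(alpha - d) f, both systems read
     d_t f = - div m,
     d_t m_i = - sum_j d_j (m_i u_j) - d_i P - nu m_i + lambda (1 + f) d_i phi,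
   up to normalising the density to have mean 1. The energy
   \int (rho |u|^2 / 2 + Pi) - (lambda / 2) \int f phi is dissipated at the rate
   nu \int rho |u|^2 only; a small multiple of the cross term
   \int m . grad Delta^(-1) f adds the missing \int P f >= c \int f^2.

   The delicate term of the derivative of the cross term is
   lambda \int f v . grad phi with v = grad Delta^(-1) f: it must be bounded by
   lambda |f|_oo |f|_2^2, although grad phi is not controlled by |f|_2. For a
   shift z, the invariance of the integral gives
     \int f (z . v) (f(. + z) - f(. - z)) = \int f f(. + z) z . (v - v(. + z)),
   which is at most |f|_oo |z|^2 |f|_2^2. Averaging over a simple random walk z and
   letting its step tend to 0 yields the same bound for \int f v . grad e^(tau Delta) f,
   with a gain e^(- tau), and Lambda^(alpha - d) is a positive mixture of the heat
   operators e^(tau Delta).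

   Fourier series are replaced by their convolutions with positive Fejer-type
   kernels, so that all sums are finite; the truncation error vanishes uniformly on
   bounded time intervals, and the rate obtained from Gronwall's inequality does not
   depend on the truncation. *)

Require Import Defs.
From mathcomp Require Import all_boot all_order all_algebra.
From mathcomp Require Import all_classical all_reals all_analysis.
From mathcomp Require Import complex ring lra zify.

Set Implicit Arguments.
Unset Strict Implicit.
Unset Printing Implicit Defensive.

Import Order.TTheory GRing.Theory Num.Theory.
Import numFieldNormedType.Exports.

Local Open Scope classical_set_scope.
Local Open Scope ring_scope.

(** No bound on derivatives of the solution is uniform in time, so constants built from derivatives
    of f or phi may only appear multiplied by a truncation error. This works because the degree of
    the kernel depends on the tolerance alone: one degree serves all functions with a given
    Lipschitz bound, hence all times up to T. In the shift identity, z . (v - v(. + z)) is of second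
    order in z since its symbol is at most (z . k)^2 / |k|^2. Second order is what the random walk
    needs: the walk has second moment proportional to tau, and so has the first nontrivial term of
    the left-hand side. The gain e^(-tau) comes from Cauchy-Schwarz and the spectral gap for tau >=
    1. It is indispensable because the mixture for |k|^(-2p) has infinite mass at large tau.
    Comparing with the exponential at frequency 1 yields a constant independent of alpha. No Gamma
    integral is needed: mixtures are handled by duality against finite signed measures, a notion
    stable under products and limits, and powers are reached from exponentials. The potential is
    given separately at each time; its gradient becomes jointly continuous once it is read off the
    momentum equation. *)

Lemma continuous_rV {R : realType} (T : topologicalType) d (f : T -> 'rV[R]_d) :
  (forall i, continuous (fun x => f x 0 i)) -> continuous f.
Proof.
move=> fc x A [P nP PA].
have : \forall y \near x, forall i : 'I_d, P 0 i (f y 0 i).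
  by apply: filter_forall => i; exact: fc (nP 0 i).
apply: filterS => y Py; apply: PA => i j.
by rewrite (ord1 i); exact: Py.
Qed.

Lemma continuous_pair (S T U : topologicalType) (f : S -> T) (g : S -> U) :
  continuous f -> continuous g -> continuous (fun s => (f s, g s)).
Proof.
move=> fc gc s A [[P Q] [/= Pf Qg] PQ]; near=> x.
by apply: PQ; split => /=; near: x; [exact: fc|exact: gc].
Unshelve. all: by end_near. Qed.

(** * Integration on the torus *)

Section torus_int_basic.
Context {R : realType}.
Notation mu := (@lebesgue_measure R).

Lemma row_consE (K : nzRingType) d (s : K) (y : 'rV[K]_d) (i : 'I_d.+1) :
  row_mx (s%:M : 'M[K]_1) y 0 i = if unlift ord0 i is Some j then y 0 j else s.
Proof.
case: unliftP => [j ->|->].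
  have -> : lift ord0 j = rshift 1 j by apply: val_inj.
  by rewrite row_mxEr.
have -> : (ord0 : 'I_d.+1) = lshift d (ord0 : 'I_1) by apply: val_inj.
by rewrite row_mxEl mxE eqxx.
Qed.

Lemma continuous_row_cons d (T : topologicalType) (a : T -> R) (b : T -> 'rV[R]_d) :
  continuous a -> continuous b ->
  continuous (fun t => (row_mx ((a t)%:M : 'M[R]_1) (b t) : 'rV[R]_d.+1)).
Proof.
move=> ac bc; apply: continuous_rV => i.
rewrite (_ : (fun _ => _) = fun t => if unlift ord0 i is Some j then b t 0 j else a t).
  case: unliftP => [j _|_] //= t.
  exact: (continuous_comp (bc t) (@coord_continuous _ _ _ 0 j _)).
by apply/funext => t; rewrite row_consE.
Qed.

Lemma integrable01 (f : R -> R) : continuous f ->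
  mu.-integrable `[0, 1] (EFin \o f).
Proof.
move=> fc; apply: continuous_compact_integrable; first exact: segment_compact.
exact: continuous_subspaceT.
Qed.

Lemma Rint01_cst (c : R) : \int[mu]_(s in `[0, 1]) c = c.
Proof. by rewrite Rintegral_cst //= lebesgue_measure_itv /= lte01 oppr0 adde0 mulr1. Qed.

Lemma Rint01_le (f g : R -> R) : continuous f -> continuous g ->
  (forall s, 0 <= s <= 1 -> f s <= g s) ->
  \int[mu]_(s in `[0, 1]) f s <= \int[mu]_(s in `[0, 1]) g s.
Proof.
move=> fc gc fg; apply: le_Rintegral => //; try exact: integrable01.
Qed.

Lemma Rint01_dist (f g : R -> R) e : continuous f -> continuous g ->
  (forall s, 0 <= s <= 1 -> `|f s - g s| <= e) ->
  `|\int[mu]_(s in `[0, 1]) f s - \int[mu]_(s in `[0, 1]) g s| <= e.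
Proof.
move=> fc gc fg; rewrite -RintegralB //; try exact: integrable01.
have fgc : continuous (f \- g) by move=> x; apply: continuousB; [exact: fc|exact: gc].
apply: le_trans (le_normr_Rintegral _ _) _ => //; first exact: (integrable01 fgc).
rewrite -[leRHS]Rint01_cst; apply: Rint01_le => //; last exact: cst_continuous.
by move=> x; exact: (cvg_norm (fgc x)).
Qed.

(** Compactness of [0, 1] turns joint continuity at each point [(t, s)] into closeness uniform in
    [s], so that no dominated convergence is involved. *)
Lemma continuous_Rint01 (T : topologicalType) (f : T -> R -> R) :
  continuous (fun p : T * R => f p.1 p.2) ->
  continuous (fun t => \int[mu]_(s in `[0, 1]) f t s).
Proof.
move=> fc t.
have sl u : continuous (f u).
  move=> s; have h : {for s, continuous (fun s : R => (u, s))}.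
    by apply: continuous_pair => x; [exact: cvg_cst|exact: cvg_id].
  exact: (continuous_comp h (fc (u, s))).
apply/cvgrPdist_le => e e0.
have /compact_near_coveringP K : compact (`[0, 1]%classic : set R) by exact: segment_compact.
have := K T (nbhs t) (fun u s => `|f t s - f u s| <= e) _.
have H : forall x : R, (`[0, 1]%classic : set R) x -> \forall x' \near x & i \near t,
    `|f t x' - f i x'| <= e.
  move=> s _.
  have h1 : \forall p \near (t, s), `|f t s - f p.1 p.2| <= e / 2.
    by move/cvgrPdist_le : (fc (t, s)); apply; rewrite divr_gt0.
  have h2 : \forall s' \near s, `|f t s - f t s'| <= e / 2.
    by move/cvgrPdist_le : (sl t s); apply; rewrite divr_gt0.
  move: h1 => [[A B] [/= At Bs] AB].
  exists (B `&` (fun s' => `|f t s - f t s'| <= e / 2), A) => /=; first by split=> //; exact: filterI.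
  move=> [s' u] /= [[Bs' h] Au].
  have := AB (u, s') (conj Au Bs') => /= h'.
  rewrite (splitr e); apply: le_trans (lerD h h').
  rewrite -(distrC (f t s')).
  have -> : f t s' - f u s' = (f t s' - f t s) + (f t s - f u s') by ring.
  exact: ler_normD.
move=> /(_ (nbhs_filter t) H) /=.
apply: filterS => u hu /=; apply: Rint01_dist; [exact: sl..|].
by move=> s s01; apply: hu; rewrite /= in_itv.
Qed.

End torus_int_basic.

Section cont_ops.
Context {R : realType} (T : topologicalType).
Implicit Types f g : T -> R.

Lemma contD f g : continuous f -> continuous g -> continuous (fun x => f x + g x).
Proof. by move=> fc gc x; exact: (cvgD (fc x) (gc x)). Qed.

Lemma contN f : continuous f -> continuous (fun x => - f x).
Proof. by move=> fc x; exact: (cvgN (fc x)). Qed.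

Lemma contB f g : continuous f -> continuous g -> continuous (fun x => f x - g x).
Proof. by move=> fc gc; apply: contD => //; exact: contN. Qed.

Lemma contM f g : continuous f -> continuous g -> continuous (fun x => f x * g x).
Proof. by move=> fc gc x; exact: (cvgM (fc x) (gc x)). Qed.

Lemma cont_cst (c : R) : continuous (fun _ : T => c).
Proof. exact: cst_continuous. Qed.

Lemma contZ (c : R) f : continuous f -> continuous (fun x => c * f x).
Proof. by apply: contM; exact: cont_cst. Qed.

Lemma contX f n : continuous f -> continuous (fun x => f x ^+ n).
Proof.
move=> fc; elim: n => [|n IH].
  by rewrite (_ : (fun _ => _) = fun=> 1); [exact: cont_cst|apply/funext => x; rewrite expr0].
rewrite (_ : (fun _ => _) = fun x => f x * f x ^+ n); first exact: contM.
by apply/funext => x; rewrite exprS.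
Qed.

Lemma cont_sum (I : Type) (r : seq I) (P : pred I) (F : I -> T -> R) :
  (forall i, P i -> continuous (F i)) -> continuous (fun x => \sum_(i <- r | P i) F i x).
Proof.
move=> Fc; elim: r => [|i r IH].
  by rewrite (_ : (fun _ => _) = fun=> 0); [exact: cont_cst|apply/funext => x; rewrite big_nil].
rewrite (_ : (fun _ => _) = fun x => if P i then F i x + \sum_(i <- r | P i) F i x
  else \sum_(i <- r | P i) F i x); last by apply/funext => x; rewrite big_cons.
by case: (boolP (P i)) => // Pi; apply: contD => //; exact: Fc.
Qed.

Lemma cont_comp (g : R -> R) f : continuous g -> continuous f -> continuous (fun x => g (f x)).
Proof. by move=> gc fc x; exact: (continuous_comp (fc x) (gc (f x))). Qed.

End cont_ops.

(** The endpoints are unordered, so that increments of either sign are treated at once later on. *)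
Lemma MVT_any (R : realType) (f df : R -> R) (x y : R) :
  (forall z, Num.min x y <= z <= Num.max x y -> is_derive z 1 f (df z)) ->
  exists2 c, Num.min x y <= c <= Num.max x y & f y - f x = df c * (y - x).
Proof.
wlog xy : x y / x <= y.
  move=> H fd; case: (leP x y) => [xy|/ltW yx].
    by have [c] := H x y xy fd; rewrite (min_idPl xy) (max_idPr xy) => ? ?; exists c.
  have [|c cyx e] := H y x yx; first by rewrite minC maxC.
  exists c; last by rewrite -opprB e -mulrN opprB.
  by move: cyx; rewrite (min_idPl yx) (max_idPr yx).
rewrite (min_idPl xy) (max_idPr xy) => fd.
have [||c] := @MVT_segment R f df x y xy.
- by move=> z; rewrite in_itv /= => /andP[xz zy]; apply: fd; rewrite !ltW.
- apply: derivable_within_continuous => z; rewrite in_itv /= => /fd fz.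
  by have [] := fz.
- by rewrite in_itv /= => ? ?; exists c.
Qed.

Lemma dist_between (R : realDomainType) (t s z : R) :
  Num.min t s <= z <= Num.max t s -> `|z - t| <= `|s - t|.
Proof.
case: (leP t s) => ts /andP[a b].
  by rewrite !ger0_norm; lra.
by rewrite !ler0_norm; lra.
Qed.

Lemma is_derive_eps (R : realType) (V : normedModType R) (F : V -> R) (x v : V) (l : R) :
  (forall e : R, 0 < e -> \forall h \near (0 : R), `|F (h *: v + x) - F x - h * l| <= e * `|h|) ->
  is_derive x v F l.
Proof.
move=> H.
have C : (fun h : R => h^-1 *: ((F \o shift x) (h *: v) - F x)) @ 0^' --> l.
  apply/cvgrPdist_le => e e0; rewrite near_withinE.
  apply: filterS (H e e0) => h hh h0 /=.
  have h0' : 0 < `|h| by rewrite normr_gt0.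
  rewrite -(ler_pM2r h0') -normrM mulrBl distrC.
  by rewrite /GRing.scale /= mulrAC mulVf // mul1r (mulrC l).
split; first by apply/cvg_ex; exists l.
exact/cvg_lim.
Qed.

Section torus_int_theory.
Context {R : realType}.
Notation mu := (@lebesgue_measure R).

Lemma continuous_comp2 (S T U : topologicalType) (f : T -> U -> R)
    (a : S -> T) (b : S -> U) :
  continuous (fun p : T * U => f p.1 p.2) -> continuous a -> continuous b ->
  continuous (fun s => f (a s) (b s)).
Proof.
move=> fc ac bc s.
apply: (@continuous_comp _ _ _ (fun s => (a s, b s)) (fun p => f p.1 p.2) s).
  exact: continuous_pair.
exact: fc.
Qed.

Lemma fst_continuous (T U : topologicalType) : continuous (@fst T U).
Proof. by move=> x; exact: cvg_fst. Qed.

Lemma snd_continuous (T U : topologicalType) : continuous (@snd T U).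
Proof. by move=> x; exact: cvg_snd. Qed.

(** The induction on [d] works because the parameter space is arbitrary: the outer variable of
    integration is moved into it, replacing [T] by [T * R]. *)
Lemma continuous_torus_int (T : topologicalType) d (f : T -> 'rV[R]_d -> R) :
  continuous (fun p : T * 'rV[R]_d => f p.1 p.2) ->
  continuous (fun t => torus_int (f t)).
Proof.
elim: d T f => [|d IH] T f fc /=.
  by apply: (continuous_comp2 fc); [move=> t; exact: cvg_id|exact: cst_continuous].
apply: continuous_Rint01.
apply: (IH (T * R)%type (fun q y => f q.1 (row_mx (q.2%:M : 'M[R]_1) y))).
apply: (continuous_comp2 fc) => [p|].
  by apply: (continuous_comp (@fst_continuous _ _ p)); exact: fst_continuous.
apply: continuous_row_cons; last exact: snd_continuous.
by move=> p; apply: (continuous_comp (@fst_continuous _ _ p)); exact: snd_continuous.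
Qed.

Lemma continuous_slice d (f : 'rV[R]_d.+1 -> R) : continuous f ->
  continuous (fun p : R * 'rV[R]_d => f (row_mx (p.1%:M : 'M[R]_1) p.2)).
Proof.
move=> fc p; apply: continuous_comp; last exact: fc.
by apply: continuous_row_cons; [exact: fst_continuous|exact: snd_continuous].
Qed.

Lemma continuous_slice1 d (f : 'rV[R]_d.+1 -> R) (s : R) : continuous f ->
  continuous (fun y : 'rV[R]_d => f (row_mx (s%:M : 'M[R]_1) y)).
Proof.
move=> fc.
have := @continuous_comp2 _ _ _ (fun s (y : 'rV[R]_d) => f (row_mx (s%:M : 'M[R]_1) y))
  (fun=> s) id (continuous_slice fc).
apply; first exact: cst_continuous.
by move=> y; exact: cvg_id.
Qed.

Lemma continuous_int_slice d (f : 'rV[R]_d.+1 -> R) : continuous f ->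
  continuous (fun s : R => torus_int (fun y : 'rV[R]_d => f (row_mx (s%:M : 'M[R]_1) y))).
Proof. by move=> fc; apply: continuous_torus_int; exact: continuous_slice. Qed.

Lemma torus_int_cst d (c : R) : torus_int (fun _ : 'rV[R]_d => c) = c.
Proof.
elim: d => //= d IH; rewrite -[RHS]Rint01_cst; congr (Rintegral _ _ _).
by apply/funext => s; exact: IH.
Qed.

Lemma torus_intD d (f g : 'rV[R]_d -> R) : continuous f -> continuous g ->
  torus_int (fun x => f x + g x) = torus_int f + torus_int g.
Proof.
elim: d f g => //= d IH f g fc gc.
rewrite -RintegralD //; try by apply: integrable01; exact: continuous_int_slice.
congr (Rintegral _ _ _); apply/funext => s.
by rewrite -IH //; exact: continuous_slice1.
Qed.

Lemma torus_intZ d (c : R) (f : 'rV[R]_d -> R) : continuous f ->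
  torus_int (fun x => c * f x) = c * torus_int f.
Proof.
elim: d f => //= d IH f fc.
rewrite -RintegralZl //; try by apply: integrable01; exact: continuous_int_slice.
congr (Rintegral _ _ _); apply/funext => s.
by rewrite -IH //; exact: continuous_slice1.
Qed.

Lemma torus_int_le_cube d (f g : 'rV[R]_d -> R) : continuous f -> continuous g ->
  (forall x : 'rV[R]_d, (forall i, 0 <= x 0 i <= 1) -> f x <= g x) ->
  torus_int f <= torus_int g.
Proof.
elim: d f g => [|d IH] f g fc gc fg /=.
  by apply: fg => -[].
apply: Rint01_le; [exact: continuous_int_slice..|] => s s01.
apply: IH; [exact: continuous_slice1..|] => y y01.
by apply: fg => i; rewrite row_consE; case: unlift.
Qed.

(** With a primitive [G] of [f], the shifted integral is [G (1 + c) - G c], whose derivative in [c]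
    is [f (1 + c) - f c = 0]. *)
Lemma Rint01_shift (f : R -> R) (a : R) : continuous f ->
  (forall s, f (s + 1) = f s) ->
  \int[mu]_(s in `[0, 1]) f (s + a) = \int[mu]_(s in `[0, 1]) f s.
Proof.
move=> fc f1.
(* The base point of the primitive lies strictly below every point at which [G] is differentiated,
   all of which are at least - |a|. *)
pose b := - `|a| - 1; pose G (x : R) := \int[mu]_(t in `[b, x]) f t.
have dG (x : R) : b < x -> is_derive x (1 : R) G (f x).
  move=> bx.
  have [] := @continuous_FTC1_closed R f b x (x + 1) _ _ bx _.
  - by rewrite ltrDl.
  - apply: continuous_compact_integrable; first exact: segment_compact.
    exact: continuous_subspaceT.
  - exact: fc.
  - by move=> dG Gf; split=> //; rewrite -derive1E.
have dGa c x : b < x + c -> is_derive x (1 : R) (fun s => G (s + c)) (f (x + c)).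
  move=> bx; have dGx := dG _ bx.
  have := @is_derive1_comp R G (fun s => s + c) x (f (x + c)) 1.
  rewrite mulr1; apply.
  have := @is_deriveD _ _ _ id (cst c) x 1 1 0; rewrite addr0; apply.
have int_eq c : - `|a| <= c -> \int[mu]_(s in `[0, 1]) f (s + c) = G (1 + c) - G c.
  move=> ac.
  have fcc : continuous (fun s => f (s + c)).
    move=> s; apply: continuous_comp; last exact: fc.
    by apply: cvgD; [exact: cvg_id|exact: cvg_cst].
  rewrite /Rintegral (@continuous_FTC2 R (fun s => f (s + c)) (fun s => G (s + c)) 0 1) //=.
  - by rewrite add0r.
  - exact: continuous_subspaceT.
  - have bc x : 0 <= x -> b < x + c.
      by move=> x0; rewrite /b; lra.
    have der x : 0 <= x -> derivable (fun s => G (s + c)) x 1.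
      by move=> x0; have [] := dGa c x (bc x x0).
    have ct x : 0 <= x -> {for x, continuous (fun s => G (s + c))}.
      by move=> x0; apply: differentiable_continuous; exact/derivable1_diffP/der.
    split; first by move=> x; rewrite in_itv /= => /andP[x0 _]; apply: der; exact: ltW.
    + by apply: cvg_at_right_filter; apply: ct.
    + by apply: cvg_at_left_filter; apply: ct.
  - move=> x; rewrite in_itv /= => /andP[x0 _]; rewrite derive1E.
    have bx : b < x + c.
      by rewrite /b; lra.
    by have [_ ->] := dGa c x bx.
have -> : \int[mu]_(s in `[0, 1]) f s = G (1 + 0) - G 0.
  by rewrite -int_eq ?oppr_le0 ?normr_ge0//; under [RHS]eq_Rintegral do rewrite addr0.
have ma : - `|a| <= a by rewrite lerNl -normrN ler_norm.
rewrite int_eq //; apply/eqP; rewrite -subr_eq0; apply/eqP.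
have [|c _ ->] := @MVT_any _ (fun c => G (1 + c) - G c) (cst 0) 0 a; last by rewrite mul0r.
move=> z /andP[z1 _].
have bz : b < z.
  rewrite /b; apply: lt_le_trans z1; rewrite lt_min.
  by have := normr_ge0 a; lra.
have dGz := dG _ bz.
have dG1z : is_derive z (1 : R) (fun s => G (1 + s)) (f (1 + z)).
  rewrite [X in is_derive _ _ X](_ : _ = fun s => G (s + 1)).
    by rewrite (addrC 1 z); apply: dGa; rewrite (lt_trans bz)// ltrDl.
  by apply/funext => s; rewrite addrC.
have := is_deriveB dG1z dGz.
by rewrite (addrC 1 z) f1 subrr.
Qed.

Lemma torus_int_shift d (f : 'rV[R]_d -> R) (a : 'rV[R]_d) : continuous f ->
  Zperiodic f -> torus_int (fun x => f (x + a)) = torus_int f.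
Proof.
elim: d f a => [|d IH] f a fc fp /=.
  by congr f; apply/rowP => -[].
have pl s : Zperiodic (fun y : 'rV[R]_d => f (row_mx (s%:M : 'M[R]_1) y)).
  move=> y k /=; rewrite -[RHS](fp _ (row_mx (0%:M : 'M[int]_1) k)); congr f.
  apply/rowP => i; rewrite row_consE [RHS]mxE row_consE [X in _ = _ + X]mxE row_consE.
  by case: unlift => [j|]; rewrite ?mxE ?addr0.
pose g s := torus_int (fun y : 'rV[R]_d => f (row_mx (s%:M : 'M[R]_1) y)).
rewrite -[RHS](@Rint01_shift g (a 0 0)); first last.
- move=> s; rewrite /g; congr torus_int; apply/funext => y.
  rewrite -[RHS](fp _ (row_mx (1%:M : 'M[int]_1) 0)); congr f.
  apply/rowP => i; rewrite row_consE [RHS]mxE row_consE [X in _ = _ + X]mxE row_consE.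
  by case: unlift => [j|]; rewrite ?mxE ?addr0.
- exact: continuous_int_slice.
congr (Rintegral _ _ _); apply/funext => s.
pose a' : 'rV[R]_d := \row_j a 0 (lift ord0 j).
rewrite /g -[RHS](IH _ a' (continuous_slice1 fc) (pl _)).
congr torus_int; apply/funext => y; congr f; apply/rowP => i.
rewrite row_consE [LHS]mxE row_consE; case: unliftP => [j ->|->]; last by [].
by rewrite !mxE.
Qed.

Lemma torus_int_dist_cube d (f g : 'rV[R]_d -> R) e : continuous f -> continuous g ->
  (forall x : 'rV[R]_d, (forall i, 0 <= x 0 i <= 1) -> `|f x - g x| <= e) ->
  `|torus_int f - torus_int g| <= e.
Proof.
move=> fc gc fg.
have fce h : continuous h -> continuous (fun x : 'rV[R]_d => h x + e).
  by move=> hc; apply: contD => //; exact: cont_cst.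
rewrite ler_distl; apply/andP; split.
  rewrite lerBlDr -[X in _ + X](torus_int_cst d e) -torus_intD //; last exact: cst_continuous.
  apply: torus_int_le_cube; [by []|exact: fce|].
  by move=> x /fg; rewrite ler_distl lerBlDr => /andP[].
rewrite -[X in _ + X](torus_int_cst d e) -torus_intD //; last exact: cst_continuous.
apply: torus_int_le_cube; [by []|exact: fce|].
by move=> x /fg; rewrite ler_distl lerBlDr => /andP[].
Qed.

Lemma compact_cube d : compact [set x : 'rV[R]_d | forall i, 0 <= x 0 i <= 1].
Proof.
have := @rV_compact R d (fun=> `[0, 1]%classic) (fun=> @segment_compact R 0 1).
congr compact; apply/seteqP; split => x /= h i; have := h i; by rewrite in_itv.
Qed.

(** The difference quotient equals [ft] at an intermediate time by the mean value theorem, and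
    compactness of the cube makes [ft] at nearby times uniformly close to [ft t]. *)
Lemma torus_int_derive d (f ft : R -> 'rV[R]_d -> R) (t delta : R) : 0 < delta ->
  (forall s x, `|s - t| < delta -> is_derive s 1 (f ^~ x) (ft s x)) ->
  (forall s, `|s - t| < delta -> continuous (f s)) ->
  (forall x, {for (t, x), continuous (fun p : R * 'rV[R]_d => ft p.1 p.2)}) ->
  is_derive t 1 (fun s => torus_int (f s)) (torus_int (ft t)).
Proof.
move=> d0 df fc ftc.
have ftct : continuous (ft t).
  move=> x; apply: (@continuous_comp _ _ _ (fun x => (t, x)) (fun p : R * 'rV[R]_d => ft p.1 p.2) x).
    by apply: continuous_pair; [exact: cst_continuous|move=> y; exact: cvg_id].
  exact: ftc.
apply: is_derive_eps => e e0.
have /compact_near_coveringP K := @compact_cube d.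
have := K R (nbhs t) (fun s x => `|ft t x - ft s x| <= e) _.
have H : forall x : 'rV[R]_d, [set x : 'rV[R]_d | forall i, 0 <= x 0 i <= 1] x ->
    \forall x' \near x & i \near t, `|ft t x' - ft i x'| <= e.
  move=> x _.
  have h1 : \forall p \near (t, x), `|ft t x - ft p.1 p.2| <= e / 2.
    by move/cvgrPdist_le : (ftc x); apply; rewrite divr_gt0.
  have h2 : \forall x' \near x, `|ft t x - ft t x'| <= e / 2.
    by move/cvgrPdist_le : (ftct x); apply; rewrite divr_gt0.
  move: h1 => [[A B] [/= At Bs] AB].
  exists (B `&` (fun s' => `|ft t x - ft t s'| <= e / 2), A) => /=; first by split=> //; exact: filterI.
  move=> [s' u] /= [[Bs' h] Au].
  have := AB (u, s') (conj Au Bs') => /= h'.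
  rewrite (splitr e); apply: le_trans (lerD h h').
  rewrite -(distrC (ft t s')).
  have -> : ft t s' - ft u s' = (ft t s' - ft t x) + (ft t x - ft u s') by ring.
  exact: ler_normD.
move=> /(_ (nbhs_filter t) H) /= {H}.
have tI : \forall s \near t, `|s - t| < delta.
  by near do rewrite distrC; exact: nbhsx_ballx.
move=> /(filterI tI) /nbhs_ballP[r /= r0 rP].
exists r => //= h; rewrite /ball_ /= sub0r normrN => hr.
have rP' s : `|t - s| < r -> `|s - t| < delta /\ forall x : 'rV[R]_d, (forall i, 0 <= x 0 i <= 1) -> `|ft t x - ft s x| <= e.
  by move=> /rP.
have ht : `|t - (h + t)| < r by rewrite opprD addrCA subrr addr0 normrN.
rewrite /GRing.scale /= mulr1.
have [ht1 _] := rP' _ ht.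
have fct : continuous (f t) by apply: fc; rewrite subrr normr0.
have fcB : continuous (fun x => -1 * f t x) by exact: contZ.
have fcht := fc _ ht1.
rewrite -(mulN1r (torus_int (f t))) -torus_intZ //.
rewrite -torus_intD // -torus_intZ //.
apply: torus_int_dist_cube.
- exact: contD.
- exact: contZ.
move=> x x01.
have [|c cI] := @MVT_any _ (f ^~ x) (ft ^~ x) t (h + t).
  by move=> z zI; apply: df; apply: le_lt_trans ht1; exact: dist_between.
rewrite /= mulN1r => ->; rewrite addrK mulrC -mulrBr normrM mulrC.
apply: ler_wpM2r => //; rewrite distrC; apply (rP' c) => //.
apply: le_lt_trans ht; rewrite !(distrC t).
exact: dist_between.
Unshelve. all: by end_near. Qed.

End torus_int_theory.

Section line_derivative.
Context {R : realType} (V : normedModType R).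

Lemma is_derive_line (g : V -> R) (x v : V) (s l : R) :
  is_derive (x + s *: v) v g l -> is_derive s (1 : R) (fun r => g (x + r *: v)) l.
Proof.
have E : (fun h : R => h^-1 *: (((fun r => g (x + r *: v)) \o shift s) (h *: (1 : R)) - g (x + s *: v)))
  = (fun h : R => h^-1 *: ((g \o shift (x + s *: v)) (h *: v) - g (x + s *: v))).
  apply/funext => h /=; congr (_ *: (g _ - _)).
  by rewrite (_ : h *: (1 : R) = h) ?scalerDl 1?addrCA // /GRing.scale /= mulr1.
by move=> [D <-]; split; [rewrite /derivable E|rewrite /derive E].
Qed.

Lemma is_derive_translate (g : V -> R) (x a v : V) (l : R) :
  is_derive (x + a) v g l -> is_derive x v (fun y => g (y + a)) l.
Proof.
have E : (fun h : R => h^-1 *: (((fun y => g (y + a)) \o shift x) (h *: v) - g (x + a)))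
  = (fun h : R => h^-1 *: ((g \o shift (x + a)) (h *: v) - g (x + a))).
  by apply/funext => h /=; rewrite addrA.
by move=> [D <-]; split; [rewrite /derivable E|rewrite /derive E].
Qed.

Lemma is_derive_unique (g : V -> R) (x v : V) (l l' : R) :
  is_derive x v g l -> is_derive x v g l' -> l = l'.
Proof. by move=> [_ <-] [_ <-]. Qed.

End line_derivative.

(** * Continuous periodic functions *)

Section periodic.
Context {R : realType} (d : nat).
Notation V := 'rV[R]_d.
Implicit Types f g : V -> R.

Definition cper f := continuous f /\ Zperiodic f.

Definition has_dx (i : 'I_d) f f' := forall x : V, is_derive x (delta_mx 0 i) f (f' x).

Lemma cper_cst (c : R) : cper (fun=> c).
Proof. by split; [exact: cont_cst|]. Qed.

Lemma cperD f g : cper f -> cper g -> cper (fun x => f x + g x).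
Proof. by move=> [fc fp] [gc gp]; split; [exact: contD|move=> x k; rewrite fp gp]. Qed.

Lemma cperN f : cper f -> cper (fun x => - f x).
Proof. by move=> [fc fp]; split; [exact: contN|move=> x k; rewrite fp]. Qed.

Lemma cperB f g : cper f -> cper g -> cper (fun x => f x - g x).
Proof. by move=> fc gc; apply: cperD => //; exact: cperN. Qed.

Lemma cperM f g : cper f -> cper g -> cper (fun x => f x * g x).
Proof. by move=> [fc fp] [gc gp]; split; [exact: contM|move=> x k; rewrite fp gp]. Qed.

Lemma cperZ (c : R) f : cper f -> cper (fun x => c * f x).
Proof. by apply: cperM; exact: cper_cst. Qed.

Lemma cper_sum (I : Type) (r : seq I) (P : pred I) (F : I -> V -> R) :
  (forall i, P i -> cper (F i)) -> cper (fun x => \sum_(i <- r | P i) F i x).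
Proof.
move=> H; split; first by apply: cont_sum => i /H[].
by move=> x k; apply: eq_bigr => i /H[_ ->].
Qed.

Lemma cper_shift f (a : V) : cper f -> cper (fun x => f (x + a)).
Proof.
move=> [fc fp]; split; last by move=> x k; rewrite addrAC fp.
move=> x; apply: (@continuous_comp V V R (fun x : V => x + a) f x); last exact: fc.
exact: (cvgD (@cvg_id _ (nbhs x)) (@cvg_cst _ a _ _ _)).
Qed.

Lemma torus_intN f : continuous f -> torus_int (fun x => - f x) = - torus_int f.
Proof.
move=> fc; rewrite -mulN1r -torus_intZ //; congr torus_int.
by apply/funext => x; rewrite mulN1r.
Qed.

Lemma torus_intB f g : continuous f -> continuous g ->
  torus_int (fun x => f x - g x) = torus_int f - torus_int g.
Proof. by move=> fc gc; rewrite torus_intD ?torus_intN//; exact: contN. Qed.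

Lemma torus_int_sum (I : Type) (r : seq I) (P : pred I) (F : I -> V -> R) :
  (forall i, P i -> continuous (F i)) ->
  torus_int (fun x => \sum_(i <- r | P i) F i x) = \sum_(i <- r | P i) torus_int (F i).
Proof.
move=> Fc; elim: r => [|i r IH].
  by rewrite big_nil -[RHS](torus_int_cst d); congr torus_int; apply/funext => x; rewrite big_nil.
rewrite big_cons -IH; case: (boolP (P i)) => Pi.
  rewrite -torus_intD; [|exact: Fc|exact: cont_sum].
  by congr torus_int; apply/funext => x; rewrite big_cons Pi.
by congr torus_int; apply/funext => x; rewrite big_cons (negPf Pi).
Qed.

Lemma torus_int_le f g : continuous f -> continuous g ->
  (forall x, f x <= g x) -> torus_int f <= torus_int g.
Proof. by move=> fc gc fg; apply: torus_int_le_cube. Qed.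

Lemma torus_int_ge0 f : continuous f -> (forall x, 0 <= f x) -> 0 <= torus_int f.
Proof.
by move=> fc f0; rewrite -(torus_int_cst d 0); apply: torus_int_le => //; exact: cont_cst.
Qed.

Lemma torus_int_norm_le f g : continuous f -> continuous g ->
  (forall x, `|f x| <= g x) -> `|torus_int f| <= torus_int g.
Proof.
move=> fc gc fg; rewrite ler_norml -torus_intN //; apply/andP; split.
  by apply: torus_int_le => //; [exact: contN|move=> x; have := fg x; rewrite ler_norml => /andP[]].
by apply: torus_int_le => // x; have := fg x; rewrite ler_norml => /andP[].
Qed.

(** The integral of the translates of [f] along the i-th axis is constant by translation invariance;
    differentiating it under the integral at 0 gives the integral of [f']. *)
Lemma torus_int_dx0 (i : 'I_d) f f' : cper f -> continuous f' -> has_dx i f f' ->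
  torus_int f' = 0.
Proof.
move=> [fc fp] fc' df; pose e : V := delta_mx 0 i.
have ce (x : V) : continuous (fun s : R => x + s *: e).
  by move=> s; apply: cvgD; [exact: cvg_cst|apply: cvgZr_tmp; exact: cvg_id].
have h : is_derive (0 : R) 1 (fun s => torus_int (fun x => f (x + s *: e)))
   (torus_int (fun x => f' (x + 0 *: e))).
  apply: (@torus_int_derive _ _ (fun s x => f (x + s *: e)) (fun s x => f' (x + s *: e)) 0 1) => //.
  - by move=> s x _; apply: is_derive_line; exact: df.
  - by move=> s _; have [] := cper_shift (s *: e) (conj fc fp).
  - move=> x; apply: (@continuous_comp (R * V)%type V R (fun p : R * V => p.2 + p.1 *: e) f' (0, x)); last exact: fc'.
    by apply: cvgD; [exact: cvg_snd|apply: cvgZr_tmp; exact: cvg_fst].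
move: h; rewrite (_ : (fun s : R => _) = cst (torus_int f)); last first.
  by apply/funext => s; rewrite torus_int_shift.
move=> /is_derive_unique /(_ (is_derive_cst _ _ _)) => <-.
by congr torus_int; apply/funext => x; rewrite scale0r addr0.
Qed.

Lemma periodic_reduce (x : V) : exists k : 'rV[int]_d,
  forall i, 0 <= (x + lattice k) 0 i <= 1.
Proof.
exists (\row_i - Num.floor (x 0 i)) => i; rewrite !mxE mulrNz.
have /andP[h1 h2] := floor_itv (x 0 i).
by rewrite subr_ge0 h1 /= lerBlDr addrC; rewrite intrD in h2; exact: ltW.
Qed.

Lemma cper_bounded f : cper f -> exists2 B, 0 <= B & forall x, `|f x| <= B.
Proof.
move=> [fc fp].
have fw : {within [set x : V | forall i, 0 <= x 0 i <= 1], continuous f}.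
  exact: continuous_subspaceT.
have /compact_bounded[B [_ BP]] := continuous_compact fw (@compact_cube R d).
exists (`|B| + 1) => // x; have [k kx] := periodic_reduce x.
rewrite -(fp x k); apply: BP; last by exists (x + lattice k).
by rewrite (le_lt_trans (ler_norm B))// ltrDl.
Qed.

End periodic.

(** The optimal weight is [C / A]. Adding a small [eta] to both [A] and [C] in the witness covers
    the degenerate cases [A = 0] and [C = 0]. All Cauchy-Schwarz inequalities below are obtained in
    this way. *)
Lemma le_mul_of_amgm (R : realType) (X A C : R) : 0 <= A -> 0 <= C ->
  (forall delta, 0 < delta -> 2 * X <= delta * A ^+ 2 + delta^-1 * C ^+ 2) -> X <= A * C.
Proof.
move=> A0 C0 H; apply/ler_addgt0Pl => e e0.
pose eta := e / (A + C + 1).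
have AC0 : 0 < A + C + 1 by lra.
have eta0 : 0 < eta by rewrite divr_gt0.
have Ae : 0 < A + eta by lra.
have Ce : 0 < C + eta by lra.
have := H ((C + eta) / (A + eta)) (divr_gt0 Ce Ae).
rewrite invf_div.
have h1 : (C + eta) / (A + eta) * A ^+ 2 <= (C + eta) * A.
  rewrite mulrAC -mulrA ler_pM2l // ler_pdivrMr // expr2 ler_wpM2l //; lra.
have h2 : (A + eta) / (C + eta) * C ^+ 2 <= (A + eta) * C.
  rewrite mulrAC -mulrA ler_pM2l // ler_pdivrMr // expr2 ler_wpM2l //; lra.
have h3 : eta * (A + C + 1) = e by rewrite /eta divfK // lt0r_neq0.
nra.
Qed.

(** * Real Fourier coefficients and multipliers *)

Section fourier.
Context {R : realType} (d : nat).
Notation V := 'rV[R]_d.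
Notation K := 'rV[int]_d.
Implicit Types (f g : V -> R) (k l : K) (x y z : V).

Definition wave k (i : 'I_d) : R := 2 * pi * (k 0 i)%:~R.
Definition phase k x : R := 2 * pi * dotp (lattice k) x.
Definition ca f k : R := torus_int (fun x => f x * cos (phase k x)).
Definition sa f k : R := torus_int (fun x => f x * sin (phase k x)).
(* With c_k = ca k - i sa k the complex Fourier coefficient, Sy and An are the real
   and imaginary parts of c_k(g) times the conjugate of c_k(f). *)
Definition Sy g f k := ca g k * ca f k + sa g k * sa f k.
Definition An g f k := ca g k * sa f k - sa g k * ca f k.

Lemma phaseE k x : phase k x = \sum_(i < d) wave k i * x 0 i.
Proof. by rewrite /phase /dotp mulr_sumr; apply: eq_bigr => i _; rewrite mxE mulrA. Qed.

Lemma phaseD k x y : phase k (x + y) = phase k x + phase k y.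
Proof. by rewrite !phaseE -big_split; apply: eq_bigr => i _; rewrite mxE mulrDr. Qed.

Lemma phaseN k x : phase k (- x) = - phase k x.
Proof. by rewrite !phaseE -sumrN; apply: eq_bigr => i _; rewrite mxE mulrN. Qed.

Lemma phase0 k : phase k 0 = 0.
Proof. by rewrite phaseE big1 // => i _; rewrite mxE mulr0. Qed.

Lemma phase0l x : phase 0 x = 0.
Proof. by rewrite phaseE big1 // => i _; rewrite /wave mxE mulr0 mul0r. Qed.

Lemma phaseZ k (s : R) x : phase k (s *: x) = s * phase k x.
Proof. by rewrite !phaseE mulr_sumr; apply: eq_bigr => i _; rewrite mxE mulrCA. Qed.

Lemma phase_delta k i : phase k (delta_mx 0 i) = wave k i.
Proof.
rewrite phaseE (bigD1 i) //= mxE !eqxx mulr1 big1 ?addr0 // => j ji.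
by rewrite mxE (negPf ji) andbF mulr0.
Qed.

Lemma phaseDl k l x : phase (k + l) x = phase k x + phase l x.
Proof.
by rewrite !phaseE -big_split; apply: eq_bigr => i _; rewrite /wave mxE intrD /=; ring.
Qed.

Lemma phaseNl k x : phase (- k) x = - phase k x.
Proof.
by rewrite !phaseE -sumrN; apply: eq_bigr => i _; rewrite /wave mxE intrN; ring.
Qed.

Lemma cos_int (a : R) (m : int) : cos (a + 2 * pi * m%:~R) = cos a.
Proof.
case: m => n.
  by have := periodicn (@cosD2pi R) n a => <-; congr cos; rewrite -mulr_natr -pmulrn; ring.
rewrite NegzE; have := periodicn (@cosD2pi R) n.+1 (a + 2 * pi * (- n.+1%:Z)%:~R) => <-.
by congr cos; rewrite -mulr_natr intrN -pmulrn; ring.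
Qed.

Lemma sin_int (a : R) (m : int) : sin (a + 2 * pi * m%:~R) = sin a.
Proof.
case: m => n.
  by have := periodicn (@sinD2pi R) n a => <-; congr sin; rewrite -mulr_natr -pmulrn; ring.
rewrite NegzE; have := periodicn (@sinD2pi R) n.+1 (a + 2 * pi * (- n.+1%:Z)%:~R) => <-.
by congr sin; rewrite -mulr_natr intrN -pmulrn; ring.
Qed.

Lemma phase_lattice k l : exists m : int, phase k (lattice l) = 2 * pi * m%:~R.
Proof.
exists (\sum_i k 0 i * l 0 i); rewrite phaseE rmorph_sum mulr_sumr; apply: eq_bigr => i _.
by rewrite mxE /wave rmorphM /= mulrA.
Qed.

Lemma continuous_phase k : continuous (phase k).
Proof.
rewrite (_ : phase k = fun x => \sum_(i < d) wave k i * x 0 i); last by apply/funext => x; rewrite phaseE.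
apply: cont_sum => i _; apply: contZ; exact: coord_continuous.
Qed.

Lemma cper_cos k : cper (fun x => cos (phase k x)).
Proof.
split; first by apply: cont_comp; [exact: continuous_cos|exact: continuous_phase].
by move=> x l; rewrite phaseD; have [m ->] := phase_lattice k l; rewrite cos_int.
Qed.

Lemma cper_sin k : cper (fun x => sin (phase k x)).
Proof.
split; first by apply: cont_comp; [exact: continuous_sin|exact: continuous_phase].
by move=> x l; rewrite phaseD; have [m ->] := phase_lattice k l; rewrite sin_int.
Qed.

Lemma is_derive_phase k x i : is_derive x (delta_mx 0 i) (phase k) (wave k i).
Proof.
apply: is_derive_eps => e e0; near=> h.
rewrite phaseD phaseZ phase_delta addrK subrr normr0.
by rewrite mulr_ge0 // ltW.
Unshelve. all: by end_near. Qed.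

End fourier.

Section chain.
Context {R : realType} (V : normedModType R).

Lemma is_derive_of_line (g : V -> R) (x v : V) (l : R) :
  is_derive (0 : R) 1 (fun r => g (x + r *: v)) l -> is_derive x v g l.
Proof.
have E : (fun h : R => h^-1 *: (((fun r => g (x + r *: v)) \o shift 0) (h *: (1 : R)) - g (x + 0 *: v)))
  = (fun h : R => h^-1 *: ((g \o shift x) (h *: v) - g x)).
  apply/funext => h /=; have -> : h *: (1 : R) = h by rewrite /GRing.scale /= mulr1.
  by rewrite scale0r !addr0 (addrC x).
by move=> [D <-]; split; [rewrite /derivable -E|rewrite /derive -E].
Qed.

Lemma is_derive_chain (g : R -> R) (F : V -> R) (x v : V) (a b : R) :
  is_derive (F x) 1 g a -> is_derive x v F b -> is_derive x v (fun y => g (F y)) (a * b).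
Proof.
move=> dg dF; apply: is_derive_of_line.
have dl : is_derive (0 : R) 1 (fun r => F (x + r *: v)) b.
  by apply: is_derive_line; rewrite scale0r addr0.
have dg' : is_derive ((fun r => F (x + r *: v)) 0) 1 g a by rewrite scale0r addr0.
exact: (is_derive1_comp dg' dl).
Qed.

Lemma deriM (f g : V -> R) (x v : V) (a b : R) :
  is_derive x v f a -> is_derive x v g b ->
  is_derive x v (fun y => f y * g y) (a * g x + f x * b).
Proof. by move=> df dg; have := is_deriveM df dg; rewrite /GRing.scale /= addrC (mulrC (g x)). Qed.

Lemma deriD (f g : V -> R) (x v : V) (a b : R) :
  is_derive x v f a -> is_derive x v g b -> is_derive x v (fun y => f y + g y) (a + b).
Proof. by move=> df dg; exact: is_deriveD. Qed.

Lemma deriB (f g : V -> R) (x v : V) (a b : R) :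
  is_derive x v f a -> is_derive x v g b -> is_derive x v (fun y => f y - g y) (a - b).
Proof. by move=> df dg; exact: is_deriveB. Qed.

Lemma deri_cst (c : R) (x v : V) : is_derive x v (fun=> c) 0.
Proof. exact: is_derive_cst. Qed.

Lemma deriZ (c : R) (f : V -> R) (x v : V) (a : R) :
  is_derive x v f a -> is_derive x v (fun y => c * f y) (c * a).
Proof. by move=> df; have := deriM (deri_cst c x v) df; rewrite mul0r add0r. Qed.

Lemma deri_sum (I : Type) (r : seq I) (P : pred I) (F : I -> V -> R) (dF : I -> R) (x v : V) :
  (forall i, P i -> is_derive x v (F i) (dF i)) ->
  is_derive x v (fun y => \sum_(i <- r | P i) F i y) (\sum_(i <- r | P i) dF i).
Proof.
move=> H; elim: r => [|i r IH].
  rewrite big_nil (_ : (fun _ => _) = fun=> 0); first exact: deri_cst.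
  by apply/funext => y; rewrite big_nil.
rewrite big_cons (_ : (fun _ => _) = fun y => if P i then F i y + \sum_(i <- r | P i) F i y
  else \sum_(i <- r | P i) F i y); last by apply/funext => y; rewrite big_cons.
by case: (boolP (P i)) => // Pi; apply: deriD => //; exact: H.
Qed.

End chain.

Section fourier_coefficients.
Context {R : realType} (d : nat).
Notation V := 'rV[R]_d.
Notation K := 'rV[int]_d.
Implicit Types (f g : V -> R) (k l : K) (x y z : V).

Lemma has_dx_cos k i : has_dx i (fun x : V => cos (phase k x)) (fun x => - sin (phase k x) * wave k i).
Proof. by move=> x; exact: (is_derive_chain (is_derive_cos _) (is_derive_phase _ _ _)). Qed.

Lemma has_dx_sin k i : has_dx i (fun x : V => sin (phase k x)) (fun x => cos (phase k x) * wave k i).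
Proof. by move=> x; exact: (is_derive_chain (is_derive_sin _) (is_derive_phase _ _ _)). Qed.

Lemma torus_int_by_parts i f f' g g' : cper f -> cper g ->
  continuous f' -> continuous g' -> has_dx i f f' -> has_dx i g g' ->
  torus_int (fun x => f' x * g x) = - torus_int (fun x => f x * g' x).
Proof.
move=> fp gp fc' gc' df dg; have [fc _] := fp; have [gc _] := gp.
apply/eqP; rewrite -subr_eq0 opprK -torus_intD; [|exact: contM..].
apply/eqP; apply: (@torus_int_dx0 _ _ i (fun x => f x * g x)).
- exact: cperM.
- by apply: contD; exact: contM.
- by move=> x; exact: deriM.
Qed.

Lemma ca_dx i f f' k : cper f -> continuous f' -> has_dx i f f' ->
  ca f' k = wave k i * sa f k.
Proof.
move=> fp fc' df; have [cc _] := @cper_cos R d k; have [sc _] := @cper_sin R d k.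
have [fc _] := fp.
rewrite /ca (torus_int_by_parts fp (@cper_cos R d k) fc' _ df (has_dx_cos k i)).
  rewrite /sa -torus_intZ; last exact: contM.
  rewrite -torus_intN; first by congr torus_int; apply/funext => x; ring.
  by apply: contM => //; apply: contM; [exact: contN|exact: cont_cst].
by apply: contM; [exact: contN|exact: cont_cst].
Qed.

Lemma sa_dx i f f' k : cper f -> continuous f' -> has_dx i f f' ->
  sa f' k = - wave k i * ca f k.
Proof.
move=> fp fc' df; have [cc _] := @cper_cos R d k; have [sc _] := @cper_sin R d k.
have [fc _] := fp.
rewrite /sa (torus_int_by_parts fp (@cper_sin R d k) fc' _ df (has_dx_sin k i)).
  rewrite /ca -torus_intZ; last exact: contM.
  rewrite -torus_intN; first by congr torus_int; apply/funext => x; ring.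
  by apply: contM => //; apply: contM; [|exact: cont_cst].
by apply: contM; [|exact: cont_cst].
Qed.

Lemma caD f g k : continuous f -> continuous g -> ca (fun x => f x + g x) k = ca f k + ca g k.
Proof.
move=> fc gc; have [cc _] := @cper_cos R d k; rewrite /ca -torus_intD; [|exact: contM..].
by congr torus_int; apply/funext => x; rewrite mulrDl.
Qed.

Lemma saD f g k : continuous f -> continuous g -> sa (fun x => f x + g x) k = sa f k + sa g k.
Proof.
move=> fc gc; have [cc _] := @cper_sin R d k; rewrite /sa -torus_intD; [|exact: contM..].
by congr torus_int; apply/funext => x; rewrite mulrDl.
Qed.

Lemma caZ c f k : continuous f -> ca (fun x => c * f x) k = c * ca f k.
Proof.
move=> fc; have [cc _] := @cper_cos R d k; rewrite /ca -torus_intZ; last exact: contM.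
by congr torus_int; apply/funext => x; rewrite mulrA.
Qed.

Lemma saZ c f k : continuous f -> sa (fun x => c * f x) k = c * sa f k.
Proof.
move=> fc; have [cc _] := @cper_sin R d k; rewrite /sa -torus_intZ; last exact: contM.
by congr torus_int; apply/funext => x; rewrite mulrA.
Qed.

Lemma ca_sum (I : Type) (r : seq I) (P : pred I) (F : I -> V -> R) k :
  (forall i, P i -> continuous (F i)) ->
  ca (fun x => \sum_(i <- r | P i) F i x) k = \sum_(i <- r | P i) ca (F i) k.
Proof.
move=> Fc; have [cc _] := @cper_cos R d k; rewrite /ca -torus_int_sum.
  by congr torus_int; apply/funext => x; rewrite mulr_suml.
by move=> i /Fc ?; exact: contM.
Qed.

Lemma sa_sum (I : Type) (r : seq I) (P : pred I) (F : I -> V -> R) k :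
  (forall i, P i -> continuous (F i)) ->
  sa (fun x => \sum_(i <- r | P i) F i x) k = \sum_(i <- r | P i) sa (F i) k.
Proof.
move=> Fc; have [cc _] := @cper_sin R d k; rewrite /sa -torus_int_sum.
  by congr torus_int; apply/funext => x; rewrite mulr_suml.
by move=> i /Fc ?; exact: contM.
Qed.

Lemma ca_shift f k z : cper f ->
  ca (fun x => f (x + z)) k = cos (phase k z) * ca f k + sin (phase k z) * sa f k.
Proof.
move=> fp; have cp := @cper_cos R d k; have sp := @cper_sin R d k.
have [fc _] := fp; have [cc _] := cp; have [sc _] := sp.
rewrite /ca /sa -torus_intZ; last exact: contM.
rewrite -torus_intZ; last exact: contM.
rewrite -torus_intD; [|by apply: contZ; exact: contM..].
have fp2 : cper (fun x => cos (phase k z) * (f x * cos (phase k x)) + sin (phase k z) * (f x * sin (phase k x))).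
  by apply: cperD; apply: cperZ; exact: cperM.
have [c2 p2] := fp2.
(* It is the right-hand side that gets translated by [z]; the identity cos^2 + sin^2 = 1 then
   collapses it to the left-hand side. *)
rewrite -(torus_int_shift z c2 p2); congr torus_int; apply/funext => x.
rewrite phaseD cosD sinD; have := cos2Dsin2 (phase k z).
set a := cos (phase k z); set b := sin (phase k z) => ab.
have {1}-> : cos (phase k x) = (a ^+ 2 + b ^+ 2) * cos (phase k x) by rewrite ab mul1r.
ring.
Qed.

Lemma torus_int_cos k : torus_int (fun x : V => cos (phase k x)) = (k == 0)%:R.
Proof.
have [->|k0] := eqVneq k 0.
  by rewrite -[RHS](torus_int_cst d); congr torus_int; apply/funext => x; rewrite phase0l cos0.
have [i ki] : exists i, k 0 i != 0.
  apply/existsP; apply: contraNT k0; rewrite negb_exists => /forallP H.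
  by apply/eqP/rowP => i; rewrite mxE; apply/eqP; have := H i; rewrite negbK.
have kR : (k 0 i)%:~R != 0 :> R by rewrite intr_eq0.
(* Half a period of the wave along a direction where [k] does not vanish: this translation flips the
   sign of the cosine but preserves its integral. *)
pose z : V := (2 * (k 0 i)%:~R)^-1 *: delta_mx 0 i.
have pz : phase k z = pi.
  by rewrite phaseZ phase_delta /wave; field.
have [c p] := @cper_cos R d k.
have := torus_int_shift z c p.
rewrite (_ : (fun x => _) = fun x => - cos (phase k x)); last first.
  by apply/funext => x; rewrite phaseD pz cosDpi.
rewrite torus_intN // => h; rewrite ?(negPf k0) /=; lra.
Qed.

Lemma torus_int_sin k : torus_int (fun x : V => sin (phase k x)) = 0.
Proof.
have [->|k0] := eqVneq k 0.
  by rewrite -[RHS](torus_int_cst d); congr torus_int; apply/funext => x; rewrite phase0l sin0.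
have [i ki] : exists i, k 0 i != 0.
  apply/existsP; apply: contraNT k0; rewrite negb_exists => /forallP H.
  by apply/eqP/rowP => i; rewrite mxE; apply/eqP; have := H i; rewrite negbK.
have kR : (k 0 i)%:~R != 0 :> R by rewrite intr_eq0.
pose z : V := (2 * (k 0 i)%:~R)^-1 *: delta_mx 0 i.
have pz : phase k z = pi.
  by rewrite phaseZ phase_delta /wave; field.
have [c p] := @cper_sin R d k.
have := torus_int_shift z c p.
rewrite (_ : (fun x => _) = fun x => - sin (phase k x)); last first.
  by apply/funext => x; rewrite phaseD pz sinDpi.
rewrite torus_intN // => h; rewrite ?(negPf k0) /=; lra.
Qed.

End fourier_coefficients.

(** * Truncated Fourier multipliers and Bessel's inequality *)

Section multipliers.
Context {R : realType} (d : nat).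
Notation V := 'rV[R]_d.
Notation K := 'rV[int]_d.
Implicit Types (f g : V -> R) (k l : K) (x y z : V) (c e : K -> R) (S : seq K).

(* Fourier multiplier with symbol c + i e, truncated to the frequencies in S. *)
Definition Mop S c e f x : R := \sum_(k <- S)
  (c k * (ca f k * cos (phase k x) + sa f k * sin (phase k x))
   + e k * (sa f k * cos (phase k x) - ca f k * sin (phase k x))).

Lemma cper_Mop S c e f : cper (Mop S c e f).
Proof.
apply: cper_sum => k _.
by apply: cperD; apply: cperZ; [apply: cperD|apply: cperB]; apply: cperZ;
  (exact: cper_cos || exact: cper_sin).
Qed.

Lemma torus_int_Mop S c e f g : continuous g ->
  torus_int (fun x => g x * Mop S c e f x) = \sum_(k <- S) (c k * Sy g f k + e k * An g f k).
Proof.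
move=> gc.
rewrite (_ : (fun x => _) = fun x => \sum_(k <- S)
   ((c k * ca f k + e k * sa f k) * (g x * cos (phase k x)) +
    (c k * sa f k - e k * ca f k) * (g x * sin (phase k x)))); last first.
  by apply/funext => x; rewrite mulr_sumr; apply: eq_bigr => k _; ring.
have cc k : continuous (fun x : V => g x * cos (phase k x)).
  by apply: contM => //; have [] := @cper_cos R d k.
have sc k : continuous (fun x : V => g x * sin (phase k x)).
  by apply: contM => //; have [] := @cper_sin R d k.
rewrite torus_int_sum; last by move=> k _; apply: contD; exact: contZ.
apply: eq_bigr => k _; rewrite torus_intD; [|exact: contZ..].
by rewrite !torus_intZ // -/(ca g k) -/(sa g k) /Sy /An; ring.
Qed.

Lemma ca_cos k l : ca (fun x : V => cos (phase k x)) l = 2^-1 * ((k == l)%:R + (k == - l)%:R).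
Proof.
have e (a b : R) : cos a * cos b = 2^-1 * (cos (a - b) + cos (a + b)) by rewrite cosB cosD; field.
rewrite /ca (_ : (fun x => _) = fun x => 2^-1 * (cos (phase (k - l) x) + cos (phase (k + l) x))).
  have [c1 _] := @cper_cos R d (k - l); have [c2 _] := @cper_cos R d (k + l).
  by rewrite torus_intZ ?torus_intD ?torus_int_cos ?subr_eq0 ?addr_eq0 //; exact: contD.
by apply/funext => x; rewrite e !phaseDl phaseNl.
Qed.

Lemma sa_sin k l : sa (fun x : V => sin (phase k x)) l = 2^-1 * ((k == l)%:R - (k == - l)%:R).
Proof.
have e (a b : R) : sin a * sin b = 2^-1 * (cos (a - b) - cos (a + b)) by rewrite cosB cosD; field.
rewrite /sa (_ : (fun x => _) = fun x => 2^-1 * (cos (phase (k - l) x) - cos (phase (k + l) x))).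
  have [c1 _] := @cper_cos R d (k - l); have [c2 _] := @cper_cos R d (k + l).
  by rewrite torus_intZ ?torus_intB ?torus_int_cos ?subr_eq0 ?addr_eq0 //; exact: contB.
by apply/funext => x; rewrite e !phaseDl phaseNl.
Qed.

Lemma ca_sin k l : ca (fun x : V => sin (phase k x)) l = 0.
Proof.
have e (a b : R) : sin a * cos b = 2^-1 * (sin (a - b) + sin (a + b)) by rewrite sinB sinD; field.
rewrite /ca (_ : (fun x => _) = fun x => 2^-1 * (sin (phase (k - l) x) + sin (phase (k + l) x))).
  have [c1 _] := @cper_sin R d (k - l); have [c2 _] := @cper_sin R d (k + l).
  by rewrite torus_intZ ?torus_intD ?torus_int_sin ?addr0 ?mulr0 //; exact: contD.
by apply/funext => x; rewrite e !phaseDl phaseNl.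
Qed.

Lemma sa_cos k l : sa (fun x : V => cos (phase k x)) l = 0.
Proof.
rewrite -(ca_sin l k) /sa /ca; congr torus_int; apply/funext => x; exact: mulrC.
Qed.

Lemma ca_opp f k : ca f (- k) = ca f k.
Proof. by rewrite /ca; congr torus_int; apply/funext => x; rewrite phaseNl cosN. Qed.

Lemma sa_opp f k : continuous f -> sa f (- k) = - sa f k.
Proof.
move=> fc; have [c _] := @cper_sin R d k; rewrite /sa -torus_intN; last exact: contM.
by congr torus_int; apply/funext => x; rewrite phaseNl sinN mulrN.
Qed.

(** In real form the frequencies [k] and [- k] carry the same mode, each with weight one half. Only
    on a set closed under opposites do the halves add up, so that the symbol 1 acts as a
    projection. *)
Definition symmetric_freq S := uniq S /\ forall k, k \in S -> - k \in S.

Lemma sum_pick S k (F : K -> R) : uniq S -> k \in S ->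
  \sum_(l <- S) F l * (l == k)%:R = F k.
Proof.
move=> uS kS; rewrite (bigD1_seq k) //= eqxx mulr1 big1 ?addr0 // => l /negPf ->.
by rewrite mulr0.
Qed.

Lemma ca_proj S f l : symmetric_freq S -> continuous f -> l \in S ->
  ca (Mop S (fun=> 1) (fun=> 0) f) l = ca f l.
Proof.
move=> [uS sS] fc lS; have cc k := (@cper_cos R d k).1; have sc k := (@cper_sin R d k).1.
rewrite (_ : Mop S _ _ f = fun x => \sum_(k <- S)
   (ca f k * cos (phase k x) + sa f k * sin (phase k x))); last first.
  by apply/funext => x; apply: eq_bigr => k _; ring.
rewrite ca_sum; last by move=> k _; apply: contD; exact: contZ.
rewrite (eq_bigr (fun k => 2^-1 * (ca f k * (k == l)%:R) + 2^-1 * (ca f k * (k == - l)%:R))); last first.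
  by move=> k _; rewrite caD ?caZ ?ca_cos ?ca_sin //; [ring|exact: contZ..].
rewrite big_split /= -!mulr_sumr !sum_pick // ?ca_opp ?sS //; by field.
Qed.

Lemma sa_proj S f l : symmetric_freq S -> continuous f -> l \in S ->
  sa (Mop S (fun=> 1) (fun=> 0) f) l = sa f l.
Proof.
move=> [uS sS] fc lS; have cc k := (@cper_cos R d k).1; have sc k := (@cper_sin R d k).1.
rewrite (_ : Mop S _ _ f = fun x => \sum_(k <- S)
   (ca f k * cos (phase k x) + sa f k * sin (phase k x))); last first.
  by apply/funext => x; apply: eq_bigr => k _; ring.
rewrite sa_sum; last by move=> k _; apply: contD; exact: contZ.
rewrite (eq_bigr (fun k => 2^-1 * (sa f k * (k == l)%:R) - 2^-1 * (sa f k * (k == - l)%:R))); last first.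
  by move=> k _; rewrite saD ?saZ ?sa_cos ?sa_sin //; [ring|exact: contZ..].
rewrite sumrB /= -!mulr_sumr !sum_pick // ?sa_opp ?sS //; by field.
Qed.

(** With [g] the projection of [f], both int f g and int g^2 equal the left-hand side, and int (f -
    g)^2 is nonnegative. *)
Lemma bessel S f : symmetric_freq S -> continuous f ->
  \sum_(k <- S) Sy f f k <= torus_int (fun x => f x ^+ 2).
Proof.
move=> sS fc; pose g := Mop S (fun=> 1) (fun=> 0) f.
have [gc _] : cper g by exact: cper_Mop.
have e1 : torus_int (fun x => f x * g x) = \sum_(k <- S) Sy f f k.
  by rewrite torus_int_Mop //; apply: eq_bigr => k _; rewrite mul0r addr0 mul1r.
have e2 : torus_int (fun x => g x * g x) = \sum_(k <- S) Sy f f k.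
  rewrite torus_int_Mop // !big_seq; apply: eq_bigr => k kS.
  by rewrite mul0r addr0 mul1r /Sy ca_proj ?sa_proj.
have : 0 <= torus_int (fun x => (f x - g x) ^+ 2).
  by apply: torus_int_ge0 => [|x]; [apply: contX; exact: contB|exact: sqr_ge0].
rewrite (_ : (fun x => (f x - g x) ^+ 2) = fun x => (f x ^+ 2 - 2 * (f x * g x)) + g x * g x); last first.
  by apply/funext => x; ring.
have fgc : continuous (fun x => f x * g x) by exact: contM.
have ggc : continuous (fun x => g x * g x) by exact: contM.
have f2 : continuous (fun x => f x ^+ 2) by exact: contX.
have zfgc : continuous (fun x => 2 * (f x * g x)) by exact: contZ.
rewrite torus_intD ?torus_intB ?torus_intZ //; last exact: contB.
by rewrite e1 e2; lra.
Qed.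

(** The symbol is bounded frequency by frequency through a weighted arithmetic-geometric inequality,
    and Bessel is applied to [f] and to [g] separately; Parseval is never invoked. *)
Lemma sum_SyAn_le S c e f g (B A C : R) : symmetric_freq S -> continuous f -> continuous g ->
  0 <= A -> 0 <= B -> 0 <= C ->
  (forall k, k \in S -> c k ^+ 2 + e k ^+ 2 <= B ^+ 2) ->
  torus_int (fun x => g x ^+ 2) <= A ^+ 2 -> torus_int (fun x => f x ^+ 2) <= C ^+ 2 ->
  `|\sum_(k <- S) (c k * Sy g f k + e k * An g f k)| <= B * (A * C).
Proof.
move=> sS fc gc A0 B0 C0 cB gA fC.
rewrite mulrA; apply: le_mul_of_amgm => //; first exact: mulr_ge0.
move=> dl dl0.
have hk k : k \in S -> 2 * `|c k * Sy g f k + e k * An g f k|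
    <= dl * B ^+ 2 * Sy g g k + dl^-1 * Sy f f k.
  move=> /cB; rewrite /Sy /An.
  move: (ca g k) (sa g k) (ca f k) (sa f k) (c k) (e k) => a b a' b' p q pq.
  (* |p X + q Y|^2 <= (p^2+q^2)(X^2+Y^2) with X^2+Y^2 = |g_k|^2 |f_k|^2 *)
  have h : (p * (a * a' + b * b') + q * (a * b' - b * a')) ^+ 2
      <= B ^+ 2 * ((a * a + b * b) * (a' * a' + b' * b')).
    apply: (@le_trans _ _ ((p ^+ 2 + q ^+ 2) * ((a * a + b * b) * (a' * a' + b' * b')))).
      rewrite -subr_ge0 (_ : _ - _ = (p * (a * b' - b * a') - q * (a * a' + b * b')) ^+ 2); last by ring.
      exact: sqr_ge0.
    by apply: ler_wpM2r => //; apply: mulr_ge0; apply: addr_ge0; rewrite -expr2 sqr_ge0.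
  rewrite -ler_sqr ?nnegrE; last 2 first.
  - by apply: mulr_ge0.
  - have s0 (u v : R) : 0 <= u * u + v * v by rewrite -!expr2 addr_ge0 ?sqr_ge0.
    by rewrite addr_ge0 // mulr_ge0 ?s0 ?mulr_ge0 ?sqr_ge0 ?invr_ge0 // ltW.
  rewrite exprMn real_normK ?num_real //.
  move: h; set G := a * a + b * b; set H := a' * a' + b' * b'; set X := _ + _.
  move=> h; have dV : dl * dl^-1 = 1 by rewrite divff // lt0r_neq0.
  (* The square of a sum exceeds the square of the difference by four times the product, and here
     [dl] cancels from the product. *)
  rewrite -subr_ge0; apply: (@le_trans _ _ ((dl * B ^+ 2 * G - dl^-1 * H) ^+ 2)); first exact: sqr_ge0.
  rewrite -subr_ge0 (_ : _ - _ = 4 * (B ^+ 2 * (G * H) * (dl * dl^-1) - X ^+ 2)); last by ring.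
  by rewrite dV mulr1 mulr_ge0 // subr_ge0.
apply: (@le_trans _ _ (\sum_(k <- S) (dl * B ^+ 2 * Sy g g k + dl^-1 * Sy f f k))).
  apply: (@le_trans _ _ (2 * \sum_(k <- S) `|c k * Sy g f k + e k * An g f k|)).
    by rewrite ler_pM2l //; exact: ler_norm_sum.
  by rewrite mulr_sumr !big_seq; apply: ler_sum => k kS; exact: hk.
rewrite big_split -!mulr_sumr /=.
apply: lerD.
  rewrite (_ : dl * (B * A) ^+ 2 = (dl * B ^+ 2) * A ^+ 2); last by ring.
  apply: ler_wpM2l; first by rewrite mulr_ge0 ?sqr_ge0 // ltW.
  exact: le_trans (bessel sS gc) gA.
apply: ler_wpM2l; first by rewrite invr_ge0 ltW.
exact: le_trans (bessel sS fc) fC.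
Qed.

Lemma torus_int_CS f g (A C : R) : continuous f -> continuous g -> 0 <= A -> 0 <= C ->
  torus_int (fun x => f x ^+ 2) <= A ^+ 2 -> torus_int (fun x => g x ^+ 2) <= C ^+ 2 ->
  `|torus_int (fun x => f x * g x)| <= A * C.
Proof.
move=> fc gc A0 C0 fA gC; apply: le_mul_of_amgm => // dl dl0.
have f2 : continuous (fun x => f x ^+ 2) by exact: contX.
have g2 : continuous (fun x => g x ^+ 2) by exact: contX.
have dl1 : 0 < dl^-1 by rewrite invr_gt0.
apply: (@le_trans _ _ (dl * torus_int (fun x => f x ^+ 2) + dl^-1 * torus_int (fun x => g x ^+ 2))).
  rewrite -[X in X * `|_|](ger0_norm (ltW (ltr0Sn R 1))) -normrM -torus_intZ; last exact: contM.
  rewrite -!torus_intZ // -torus_intD; [|exact: contZ..].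
  apply: torus_int_norm_le; [by apply: contZ; exact: contM|by apply: contD; exact: contZ|].
  move=> x; have dV : dl * dl^-1 = 1 by rewrite divff // lt0r_neq0.
  have h (s : R) : s ^+ 2 = 1 -> 0 <= dl * f x ^+ 2 + dl^-1 * g x ^+ 2 - s * (2 * (f x * g x)).
    move=> s2; rewrite (_ : _ - _ = dl * (f x - dl^-1 * s * g x) ^+ 2).
      by rewrite mulr_ge0 ?sqr_ge0 // ltW.
    transitivity (dl * f x ^+ 2 + dl^-1 * (s ^+ 2) * (dl * dl^-1) * g x ^+ 2 - (dl * dl^-1) * s * (2 * (f x * g x))).
      by rewrite s2 dV; ring.
    by ring.
  have h1 := h 1 (expr1n _ _); have h2 := h (-1) (sqrr_sign _ 1).
  by rewrite ler_norml; apply/andP; split; lra.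
by apply: lerD; apply: ler_wpM2l => //; exact: ltW.
Qed.

(** Pairing the output [g] with itself gives |g|^2 <= B |g| |f|; one factor |g| is then divided out,
    the case |g| = 0 being separate. *)
Lemma Mop_norm S c e f (B : R) : symmetric_freq S -> continuous f -> 0 <= B ->
  (forall k, k \in S -> c k ^+ 2 + e k ^+ 2 <= B ^+ 2) ->
  torus_int (fun x => Mop S c e f x ^+ 2) <= B ^+ 2 * torus_int (fun x => f x ^+ 2).
Proof.
move=> sS fc B0 cB; have [gc _] := @cper_Mop S c e f; set g := Mop S c e f.
have I0 (h : V -> R) : continuous h -> 0 <= torus_int (fun x : V => h x ^+ 2).
  by move=> hc; apply: torus_int_ge0 => [|x]; [exact: contX|exact: sqr_ge0].
pose n (h : V -> R) := Num.sqrt (torus_int (fun x : V => h x ^+ 2)).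
have nE (h : V -> R) : continuous h -> torus_int (fun x => h x ^+ 2) = n h ^+ 2.
  by move=> hc; rewrite sqr_sqrtr // I0.
have := @sum_SyAn_le S c e f g B (n g) (n f) sS fc gc (sqrtr_ge0 _) B0 (sqrtr_ge0 _) cB.
rewrite -!nE // => /(_ (lexx _) (lexx _)).
rewrite -torus_int_Mop // -/g.
rewrite (_ : (fun x => g x * g x) = fun x => g x ^+ 2); last by apply/funext => x; rewrite expr2.
rewrite ger0_norm ?I0 // !nE // => h.
have := sqrtr_ge0 (torus_int (fun x => g x ^+ 2)); rewrite -/(n g) => g0.
have f0 := sqrtr_ge0 (torus_int (fun x => f x ^+ 2)); rewrite -/(n f) in f0.
rewrite -exprMn ler_sqr ?nnegrE ?mulr_ge0 //.
move: g0; rewrite le_eqVlt => /predU1P[<-|g0]; first by rewrite mulr_ge0.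
rewrite -(ler_pM2l g0) -expr2; apply: le_trans h _.
by rewrite mulrCA.
Qed.

(** Differentiation multiplies the complex symbol [c + i e] by [i * wave k i]. *)
Lemma Mop_dx S c e f i :
  has_dx i (Mop S c e f) (Mop S (fun k => - wave k i * e k) (fun k => wave k i * c k) f).
Proof.
move=> x; rewrite /Mop; apply: deri_sum => k _.
have dc := has_dx_cos k i x; have ds := has_dx_sin k i x.
have := deriD (deriZ (c k) (deriD (deriZ (ca f k) dc) (deriZ (sa f k) ds)))
  (deriZ (e k) (deriB (deriZ (sa f k) dc) (deriZ (ca f k) ds))).
move=> h; apply: (is_derive_eq h); ring.
Qed.

Lemma Mop_shift S c e f x z :
  Mop S c e f (x + z) = Mop S (fun k => c k * cos (phase k z) - e k * sin (phase k z))
     (fun k => c k * sin (phase k z) + e k * cos (phase k z)) f x.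
Proof. by apply: eq_bigr => k _; rewrite phaseD cosD sinD; ring. Qed.

End multipliers.

(** * Fejer-type approximation *)

Section trigonometric_bounds.
Context {R : realType}.
Implicit Types x : R.

Lemma sin_le_id x : 0 <= x -> sin x <= x.
Proof.
move=> x0; have [c _] := @MVT_any R sin cos 0 x (fun z _ => is_derive_sin z).
rewrite sin0 !subr0 => ->; rewrite -[leRHS]mul1r; apply: ler_wpM2r => //.
Qed.

Lemma cos_ge_quad x : 1 - x ^+ 2 / 2 <= cos x.
Proof.
wlog x0 : x / 0 <= x.
  move=> H; have [/H //|/ltW x0] := leP 0 x.
  by rewrite -cosN -sqrrN; apply: H; rewrite oppr_ge0.
have D z : is_derive z (1 : R) (fun y => cos y - (1 - 2^-1 * (y * y))) (- sin z - (0 - 2^-1 * (1 * z + z * 1))).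
  exact: (deriB (is_derive_cos z) (deriB (deri_cst 1 z 1)
    (deriZ 2^-1 (deriM (is_derive_id z 1) (is_derive_id z 1))))).
have [c] := @MVT_any R _ _ 0 x (fun z _ => D z).
rewrite (min_idPl x0) cos0 => /andP[c0 _]; have := sin_le_id c0 => sc e.
have : 0 <= (- sin c - (0 - 2^-1 * (1 * c + c * 1))) * (x - 0) by rewrite mulr_ge0; lra.
rewrite -e; rewrite expr2; lra.
Qed.

Lemma sin_ge_half_id x : 0 <= x <= 1 -> x / 2 <= sin x.
Proof.
move=> /andP[x0 x1]; have [c] := @MVT_any R sin cos 0 x (fun z _ => is_derive_sin z).
rewrite (min_idPl x0) (max_idPr x0) sin0 !subr0 => /andP[c0 cx] ->.
by rewrite mulrC; apply: ler_wpM2r => //; have := cos_ge_quad c; nra.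
Qed.

(** If [pi * a <= 1], the sine is at least half its argument and [pi >= 2]. Otherwise monotonicity
    of the sine up to [pi / 2] gives at least sin 1 >= 1/2 >= a. *)
Lemma norm_le_sinpi (a : R) : `|a| <= 1 / 2 -> `|a| <= `|sin (pi * a)|.
Proof.
wlog a0 : a / 0 <= a.
  move=> H; have [/H //|/ltW a0] := leP 0 a.
  by move=> h; have := H (- a); rewrite mulrN sinN !normrN; apply; rewrite ?oppr_ge0.
rewrite ger0_norm // => a2; apply: le_trans (ler_norm _).
have p2 := pi_ge2 R; have pa0 : 0 <= pi * a by apply: mulr_ge0 => //; lra.
have [h|h] := leP (pi * a) 1.
  by apply: le_trans (sin_ge_half_id _); [nra|apply/andP].
have ph : pi * a <= pi / 2 by rewrite ler_wpM2l //; lra.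
have h1 : sin 1 <= sin (pi * a).
  have [e|ne] := eqVneq 1 (pi * a); first by rewrite -e.
  apply: ltW; rewrite ltr_sin ?in_itv //=; apply/andP; split => //; lra.
by apply: le_trans h1; apply: le_trans (sin_ge_half_id _); [lra|apply/andP; split; lra].
Qed.

End trigonometric_bounds.

(** * A positive kernel with explicit Fourier coefficients *)

Section fejer.
Context {R : realType}.

Definition cis (a : R) : R[i] := Complex (cos a) (sin a).

Lemma cisD a b : cis (a + b) = cis a * cis b.
Proof. by apply/eqP; rewrite eq_complex /= cosD sinD eqxx (addrC (sin a * _)) eqxx. Qed.

Lemma cis0 : cis 0 = 1.
Proof. by rewrite /cis cos0 sin0. Qed.

Lemma cisMn a n : cis (n%:R * a) = cis a ^+ n.
Proof.
elim: n => [|n IH]; first by rewrite mul0r cis0 expr0.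
by rewrite exprS -IH -cisD; congr cis; rewrite -natr1; ring.
Qed.

Lemma cis_sum (I : Type) (r : seq I) (P : pred I) (F : I -> R) :
  cis (\sum_(i <- r | P i) F i) = \prod_(i <- r | P i) cis (F i).
Proof. exact: (big_morph cis cisD cis0). Qed.

Lemma add1_cis a : 1 + cis (2 * a) = (2 * cos a)%:C%C * cis a.
Proof.
apply/eqP; rewrite eq_complex /=.
have -> : 2 * a = a + a by ring.
rewrite cosD sinD; have := cos2Dsin2 a; rewrite !expr2 => h.
apply/andP; split; apply/eqP; last by ring.
by rewrite mul0r subr0 -{1}h; ring.
Qed.

(** Binomial expansion of (1 + e^(2ia))^(2n) = (2 cos a)^(2n) e^(2nia), recentred by the factor
    e^(-2nia). *)
Lemma sum_binom_cis n (a : R) :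
  \sum_(m < n.*2.+1) ('C(n.*2, m)%:R)%:C%C * cis (2 * a * (m%:R - n%:R))
  = ((2 * cos a) ^+ n.*2)%:C%C.
Proof.
transitivity (cis (- (n.*2%:R * a)) * (1 + cis (2 * a)) ^+ n.*2).
  rewrite exprDn mulr_sumr; apply: eq_bigr => m _.
  rewrite expr1n mul1r -cisMn mulrnAr -cisD -[RHS]mulr_natr [RHS]mulrC rmorph_nat; congr (_ * cis _).
  have -> : n.*2%:R = 2 * n%:R :> R by rewrite -muln2 natrM mulrC.
  by ring.
rewrite add1_cis exprMn mulrCA -cisMn -cisD addNr cis0 mulr1.
by rewrite rmorphXn.
Qed.

Context (d : nat).
Notation V := 'rV[R]_d.
Notation K := 'rV[int]_d.

Definition box_vec n (F : {ffun 'I_d -> 'I_n.*2.+1}) : K := \row_i ((F i)%:Z - n%:Z).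
Definition box n : seq K := [seq box_vec F | F <- enum {ffun 'I_d -> 'I_n.*2.+1}].
(** Coefficient of the kernel at frequency [m], meaningful for |m| <= n. For [m < - n] the absolute
    value folds the index back to an irrelevant number; [box] excludes these frequencies, and the
    bounds 0 <= wt <= 1 hold for them all the same. *)
Definition wt1 n (m : int) : R := 'C(n.*2, absz (m + n%:Z))%:R / 'C(n.*2, n)%:R.
Definition wt n (k : K) : R := \prod_i wt1 n (k 0 i).
(** Tensor product of de la Vallee Poussin kernels. Positivity is visible from the even power, and
    the coefficient at a unit frequency has the closed form n / (n + 1), which measures the
    concentration at 0. *)
Definition fejer n (y : V) : R := \prod_i ((2 * cos (pi * y 0 i)) ^+ n.*2 / 'C(n.*2, n)%:R).

Lemma box_vec_inj n : injective (@box_vec n).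
Proof.
move=> F G /rowP FG; apply/ffunP => i; apply/val_inj; have := FG i; rewrite !mxE.
by move=> /addIr [].
Qed.

Lemma mem_box n k : (k \in box n) = [forall i, (absz (k 0%R i) <= n)%N].
Proof.
apply/mapP/forallP => [[F _ ->] i|H].
  by rewrite mxE; have := ltn_ord (F i); move: (nat_of_ord (F i)) => a; rewrite -addnn => ?; lia.
have H' i : (absz (k 0%R i + n%:Z)%R < n.*2.+1)%N by have := H i; move: (k 0 i) => a; rewrite -?addnn; lia.
exists [ffun i => Ordinal (H' i)]; first by rewrite mem_enum.
by apply/rowP => i; rewrite mxE ffunE /=; have := H i; move: (k 0 i) => a; rewrite -?addnn; lia.
Qed.

Lemma box_symmetric n : symmetric_freq (box n).
Proof.
split; first by rewrite map_inj_uniq ?enum_uniq //; exact: box_vec_inj.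
move=> k; rewrite !mem_box => /forallP H; apply/forallP => i; have := H i.
by rewrite mxE abszN.
Qed.

Lemma sum_wt_cis n (y : V) :
  \sum_(k <- box n) (wt n k)%:C%C * cis (phase k y) = (fejer n y)%:C%C.
Proof.
rewrite big_map big_enum /=.
rewrite (eq_bigr (fun F : {ffun 'I_d -> 'I_n.*2.+1} =>
   \prod_i (('C(n.*2, F i)%:R / 'C(n.*2, n)%:R)%:C%C * cis (2 * (pi * y 0 i) * ((F i)%:R - n%:R))))).
  rewrite -(bigA_distr_bigA (fun i (m : 'I_n.*2.+1) =>
     ('C(n.*2, m)%:R / 'C(n.*2, n)%:R)%:C%C * cis (2 * (pi * y 0 i) * (m%:R - n%:R)))).
  rewrite /fejer rmorph_prod; apply: eq_bigr => i _.
  rewrite rmorphM /= -sum_binom_cis mulr_suml; apply: eq_bigr => m _.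
  by rewrite rmorphM /= mulrAC.
move=> F _; rewrite big_split /= -cis_sum; congr (_ * cis _).
  rewrite /wt rmorph_prod; apply: eq_bigr => i _; rewrite /wt1 mxE subrK.
  by rewrite absz_nat.
rewrite phaseE; apply: eq_bigr => i _; rewrite /wave mxE rmorphB /= -!pmulrn; ring.
Qed.

Lemma sum_wt_cos n (y : V) : \sum_(k <- box n) wt n k * cos (phase k y) = fejer n y.
Proof.
have := congr1 (@complex.Re R) (sum_wt_cis n y).
rewrite (raddf_sum (@complex.Re R)) /= => <-; apply: eq_bigr => k _ /=.
by rewrite mul0r subr0.
Qed.

Lemma fejer_ge0 n (y : V) : 0 <= fejer n y.
Proof.
apply: prodr_ge0 => i _; rewrite mulr_ge0 ?invr_ge0 ?ler0n //.
by rewrite -muln2 exprM sqr_ge0.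
Qed.

Lemma wt1_0 n : wt1 n 0 = 1.
Proof. by rewrite /wt1 add0r absz_nat divff // pnatr_eq0 -lt0n bin_gt0 -addnn leq_addr. Qed.

Lemma bin_center_ge n m : ('C(n.*2, m) <= 'C(n.*2, n))%N.
Proof.
wlog mn : m / (m <= n)%N.
  move=> H; have [/H //|nm] := leqP m n.
  have [m2|m2] := leqP m n.*2; last by rewrite bin_small.
  by rewrite -bin_sub //; apply: H; lia.
have [j ->] : exists j, m = (n - j)%N by exists (n - m)%N; lia.
elim: j => [|j IH]; first by rewrite subn0.
apply: leq_trans IH; have [jn|jn] := ltnP j n; last first.
  by have -> : (n - j.+1 = n - j)%N by lia.
have -> : (n - j = (n - j.+1).+1)%N by lia.
rewrite -(leq_pmul2l (m := (n - j.+1).+1)) // mul_bin_left.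
by rewrite leq_mul2r; apply/orP; right; lia.
Qed.

Lemma wt1_1 n : (0 < n)%N -> wt1 n 1 = n%:R / n.+1%:R.
Proof.
move=> n0; have b0 : 'C(n.*2, n)%:R != 0 :> R by rewrite pnatr_eq0 -lt0n bin_gt0 -addnn leq_addr.
rewrite /wt1 (_ : absz (1 + n%:Z) = n.+1); last by lia.
have := mul_bin_left n.*2 n; rewrite (_ : n.*2 - n = n)%N; last by lia.
move=> /(congr1 (fun m => m%:R : R)); rewrite !natrM => h.
have n1 : n.+1%:R != 0 :> R by rewrite pnatr_eq0.
by apply/eqP; rewrite (eqr_div _ _ b0 n1) mulrC h.
Qed.

Lemma wt1_N1 n : (0 < n)%N -> wt1 n (- 1) = n%:R / n.+1%:R.
Proof.
move=> n0; rewrite -wt1_1 // /wt1; congr (_%:R / _).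
have -> : absz (-1 + n%:Z)%R = (n.*2 - absz (1 + n%:Z)%R)%N by lia.
by rewrite bin_sub //; lia.
Qed.

Lemma wt_ge0 n k : 0 <= wt n k.
Proof. by apply: prodr_ge0 => i _; rewrite mulr_ge0 ?invr_ge0 ?ler0n. Qed.

Lemma wt_le1 n k : wt n k <= 1.
Proof.
have h (i : 'I_d) : 0 <= wt1 n (k 0 i) <= 1; last first.
  have : 0 <= wt n k <= 1; last by case/andP.
  rewrite /wt; elim/big_ind : _ => [|a b /andP[a0 a1] /andP[b0 b1]|i _]; rewrite ?h ?ler01 ?lexx //.
  by rewrite mulr_ge0 // mulr_ile1.
rewrite mulr_ge0 ?invr_ge0 ?ler0n //=.
rewrite ler_pdivrMr ?mul1r ?ler_nat ?bin_center_ge //.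
by rewrite ltr0n bin_gt0 -addnn leq_addr.
Qed.

Lemma wt0 n : wt n 0 = 1.
Proof. by rewrite /wt big1 // => i _; rewrite mxE wt1_0. Qed.

Lemma wt_delta n i : (0 < n)%N -> wt n (delta_mx 0 i) = n%:R / n.+1%:R.
Proof.
move=> n0; rewrite /wt (bigD1 i) //= mxE !eqxx wt1_1 // big1 ?mulr1 // => j ji.
by rewrite mxE (negPf ji) andbF wt1_0.
Qed.

Lemma wt_deltaN n i : (0 < n)%N -> wt n (- delta_mx 0 i) = n%:R / n.+1%:R.
Proof.
move=> n0; rewrite /wt (bigD1 i) //= !mxE !eqxx wt1_N1 // big1 ?mulr1 // => j ji.
by rewrite !mxE (negPf ji) andbF oppr0 wt1_0.
Qed.

Lemma cper_fejer n : cper (@fejer n).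
Proof.
have -> : @fejer n = fun y => \sum_(k <- box n) wt n k * cos (phase k y).
  by apply/funext => y; rewrite sum_wt_cos.
by apply: cper_sum => k _; apply: cperZ; exact: cper_cos.
Qed.

Definition Qn n (f : V -> R) : V -> R := Mop (box n) (@wt n) (fun=> 0) f.

(** This exhibits [Qn] as an average of translates against a positive weight of mass 1, which is
    what makes the uniform error estimate possible. *)
Lemma Qn_conv n (f : V -> R) x : cper f ->
  Qn n f x = torus_int (fun y => f (y + x) * fejer n y).
Proof.
move=> fp; have [fc _] := fp.
have [fsc _] := cper_shift x fp.
have cc k : continuous (fun y : V => cos (phase k y)) by case: (@cper_cos R d k).
rewrite (_ : (fun y => _) = fun y => \sum_(k <- box n) wt n k * (f (y + x) * cos (phase k y))); last first.
  by apply/funext => y; rewrite -sum_wt_cos mulr_sumr; apply: eq_bigr => k _; ring.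
rewrite torus_int_sum; last by move=> k _; apply: contZ; exact: contM.
apply: eq_bigr => k _; rewrite torus_intZ; last exact: contM.
by rewrite -/(ca (fun y => f (y + x)) k) ca_shift // mul0r addr0; ring.
Qed.

Lemma torus_int_fejer n : torus_int (@fejer n) = 1.
Proof.
have cc k : continuous (fun y : V => cos (phase k y)) by case: (@cper_cos R d k).
have -> : @fejer n = fun y => \sum_(k <- box n) wt n k * cos (phase k y).
  by apply/funext => y; rewrite sum_wt_cos.
rewrite torus_int_sum; last by move=> k _; exact: contZ.
rewrite (eq_bigr (fun k => wt n k * (k == 0)%:R)); last first.
  by move=> k _; rewrite torus_intZ // torus_int_cos.
rewrite sum_pick ?wt0 ?(box_symmetric n).1 // mem_box.
by apply/forallP => i; rewrite mxE.
Qed.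

(** Since sin^2 (pi y) = (1 - cos (2 pi y)) / 2, only the frequencies 0 and +-e_i are tested, and
    the value is (1 - n / (n + 1)) / 2. *)
Lemma torus_int_fejer_sin2 n i : (0 < n)%N ->
  torus_int (fun y : V => sin (pi * y 0 i) ^+ 2 * fejer n y) = (2 * n.+1%:R)^-1.
Proof.
move=> n0; have cc k : continuous (fun y : V => cos (phase k y)) by case: (@cper_cos R d k).
pose dl : K := delta_mx 0 i.
have dE (y : V) : sin (pi * y 0 i) ^+ 2 = 2^-1 - 2^-1 * cos (phase dl y).
  have -> : phase dl y = pi * y 0 i + pi * y 0 i.
    rewrite phaseE (bigD1 i) //= /wave mxE !eqxx (_ : (true && true)%:R%:~R = 1 :> R) // big1 ?addr0; first by ring.
    by move=> j ji; rewrite mxE (negPf ji) andbF mulr0 mul0r.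
  by rewrite cosD -!expr2 cos2sin2; field.
have [fc _] := @cper_fejer n.
have cf : continuous (fun y => cos (phase dl y) * fejer n y) by exact: contM.
rewrite (_ : (fun y => _) = fun y => 2^-1 * fejer n y - 2^-1 * (cos (phase dl y) * fejer n y)); last first.
  by apply/funext => y; rewrite dE; ring.
rewrite torus_intB ?torus_intZ ?torus_int_fejer //; [|exact: contZ..].
have dl_box : dl \in box n.
  rewrite mem_box; apply/forallP => j; rewrite !mxE; case: eqP => _ //=; case: eqP => _ //=; lia.
have -> : torus_int (fun y => cos (phase dl y) * fejer n y) = n%:R / n.+1%:R.
  rewrite (_ : (fun y => _) = fun y => \sum_(k <- box n) wt n k * (cos (phase k y) * cos (phase dl y))); last first.
    by apply/funext => y; rewrite -sum_wt_cos mulr_sumr; apply: eq_bigr => k _; ring.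
  rewrite torus_int_sum; last by move=> k _; apply: contZ; exact: contM.
  rewrite (eq_bigr (fun k => 2^-1 * (wt n k * (k == dl)%:R) + 2^-1 * (wt n k * (k == - dl)%:R))); last first.
    move=> k _; rewrite torus_intZ; last exact: contM.
    by rewrite -/(ca (fun y => cos (phase k y)) dl) ca_cos; ring.
  have [uB sB] := box_symmetric n.
  by rewrite big_split /= -!mulr_sumr !sum_pick ?sB // wt_delta // wt_deltaN //; field.
have n1 : n.+1%:R != 0 :> R by rewrite pnatr_eq0.
by rewrite -natr1 in n1 *; field.
Qed.

(** Only derivatives along the axes are available, so the increment is made one coordinate at a
    time; this is why the l^1 norm appears. *)
Lemma lipschitz_coord (f : V -> R) (f' : 'I_d -> V -> R) (L : R) :
  (forall i, has_dx i f (f' i)) -> (forall i x, `|f' i x| <= L) ->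
  forall (x y : V), `|f (x + y) - f x| <= L * \sum_i `|y 0 i|.
Proof.
move=> df fL x y.
have H (r : seq 'I_d) : forall z : V, `|f (z + \sum_(i <- r) y 0 i *: delta_mx 0 i) - f z| <= L * \sum_(i <- r) `|y 0 i|.
  elim: r => [|i r IH] z; first by rewrite !big_nil addr0 subrr normr0 mulr0.
  rewrite !big_cons mulrDr addrA; set z' := z + _; set w := \sum_(j <- r) _.
  have -> : f (z' + w) - f z = (f z' - f z) + (f (z' + w) - f z') by ring.
  apply: le_trans (ler_normD _ _) _; apply: lerD; last exact: IH.
  have dl (s : R) : is_derive s (1 : R) (fun s : R => f (z + s *: delta_mx 0 i)) (f' i (z + s *: delta_mx 0 i)).
    by apply: is_derive_line; exact: df.
  have [c _] := @MVT_any R _ _ 0 (y 0 i) (fun s _ => dl s).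
  rewrite scale0r addr0 subr0 => ->; rewrite normrM; apply: ler_wpM2r => //; exact: fL.
have {1}-> : y = \sum_i y 0 i *: delta_mx 0 i.
  by rewrite [LHS]matrix_sum_delta big_ord1.
exact: H.
Qed.

(** A coordinate above 1/2 is moved by -1 into [-1/2, 1/2], which periodicity allows. The sine is a
    periodic substitute for the distance to the nearest integer, with an explicitly computable
    second moment against the kernel. *)
Lemma lipschitz_torus (f : V -> R) (f' : 'I_d -> V -> R) (L : R) : Zperiodic f ->
  (forall i, has_dx i f (f' i)) -> (forall i x, `|f' i x| <= L) -> 0 <= L ->
  forall (x y : V), (forall i, 0 <= y 0 i <= 1) ->
  `|f (x + y) - f x| <= L * \sum_i `|sin (pi * y 0 i)|.
Proof.
move=> fp df fL L0 x y y01.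
pose k : K := \row_i (if y 0 i <= 1 / 2 then 0 else - 1).
rewrite -(fp _ k) -addrA; apply: le_trans (lipschitz_coord df fL _ _) _.
apply: ler_wpM2l => //; apply: ler_sum => i _.
rewrite !mxE; have /andP[yi0 yi1] := y01 i; case: ifPn => yi.
  by rewrite addr0; apply: norm_le_sinpi; rewrite ger0_norm.
rewrite -ltNge in yi.
have -> : `|sin (pi * y 0 i)| = `|sin (pi * (y 0 i + (-1)%:~R))|.
  by rewrite (_ : (-1)%:~R = -1 :> R) // mulrDr mulrN1 sinB cospi sinpi mulr0 subr0 mulrN1 normrN.
by apply: norm_le_sinpi; rewrite (_ : (-1)%:~R = -1 :> R) // ler0_norm; lra.
Qed.

Lemma torus_int_norm_le_cube (f g : V -> R) : continuous f -> continuous g ->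
  (forall x : V, (forall i, 0 <= x 0 i <= 1) -> `|f x| <= g x) -> `|torus_int f| <= torus_int g.
Proof.
move=> fc gc fg; rewrite ler_norml -torus_intN //; apply/andP; split.
  by apply: torus_int_le_cube => //; [exact: contN|move=> x /fg; rewrite ler_norml => /andP[]].
by apply: torus_int_le_cube => // x /fg; rewrite ler_norml => /andP[].
Qed.

(** The degree [n] is chosen before the function: it depends on [eta] and the dimension only. This
    uniformity is what later permits a single truncation for all times of a bounded interval. *)
Lemma Qn_approx (eta : R) : 0 < eta -> exists n, forall (f : V -> R) (f' : 'I_d -> V -> R) (L : R),
  cper f -> (forall i, has_dx i f (f' i)) -> (forall i x, `|f' i x| <= L) -> 0 <= L ->
  forall x, `|f x - Qn n f x| <= L * eta.
Proof.
move=> eta0; have dp : 0 < 2 * d.+1%:R :> R by rewrite mulr_gt0 ?ltr0n.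
(* Each coordinate will contribute at most [2 * dl]; dividing by [d.+1] instead of [d] keeps the
   quotient meaningful in dimension 0. *)
pose dl := eta / (2 * d.+1%:R); have dl0 : 0 < dl by rewrite divr_gt0.
have [n0 hn] : exists n : nat, dl^-1 * (2 * n.+1%:R)^-1 <= dl.
  exists (Num.truncn (dl^-1 * dl^-1)).
  set n := Num.truncn _; have := truncnS_gt (dl^-1 * dl^-1); rewrite -/n => h.
  have np : 0 < 2 * n.+1%:R :> R by rewrite mulr_gt0 ?ltr0n.
  have dV0 : 0 < dl^-1 by rewrite invr_gt0.
  rewrite ler_pdivrMr // -(ler_pM2l dV0).
  rewrite [leRHS]mulrA mulVf ?mul1r ?lt0r_neq0 //; apply: le_trans (ltW h) _.
  by rewrite ler_peMl ?ler0n // ler1n.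
exists n0.+1 => f f' L fp df fL L0 x; set n := n0.+1.
have nn0 : (0 < n)%N by [].
have hn' : dl^-1 * (2 * n.+1%:R)^-1 <= dl.
  apply: le_trans hn; rewrite ler_pM2l ?invr_gt0 // lef_pV2 ?posrE ?mulr_gt0 ?ltr0n //.
  by rewrite ler_pM2l // ler_nat.
rewrite Qn_conv // -[f x]mulr1 -(torus_int_fejer n) -torus_intZ; last by case: (@cper_fejer n).
have [Fc _] := @cper_fejer n; have [fsc _] := cper_shift x fp.
rewrite -torus_intB; [|exact: contZ|exact: contM].
have sc i : continuous (fun y : V => sin (pi * y 0 i) ^+ 2 * fejer n y).
  apply: contM => //; apply: contX; apply: cont_comp; first exact: continuous_sin.
  by apply: contZ; exact: coord_continuous.
(* Uses |s| <= dl + s^2 / dl, because only the second moment of the sine against the kernel is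
   known. *)
pose G (y : V) := L * \sum_i (dl * fejer n y + dl^-1 * (sin (pi * y 0 i) ^+ 2 * fejer n y)).
apply: (@le_trans _ _ (torus_int G)).
  apply: torus_int_norm_le_cube.
  - by apply: contB; [exact: contZ|exact: contM].
  - by apply: contZ; apply: cont_sum => i _; apply: contD; exact: contZ.
  move=> y y01; rewrite -mulrBl normrM (ger0_norm (fejer_ge0 n y)) distrC (addrC y x).
  apply: le_trans (ler_wpM2r (fejer_ge0 n y) (lipschitz_torus fp.2 df fL L0 x y01)) _.
  rewrite -mulrA ler_wpM2l // mulr_suml; apply: ler_sum => i _.
  rewrite mulrA -mulrDl; apply: ler_wpM2r; first exact: fejer_ge0.
  rewrite -(ler_pM2l dl0) mulrDr mulVKf ?lt0r_neq0 // -real_normK ?num_real //.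
  by move: `|sin _| => s; nra.
rewrite torus_intZ; last by apply: cont_sum => i _; apply: contD; exact: contZ.
rewrite ler_wpM2l // torus_int_sum; last by move=> i _; apply: contD; exact: contZ.
rewrite (eq_bigr (fun=> dl + dl^-1 * (2 * n.+1%:R)^-1)); last first.
  by move=> i _; rewrite torus_intD ?torus_intZ ?torus_int_fejer ?torus_int_fejer_sin2 ?mulr1 //; exact: contZ.
rewrite sumr_const card_ord -[leLHS]mulr_natr.
apply: (@le_trans _ _ ((dl + dl) * d.+1%:R)).
  apply: ler_pM; rewrite ?ler0n ?ler_nat ?leqnSn //.
    by rewrite addr_ge0 ?(ltW dl0) // mulr_ge0 // invr_ge0 ?(ltW dl0) // mulr_ge0 ?ler0n.
  exact: lerD.
rewrite le_eqVlt; apply/orP; left; apply/eqP; rewrite /dl.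
by move: (d.+1%:R) dp => D dp; field; rewrite lt0r_neq0; lra.
Qed.

End fejer.

(** * Powers as mixtures of exponentials *)

Section laplace_cone.
Context {R : realType}.
Implicit Types (g : R -> R) (x y : R).

Lemma cvg_harmonic_bound (u : nat -> R) (l C : R) :
  (forall n, `|u n - l| <= C / n.+1%:R) -> u @ \oo --> l.
Proof.
move=> H; apply/cvgrPdist_le => e e0.
have : (fun n => C * harmonic n) @ \oo --> C * 0 by apply: cvgMr; exact: cvg_harmonic.
rewrite mulr0 => /cvgrPdist_le /(_ e e0); apply: filterS => n hn.
rewrite distrC; apply: le_trans (H n) _.
by move: hn; rewrite sub0r normrN; apply: le_trans; exact: ler_norm.
Qed.

(* [laplace_mixture g] : g is nonnegative on every discrete signed measure whose
   Laplace transform is nonnegative, i.e. g lies in the closed cone spanned by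
   the exponentials [expR (- tau x)], [tau >= 0]. *)
Definition laplace_mixture g := forall s : seq (R * R),
  (forall p, p \in s -> 0 < p.2) ->
  (forall tau, 0 <= tau -> 0 <= \sum_(p <- s) p.1 * expR (- (tau * p.2))) ->
  0 <= \sum_(p <- s) p.1 * g p.2.

Lemma mixture_exp tau : 0 <= tau -> laplace_mixture (fun x => expR (- (tau * x))).
Proof. by move=> t0 s _ H; exact: H. Qed.

Lemma eq_mixture g g' : (forall x, 0 < x -> g x = g' x) -> laplace_mixture g -> laplace_mixture g'.
Proof.
move=> E H s sp sH; have := H s sp sH.
by rewrite !big_seq (eq_bigr (fun p => p.1 * g' p.2)) // => p /sp /E ->.
Qed.

Lemma mixture1 : laplace_mixture (fun=> 1).
Proof.
apply: eq_mixture (mixture_exp (lexx 0)) => x _; by rewrite mul0r oppr0 expR0.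
Qed.

Lemma mixtureD g g' : laplace_mixture g -> laplace_mixture g' ->
  laplace_mixture (fun x => g x + g' x).
Proof.
move=> H H' s sp sH; have := addr_ge0 (H s sp sH) (H' s sp sH).
by rewrite -big_split /=; under eq_bigr do rewrite -mulrDr.
Qed.

Lemma mixtureZ c g : 0 <= c -> laplace_mixture g -> laplace_mixture (fun x => c * g x).
Proof.
move=> c0 H s sp sH; have := mulr_ge0 c0 (H s sp sH).
by rewrite mulr_sumr; under eq_bigr do rewrite mulrCA.
Qed.

(** Multiplying the weights by e^(-tau x) shifts the Laplace transform by [tau], so it stays
    nonnegative and [g] can be applied. The result says that the weights multiplied by [g] again
    have nonnegative Laplace transform, and [g'] applies to them. *)
Lemma mixtureM g g' : laplace_mixture g -> laplace_mixture g' ->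
  laplace_mixture (fun x => g x * g' x).
Proof.
move=> H H' s sp sH.
have E (f : R * R -> R) : \sum_(p <- [seq (p.1 * g p.2, p.2) | p <- s]) f p
   = \sum_(p <- s) f (p.1 * g p.2, p.2) by rewrite big_map.
have := H' [seq (p.1 * g p.2, p.2) | p <- s].
rewrite E /= (eq_bigr (fun p => p.1 * (g p.2 * g' p.2))); last by move=> p _; rewrite mulrA.
apply; first by move=> p /mapP[q qs ->] /=; exact: sp.
move=> tau t0; rewrite E /=.
have E' (f : R * R -> R) : \sum_(p <- [seq (p.1 * expR (- (tau * p.2)), p.2) | p <- s]) f p
   = \sum_(p <- s) f (p.1 * expR (- (tau * p.2)), p.2) by rewrite big_map.
have := H [seq (p.1 * expR (- (tau * p.2)), p.2) | p <- s].
rewrite E' /= (eq_bigr (fun p => p.1 * g p.2 * expR (- (tau * p.2)))); last by move=> p _; rewrite mulrAC.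
apply; first by move=> p /mapP[q qs ->] /=; exact: sp.
move=> r r0; rewrite E' /=; have := sH (tau + r) (addr_ge0 t0 r0).
by congr (_ <= _); apply: eq_bigr => p _; rewrite -mulrA -expRD mulrDl opprD.
Qed.

Lemma mixture_sum n (F : nat -> R -> R) : (forall i, laplace_mixture (F i)) ->
  laplace_mixture (fun x => \sum_(i < n) F i x).
Proof.
move=> H; elim: n => [|n IH].
  apply: (@eq_mixture (fun x => 0 * 1)); last exact: mixtureZ mixture1.
  by move=> x _; rewrite big_ord0 mul0r.
apply: (eq_mixture _ (mixtureD IH (H n))) => x _; by rewrite big_ord_recr.
Qed.

Lemma mixture_prod n (F : nat -> R -> R) : (forall i, laplace_mixture (F i)) ->
  laplace_mixture (fun x => \prod_(i < n) F i x).
Proof.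
move=> H; elim: n => [|n IH].
  by apply: (eq_mixture _ mixture1) => x _; rewrite big_ord0.
apply: (eq_mixture _ (mixtureM IH (H n))) => x _; by rewrite big_ord_recr.
Qed.

(** The test measures are finite sums, so pointwise convergence on x > 0 is enough. *)
Lemma mixture_lim (G : nat -> R -> R) g : (forall n, laplace_mixture (G n)) ->
  (forall x, 0 < x -> (fun n => G n x) @ \oo --> g x) -> laplace_mixture g.
Proof.
move=> HG Gg s sp sH.
have C : (fun n => \sum_(p <- s) p.1 * G n p.2) @ \oo --> \sum_(p <- s) p.1 * g p.2.
  elim: s sp {sH} => [|p s IH] sp.
    by under eq_fun do rewrite big_nil; rewrite big_nil; exact: cvg_cst.
  under eq_fun do rewrite big_cons; rewrite big_cons; apply: cvgD.
    by apply: cvgMr; apply: Gg; apply: sp; rewrite mem_head.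
  by apply: IH => q qs; apply: sp; rewrite inE qs orbT.
rewrite -(cvg_lim _ C) //; apply: limr_ge; first by apply/cvg_ex; eexists; exact: C.
by near=> n; exact: HG.
Unshelve. all: by end_near. Qed.

(** 1 / (x + a) is the integral of e^(-tau (x + a)) over tau >= 0. [G] is its left Riemann sum on
    [0, N] with mesh 1 / N, N = n + 1, a geometric sum in closed form. *)
Lemma mixture_inv a : 0 <= a -> laplace_mixture (fun x => (x + a)^-1).
Proof.
move=> a0.
pose G (n : nat) x := n.+1%:R^-1 * \sum_(j < n.+1 * n.+1) expR (- ((j%:R / n.+1%:R) * a)) * expR (- ((j%:R / n.+1%:R) * x)).
apply: (@mixture_lim G).
  move=> n; apply: mixtureZ; first by rewrite invr_ge0 ler0n.
  apply: (@mixture_sum _ (fun j x => expR (- ((j%:R / n.+1%:R) * a)) * expR (- ((j%:R / n.+1%:R) * x)))) => j.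
  by apply: mixtureZ; [exact: expR_ge0|apply: mixture_exp; rewrite divr_ge0 ?ler0n].
move=> x x0; set y := x + a; have y0 : 0 < y by rewrite ltr_wpDr.
apply: (@cvg_harmonic_bound _ _ (1 + y^-1 ^+ 2)) => n.
set N : R := n.+1%:R; have N0 : 0 < N by rewrite ltr0n.
pose q := expR (- (y / N)); have q0 : 0 < q by exact: expR_gt0.
have q1 : q < 1 by rewrite expR_lt1 oppr_lt0 divr_gt0.
have GE : G n x = N^-1 * ((1 - q ^+ (n.+1 * n.+1)) / (1 - q)).
  rewrite /G -/N; congr (_ * _).
  rewrite (eq_bigr (fun j : 'I_(n.+1 * n.+1) => q ^+ j)); last first.
    by move=> j _; rewrite -expRD /q -expRM_natl; congr expR; rewrite /y; field; rewrite gt_eqF.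
  have := subrX1 q (n.+1 * n.+1); set S := \sum_(j < _) _; set m := q ^+ _ => h.
  have p0 : 1 - q != 0 by rewrite subr_eq0 gt_eqF.
  by apply: (mulIf p0); rewrite divfK // -opprB mulrN mulrC -h opprB.
have qN : q ^+ (n.+1 * n.+1) = expR (- (N * y)).
  by rewrite -expRM_natl natrM -/N; congr expR; field; rewrite gt_eqF.
have h1 : 1 - q <= y / N by rewrite lerBlDl -lerBlDr; exact: expR_ge1Dx.
have h2 : (1 + y / N) * q <= 1.
  have := expR_ge1Dx (y / N); rewrite -(ler_pM2r q0) => /le_trans; apply.
  by rewrite /q -expRD subrr expR0.
have h3 : expR (- (N * y)) * (N * y) <= 1.
  have := expR_ge1Dx (N * y); have e0 := expR_gt0 (- (N * y)).
  rewrite -(ler_pM2l e0) -expRD addNr expR0 mulrDr mulr1 => h.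
  by apply: le_trans h; rewrite lerDr ltW.
have e0 := expR_ge0 (- (N * y)).
move: h3 e0; rewrite -qN GE; set E := q ^+ _ => h3 e0.
have p0 : 0 < 1 - q by rewrite subr_gt0.
have Ny : 0 < N * y by rewrite mulr_gt0.
(* The upper error 1 / N is due to the mesh, the lower error y^(-2) / N to the tail beyond N. *)
have up : N^-1 * ((1 - E) / (1 - q)) - y^-1 <= N^-1.
  rewrite -(ler_pM2r Ny) -(ler_pM2r p0).
  rewrite (_ : (N^-1 * ((1 - E) / (1 - q)) - y^-1) * (N * y) * (1 - q) = y * (1 - E) - N * (1 - q)); last first.
    by field; rewrite !gt_eqF.
  rewrite (_ : N^-1 * (N * y) * (1 - q) = y * (1 - q)); last by field; rewrite gt_eqF.
  have h2' : (N + y) * q <= N.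
    by have := ler_wpM2l (ltW N0) h2; rewrite mulrA mulr1 mulrDr mulr1 mulrCA divff ?gt_eqF // mulr1.
  have := mulr_ge0 (ltW y0) e0; nra.
have lo : - (y^-1 ^+ 2 / N) <= N^-1 * ((1 - E) / (1 - q)) - y^-1.
  have E1 : E <= 1 by rewrite /E qN expR_le1 oppr_le0 ltW.
  have h1' : N * (1 - q) <= y by have := ler_wpM2l (ltW N0) h1; rewrite mulrCA divff ?gt_eqF // mulr1.
  have hA : (1 - E) * y^-1 <= N^-1 * ((1 - E) / (1 - q)).
    rewrite mulrCA -invfM ler_wpM2l ?subr_ge0 // lef_pV2 ?posrE ?mulr_gt0 //.
  have hE : E * y^-1 <= y^-1 ^+ 2 / N.
    rewrite expr2 -mulrA mulrC ler_wpM2l ?invr_ge0 ?(ltW y0) // -invfM -[leRHS]mul1r ler_pdivlMr ?mulr_gt0 //.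
    by rewrite (mulrC y).
  by rewrite lerBrDr; apply: le_trans hA; rewrite mulrBl mul1r addrC lerD2l lerN2.
rewrite ler_norml mulrDl mul1r; apply/andP; split.
  by apply: le_trans lo; rewrite opprD gerDr oppr_le0 invr_ge0 ltW.
by apply: le_trans up _; rewrite lerDl mulr_ge0 ?sqr_ge0 ?invr_ge0 ?ltW.
Qed.

Lemma ln1D_bounds y : 0 <= y -> y - y ^+ 2 <= ln (1 + y) <= y.
Proof.
move=> y0; have y1 : 0 < 1 + y by lra.
apply/andP; split; last by apply: le_ln1Dx; lra.
have h : ln ((1 + y)^-1) <= - (y / (1 + y)).
  have {1}-> : (1 + y)^-1 = 1 + - (y / (1 + y)) by field; rewrite gt_eqF.
  apply: le_ln1Dx; rewrite ltrN2 ltr_pdivrMr //; lra.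
rewrite lnV ?posrE // lerN2 in h; apply: le_trans h.
by rewrite ler_pdivlMr //; nra.
Qed.

(* prod_{i<n} (1 + p delta / (x + i delta)) with n delta = T approximates
   prod_{i<n} ((x + (i+1) delta) / (x + i delta)) ^ p, which telescopes. *)
Lemma mixture_ratio_powR (p T : R) : 0 < p -> 0 < T ->
  laplace_mixture (fun x => expR (p * (ln (x + T) - ln x))).
Proof.
move=> p0 T0.
pose dl (n : nat) : R := T / n.+1%:R.
have dl0 n : 0 < dl n by rewrite divr_gt0 ?ltr0n.
pose G (n : nat) x := \prod_(i < n.+1) (1 + p * dl n * (x + i%:R * dl n)^-1).
apply: (@mixture_lim G).
  move=> n; apply: (@mixture_prod _ (fun i x => 1 + p * dl n * (x + i%:R * dl n)^-1)) => i.
  apply: mixtureD; first exact: mixture1.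
  apply: mixtureZ; first by rewrite mulr_ge0 ?ltW.
  by apply: mixture_inv; rewrite mulr_ge0 ?ler0n ?ltW.
move=> x x0.
have GE n : G n x = expR (\sum_(i < n.+1) ln (1 + p * dl n * (x + i%:R * dl n)^-1)).
  rewrite expR_sum; apply: eq_bigr => i _; rewrite lnK // posrE.
  have xi : 0 < x + i%:R * dl n by rewrite ltr_wpDr // mulr_ge0 ?ler0n ?ltW.
  by rewrite ltr_pwDl // mulr_ge0 ?invr_ge0 ?mulr_ge0 ?ltW.
rewrite (_ : (fun n => G n x) = fun n => expR (\sum_(i < n.+1) ln (1 + p * dl n * (x + i%:R * dl n)^-1))); last first.
  by apply/funext => n; exact: GE.
apply: continuous_cvg; first exact: continuous_expR.
apply: (@cvg_harmonic_bound _ _ ((p ^+ 2 + p) * (T / x) ^+ 2)) => n.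
have tel : p * (ln (x + T) - ln x) = \sum_(i < n.+1) p * ln (1 + dl n * (x + i%:R * dl n)^-1).
  rewrite -mulr_sumr; congr (_ * _).
  transitivity (ln (x + n.+1%:R * dl n) - ln (x + 0%:R * dl n)).
    by rewrite mul0r addr0; congr (ln (_ + _) - _); rewrite /dl; field; rewrite nat1r pnatr_eq0.
  rewrite -(telescope_sumr (fun i => ln (x + i%:R * dl n)) (leq0n n.+1)) big_mkord.
  apply: eq_bigr => i _.
  have xi : 0 < x + i%:R * dl n by rewrite ltr_wpDr // mulr_ge0 ?ler0n ?ltW.
  have xi1 : 0 < x + i.+1%:R * dl n by rewrite ltr_wpDr // mulr_ge0 ?ler0n ?ltW.
  rewrite -ln_div ?posrE //; congr ln.
  by rewrite -natr1; field; rewrite gt_eqF.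
rewrite tel -sumrB; apply: le_trans (ler_norm_sum _ _ _) _.
(* Both logarithms agree with [p * y] up to second order in the mesh, so the n + 1 errors add up to
   O(1 / n). *)
have bnd (i : 'I_n.+1) : `|ln (1 + p * dl n * (x + i%:R * dl n)^-1) - p * ln (1 + dl n * (x + i%:R * dl n)^-1)|
    <= (p ^+ 2 + p) * (dl n / x) ^+ 2.
  have xi : x <= x + i%:R * dl n by rewrite lerDl mulr_ge0 ?ler0n ?ltW.
  have xi0 : 0 < x + i%:R * dl n by apply: lt_le_trans xi.
  set y := dl n * (x + i%:R * dl n)^-1; rewrite -mulrA -/y.
  have y0 : 0 <= y by rewrite mulr_ge0 ?invr_ge0 ?ltW.
  have yx : y <= dl n / x by rewrite ler_wpM2l ?(ltW (dl0 n)) // lef_pV2 ?posrE.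
  have y2 : y ^+ 2 <= (dl n / x) ^+ 2 by rewrite ler_sqr ?nnegrE // (le_trans y0).
  have /andP[a1 a2] := ln1D_bounds y0.
  have py0 : 0 <= p * y by rewrite mulr_ge0 // ltW.
  have /andP[b1 b2] := ln1D_bounds py0.
  apply: (@le_trans _ _ ((p ^+ 2 + p) * y ^+ 2)); last by rewrite ler_wpM2l // addr_ge0 ?sqr_ge0 // ltW.
  move: a1 a2 b1 b2; move: (ln (1 + y)) (ln (1 + p * y)) => A B a1 a2 b1 b2.
  have c1 : p * (y - y ^+ 2) <= p * A by rewrite ler_pM2l.
  have c2 : p * A <= p * y by rewrite ler_pM2l.
  have q0 := sqr_ge0 y; have q1 : 0 <= p * y ^+ 2 by rewrite mulr_ge0 // ltW.
  have q2 : 0 <= p ^+ 2 * y ^+ 2 by rewrite mulr_ge0 ?sqr_ge0.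
  by rewrite ler_norml; apply/andP; split; nra.
apply: le_trans (ler_sum _ (fun i _ => bnd i)) _.
rewrite sumr_const card_ord -[leLHS]mulr_natr /dl le_eqVlt; apply/orP; left; apply/eqP.
have N0 : n.+1%:R != 0 :> R by rewrite pnatr_eq0.
by move: (n.+1%:R) N0 => N N0; field; rewrite ?N0 ?gt_eqF.
Qed.

(** x^(-p) is the limit of T^(-p) ((x + T) / x)^p as T = n + 1 tends to infinity, the quotient being
    (1 + x / T)^p. *)
Lemma mixture_powRN (p : R) : 0 < p -> laplace_mixture (fun x => x `^ (- p)).
Proof.
move=> p0.
pose G (n : nat) x := expR (- (p * ln n.+1%:R)) * expR (p * (ln (x + n.+1%:R) - ln x)).
apply: (@mixture_lim G).
  by move=> n; apply: mixtureZ; [exact: expR_ge0|apply: mixture_ratio_powR; rewrite ?ltr0n].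
move=> x x0.
rewrite (_ : (fun n => G n x) = fun n => expR (- p * ln x + p * ln (1 + x / n.+1%:R))); last first.
  apply/funext => n; rewrite /G -expRD; congr expR.
  have N0 : 0 < n.+1%:R :> R by rewrite ltr0n.
  have -> : 1 + x / n.+1%:R = (x + n.+1%:R) / n.+1%:R.
    by field; rewrite nat1r pnatr_eq0.
  by rewrite ln_div ?posrE ?addr_gt0 //; ring.
rewrite /powR gt_eqF //; apply: continuous_cvg; first exact: continuous_expR.
apply: (@cvg_harmonic_bound _ _ (p * x)) => n.
rewrite addrC addKr; have N0 : 0 < n.+1%:R :> R by rewrite ltr0n.
have xn : 0 <= x / n.+1%:R by rewrite divr_ge0 ?ltW.
have /andP[_ h] := ln1D_bounds xn.
have h0 : 0 <= ln (1 + x / n.+1%:R) by apply: ln_ge0; rewrite lerDl.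
by rewrite ger0_norm ?mulr_ge0 ?(ltW p0) // -mulrA ler_pM2l.
Qed.

(** The hypothesis says that the signed measure with mass [C] at 1 and masses [- b i] at [x i] has a
    nonnegative Laplace transform; it is tested on the power. As 1^(-p) = 1, the constant [C]
    survives unchanged for every [p]. *)
Lemma laplace_power_bound (I : Type) (r : seq I) (b x : I -> R) (C p : R) :
  0 < p -> (forall i, 0 < x i) ->
  (forall tau, 0 <= tau -> \sum_(i <- r) b i * expR (- (tau * x i)) <= C * expR (- tau)) ->
  \sum_(i <- r) b i * x i `^ (- p) <= C.
Proof.
move=> p0 x0 H.
have E (f : R * R -> R) : \sum_(q <- (C, 1) :: [seq (- b i, x i) | i <- r]) f q
   = f (C, 1) + \sum_(i <- r) f (- b i, x i) by rewrite big_cons big_map.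
have := mixture_powRN p0; rewrite /laplace_mixture => /(_ ((C, 1) :: [seq (- b i, x i) | i <- r])).
rewrite E /= powR1 mulr1; under eq_bigr do rewrite mulNr; rewrite sumrN subr_ge0; apply.
  move=> q; rewrite inE => /predU1P[->|]; first by rewrite ltr01.
  elim: r {H E} => //= i r IH; rewrite inE => /predU1P[->|//]; exact: x0.
move=> tau t0; rewrite E /= mulr1; under eq_bigr do rewrite mulNr.
by rewrite sumrN subr_ge0; exact: H.
Qed.

End laplace_cone.

(** * Gaussian averages through random walks *)

Section taylor_bounds.
Context {R : realType}.
Implicit Types x y t : R.

Lemma sin_ge_cubic y : 0 <= y -> y - y ^+ 3 / 6 <= sin y.
Proof.
move=> y0.
have D z : is_derive z (1 : R) (fun y => sin y - (y - 6^-1 * (y * (y * y))))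
   (cos z - (1 - 6^-1 * (1 * (z * z) + z * (1 * z + z * 1)))).
  have did := is_derive_id z (1 : R).
  exact: (deriB (is_derive_sin z) (deriB did (deriZ 6^-1 (deriM did (deriM did did))))).
have [c _] := @MVT_any R _ _ 0 y (fun z _ => D z).
rewrite sin0 subr0 => e; have := cos_ge_quad c => h.
have : 0 <= (cos c - (1 - 6^-1 * (1 * (c * c) + c * (1 * c + c * 1)))) * y.
  by apply: mulr_ge0 => //; move: h; rewrite expr2; lra.
by rewrite -e !exprS expr0; lra.
Qed.

Lemma cos_le_quartic y : cos y <= 1 - y ^+ 2 / 2 + y ^+ 4 / 24.
Proof.
wlog y0 : y / 0 <= y.
  move=> H; have [/H //|/ltW y0] := leP 0 y.
  have := H (- y); rewrite cosN oppr_ge0 => /(_ y0).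
  by rewrite !(exprM _ 2 2) sqrrN.
have D z : is_derive z (1 : R) (fun y => 1 - 2^-1 * (y * y) + 24^-1 * ((y * y) * (y * y)) - cos y)
   (0 - 2^-1 * (1 * z + z * 1) + 24^-1 * ((1 * z + z * 1) * (z * z) + (z * z) * (1 * z + z * 1)) - (- sin z)).
  have did := is_derive_id z (1 : R); have d2 := deriM did did.
  exact: (deriB (deriD (deriB (deri_cst 1 z 1) (deriZ 2^-1 d2)) (deriZ 24^-1 (deriM d2 d2))) (is_derive_cos z)).
have [c] := @MVT_any R _ _ 0 y (fun z _ => D z).
rewrite (min_idPl y0) cos0 subr0 => /andP[c0 _] e; have := sin_ge_cubic c0 => h.
have : 0 <= (0 - 2^-1 * (1 * c + c * 1) + 24^-1 * ((1 * c + c * 1) * (c * c) + (c * c) * (1 * c + c * 1)) - (- sin c)) * y.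
  by apply: mulr_ge0 => //; move: h; rewrite !exprS expr0; lra.
by rewrite -e !exprS expr0; lra.
Qed.

Lemma norm_sin_sub y : `|sin y - y| <= `|y| ^+ 3.
Proof.
wlog y0 : y / 0 <= y.
  move=> H; have [/H //|/ltW y0] := leP 0 y.
  have := H (- y); rewrite sinN oppr_ge0 => /(_ y0).
  by rewrite -opprD !normrN.
have h1 := sin_ge_cubic y0; have h2 := sin_le_id y0.
have h3 : 0 <= y ^+ 3 by exact: exprn_ge0.
by rewrite (ger0_norm y0) ler_norml; apply/andP; split; lra.
Qed.

Lemma norm_expRN_sub t : 0 <= t -> `|expR (- t) - (1 - t)| <= t ^+ 2.
Proof.
move=> t0; have h1 := expR_ge1Dx (- t).
have h2 : expR (- t) <= (1 + t)^-1.
  by rewrite expRN lef_pV2 ?posrE ?expR_gt0 ?expR_ge1Dx //; lra.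
have h3 : (1 + t)^-1 <= 1 - t + t ^+ 2.
  by rewrite -[leLHS]mul1r ler_pdivrMr; [nra|lra].
by rewrite ler_norml; apply/andP; split; have := sqr_ge0 t; lra.
Qed.

Lemma norm_exprB_le (a b : R) n : `|a| <= 1 -> `|b| <= 1 ->
  `|a ^+ n - b ^+ n| <= n%:R * `|a - b|.
Proof.
move=> a1 b1; elim: n => [|n IH]; first by rewrite !expr0 subrr normr0 mul0r.
rewrite !exprS (_ : _ - _ = (a - b) * a ^+ n + b * (a ^+ n - b ^+ n)); last by ring.
apply: le_trans (ler_normD _ _) _; rewrite !normrM -natr1 mulrDl mul1r addrC.
apply: lerD.
  by apply: le_trans IH; rewrite ler_piMl.
by rewrite ler_piMr // normrX exprn_ile1.
Qed.

End taylor_bounds.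

(** * The simple random walk and its heat limit *)

Section random_walk.
Context {R : realType} (d : nat) (d0 : (0 < d)%N).
Notation V := 'rV[R]_d.
Notation K := 'rV[int]_d.
Implicit Types (phi psi : V -> R) (eps : R) (k : K).

Definition rw_step eps phi (c : V) : R :=
  (2 * d%:R)^-1 * \sum_i (phi (c + eps *: delta_mx 0 i) + phi (c - eps *: delta_mx 0 i)).

Definition rw eps N phi : V -> R := iter N (rw_step eps) phi.

Definition omega2 k : R := \sum_i wave k i ^+ 2.

Definition rw_char eps k : R := d%:R^-1 * \sum_i cos (eps * wave k i).

Lemma rw_le eps N phi psi : (forall z, phi z <= psi z) -> forall z, rw eps N phi z <= rw eps N psi z.
Proof.
move=> H; elim: N => //= N IH z; rewrite /rw_step.
apply: ler_wpM2l; first by rewrite invr_ge0 mulr_ge0 ?ler0n.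
by apply: ler_sum => i _; exact: lerD.
Qed.

Lemma rw_stepD eps phi psi : rw_step eps (fun z => phi z + psi z)
  = fun z => rw_step eps phi z + rw_step eps psi z.
Proof.
apply/funext => z; rewrite /rw_step -mulrDr -big_split; congr (_ * _).
by apply: eq_bigr => i _ /=; rewrite addrACA.
Qed.

Lemma rw_stepZ eps (a : R) phi : rw_step eps (fun z => a * phi z) = fun z => a * rw_step eps phi z.
Proof.
apply/funext => z; rewrite /rw_step [RHS]mulrCA [in RHS]mulr_sumr; congr (_ * _).
by apply: eq_bigr => i _; rewrite mulrDr.
Qed.

Lemma rwD eps N phi psi : rw eps N (fun z => phi z + psi z) = fun z => rw eps N phi z + rw eps N psi z.
Proof. by elim: N => //= N IH; rewrite /rw /= -/(rw _ _ _) IH rw_stepD. Qed.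

Lemma rwZ eps N (a : R) phi : rw eps N (fun z => a * phi z) = fun z => a * rw eps N phi z.
Proof. by elim: N => //= N IH; rewrite /rw /= -/(rw _ _ _) IH rw_stepZ. Qed.

Lemma rw_sum eps N (I : Type) (r : seq I) (F : I -> V -> R) :
  rw eps N (fun z => \sum_(i <- r) F i z) = fun z => \sum_(i <- r) rw eps N (F i) z.
Proof.
elim: r => [|i r IH].
  transitivity (rw eps N (fun z => 0 * 0)).
    by congr rw; apply/funext => z; rewrite big_nil mul0r.
  by rewrite rwZ; apply/funext => z; rewrite big_nil mul0r.
transitivity (rw eps N (fun z => F i z + \sum_(i <- r) F i z)).
  by congr rw; apply/funext => z; rewrite big_cons.
by rewrite rwD IH; apply/funext => z; rewrite big_cons.
Qed.

Lemma dR0 : d%:R != 0 :> R.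
Proof. by rewrite pnatr_eq0 -lt0n. Qed.

Lemma rw_step_cos eps k : rw_step eps (fun z => cos (phase k z)) = fun z => rw_char eps k * cos (phase k z).
Proof.
apply/funext => z; rewrite /rw_step /rw_char.
rewrite (eq_bigr (fun i => 2 * cos (phase k z) * cos (eps * wave k i))); last first.
  by move=> i _; rewrite !phaseD phaseN !phaseZ !phase_delta cosB cosD; ring.
by rewrite -mulr_sumr; field; exact: dR0.
Qed.

Lemma rw_step_sin eps k (j : 'I_d) : rw_step eps (fun z => z 0 j * sin (phase k z))
  = fun z => rw_char eps k * (z 0 j * sin (phase k z)) + eps / d%:R * sin (eps * wave k j) * cos (phase k z).
Proof.
apply/funext => z; rewrite /rw_step /rw_char.
rewrite (eq_bigr (fun i => 2 * (z 0 j * sin (phase k z)) * cos (eps * wave k i)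
   + (if i == j then 2 * eps * sin (eps * wave k j) * cos (phase k z) else 0))); last first.
  move=> i _; rewrite !phaseD phaseN !phaseZ !phase_delta sinB sinD !mxE eqxx /= eq_sym.
  by case: eqP => [->|_]; rewrite /= ?mulr1 ?mulr0; ring.
rewrite big_split /= -big_mkcond big_pred1_eq -mulr_sumr.
by field; exact: dR0.
Qed.

Lemma rw_step_sqr eps : rw_step eps (fun z => dotp z z) = fun z => dotp z z + eps ^+ 2.
Proof.
apply/funext => z; rewrite /rw_step.
have e (i : 'I_d) : dotp (z + eps *: delta_mx 0 i) (z + eps *: delta_mx 0 i)
   + dotp (z - eps *: delta_mx 0 i) (z - eps *: delta_mx 0 i) = 2 * (dotp z z + eps ^+ 2).
  rewrite /dotp -big_split /= (eq_bigr (fun l => 2 * (z 0 l * z 0 l) + (if l == i then 2 * eps ^+ 2 else 0))).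
    by rewrite big_split /= -big_mkcond big_pred1_eq -mulr_sumr -mulrDr.
  by move=> l _; rewrite !mxE eqxx /=; case: eqP => _; rewrite ?mulr1 ?mulr0; ring.
rewrite (eq_bigr (fun=> 2 * (dotp z z + eps ^+ 2))); last by move=> i _; exact: e.
by rewrite sumr_const card_ord -[_ *+ d]mulr_natr; field; exact: dR0.
Qed.

Lemma rw_step_cst eps (c : R) : rw_step eps (fun=> c) = fun=> c.
Proof.
apply/funext => z; rewrite /rw_step sumr_const card_ord -[(c + c) *+ d]mulr_natr.
by field; exact: dR0.
Qed.

(** The steps are centred, so the second moment is exactly linear in the number of steps; a
    quadratic bound passes through the walk without error. *)
Lemma rw_sqr eps N : rw eps N (fun z => dotp z z) = fun z => dotp z z + N%:R * eps ^+ 2.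
Proof.
elim: N => [|N IH]; first by apply/funext => z /=; rewrite mul0r addr0.
rewrite /rw /= -/(rw _ _ _) IH.
transitivity (rw_step eps (fun z => dotp z z + N%:R * eps ^+ 2 * 1)).
  by congr rw_step; apply/funext => z; rewrite mulr1.
rewrite (rw_stepD eps (fun z => dotp z z) (fun z => N%:R * eps ^+ 2 * 1)) rw_step_sqr rw_stepZ.
apply/funext => z; rewrite rw_step_cst -natr1; ring.
Qed.

(** One step maps [z_j sin] to a multiple of itself plus a multiple of [cos], with the same
    eigenvalue [rw_char]: a Jordan block, whence the factor [N] and the exponent [N.-1]. For a walk
    started at 0 only the second term survives. *)
Lemma rw_sin eps N k j : rw eps N (fun z => z 0 j * sin (phase k z)) =
  fun z => rw_char eps k ^+ N * (z 0 j * sin (phase k z))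
   + N%:R * rw_char eps k ^+ N.-1 * (eps / d%:R * sin (eps * wave k j)) * cos (phase k z).
Proof.
elim: N => [|N IH]; first by apply/funext => z /=; rewrite expr0 mul1r !mul0r addr0.
rewrite /rw /= -/(rw _ _ _) IH rw_stepD !rw_stepZ rw_step_sin rw_step_cos.
apply/funext => z; rewrite -natr1 exprS.
by case: N {IH} => [|N] /=; rewrite ?exprS; ring.
Qed.

Lemma rw_char_norm eps k : `|rw_char eps k| <= 1.
Proof.
rewrite normrM ger0_norm ?invr_ge0 ?ler0n // mulrC ler_pdivrMr ?ltr0n // mul1r.
apply: le_trans (ler_norm_sum _ _ _) _.
have -> : d%:R = \sum_(i < d) 1 :> R by rewrite sumr_const card_ord.
by apply: ler_sum => i _; exact: cos_max.
Qed.

(** An error of order [eps ^+ 4] per step is needed: with [eps ^+ 2] of order 1 / N, the accumulated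
    error over N steps is O(1 / N). *)
Lemma rw_char_expansion eps k : `|rw_char eps k - expR (- (eps ^+ 2 * omega2 k / (2 * d%:R)))|
  <= eps ^+ 4 * (\sum_i wave k i ^+ 4 + omega2 k ^+ 2).
Proof.
set t := eps ^+ 2 * omega2 k / (2 * d%:R).
have dp : 0 < d%:R :> R by rewrite ltr0n.
have W0 : 0 <= omega2 k by apply: sumr_ge0 => i _; exact: sqr_ge0.
have dp2 : 0 <= 2 * d%:R :> R by apply: mulr_ge0; exact: ler0n.
have t0 : 0 <= t by apply: divr_ge0 => //; apply: mulr_ge0 => //; exact: sqr_ge0.
have h1 : `|rw_char eps k - (1 - t)| <= eps ^+ 4 * \sum_i wave k i ^+ 4.
  have -> : rw_char eps k - (1 - t) = d%:R^-1 * \sum_i (cos (eps * wave k i) - (1 - (eps * wave k i) ^+ 2 / 2)).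
    rewrite /rw_char sumrB mulrBr; congr (_ - _).
    rewrite sumrB sumr_const card_ord mulrBr mulVf ?dR0 //; congr (_ - _).
    rewrite /t /omega2 mulr_sumr mulr_suml mulr_sumr; apply: eq_bigr => i _.
    by field; exact: dR0.
  rewrite normrM ger0_norm ?invr_ge0 ?ler0n //.
  apply: (@le_trans _ _ (\sum_i `|cos (eps * wave k i) - (1 - (eps * wave k i) ^+ 2 / 2)|)).
    apply: le_trans (_ : _ <= `|\sum_i (cos (eps * wave k i) - (1 - (eps * wave k i) ^+ 2 / 2))|) _; last exact: ler_norm_sum.
    by rewrite ler_piMl // invf_le1 // ler1n.
  rewrite mulr_sumr; apply: ler_sum => i _; rewrite -exprMn.
  have := cos_ge_quad (eps * wave k i); have := cos_le_quartic (eps * wave k i).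
  have : 0 <= (eps * wave k i) ^+ 4 by rewrite (exprM _ 2 2) sqr_ge0.
  by move: (_ ^+ 4) (_ ^+ 2) (cos _) => a b c *; rewrite ler_norml; apply/andP; split; lra.
have h2 := norm_expRN_sub t0.
have h3 : t ^+ 2 <= eps ^+ 4 * omega2 k ^+ 2.
  have eo : 0 <= eps ^+ 2 * omega2 k by apply: mulr_ge0 => //; exact: sqr_ge0.
  rewrite (exprM eps 2 2) -exprMn ler_sqr ?nnegrE //.
  have d1 : 1 <= d%:R :> R by rewrite ler1n.
  by apply: ler_piMr => //; rewrite invf_le1; lra.
rewrite -[_ - _](subrKA (1 - t)) mulrDr.
apply: le_trans (ler_normD _ _) _; apply: lerD => //.
by rewrite distrC; apply: le_trans h2 h3.
Qed.

(** The second term of [rw_sin] for [N.+1] steps of size sqrt(eta / N.+1), hence the exponent [N].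
    The limit is minus the derivative, with respect to [wave k j], of the Gaussian characteristic
    function. *)
Lemma rw_gaussian (eta : R) k j : 0 < eta ->
  (fun N => let eps := Num.sqrt (eta / N.+1%:R) in
     N.+1%:R * rw_char eps k ^+ N * (eps / d%:R * sin (eps * wave k j))) @ \oo -->
  expR (- (eta * omega2 k / (2 * d%:R))) * (eta / d%:R * wave k j).
Proof.
move=> eta0 /=.
have dp : 0 < d%:R :> R by rewrite ltr0n.
have W0 : 0 <= omega2 k by apply: sumr_ge0 => i _; exact: sqr_ge0.
pose eps N : R := Num.sqrt (eta / N.+1%:R).
have N0 N : 0 < N.+1%:R :> R by rewrite ltr0n.
have eps2 N : eps N ^+ 2 = eta / N.+1%:R by rewrite sqr_sqrtr // divr_ge0 ?ltW.
have eps4 N : eps N ^+ 4 = (eta / N.+1%:R) ^+ 2 by rewrite (exprM _ 2 2) eps2.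
rewrite (_ : (fun N => _) = fun N => rw_char (eps N) k ^+ N * (N.+1%:R * (eps N / d%:R * sin (eps N * wave k j)))); last first.
  by apply/funext => N; rewrite -/(eps N); ring.
apply: cvgM.
  have c1 : (fun N : nat => expR (- (eps N ^+ 2 * omega2 k / (2 * d%:R))) ^+ N) @ \oo --> expR (- (eta * omega2 k / (2 * d%:R))).
    rewrite (_ : (fun N => _) = fun N : nat => expR (- (eta * omega2 k / (2 * d%:R)) + (eta * omega2 k / (2 * d%:R)) / N.+1%:R)); last first.
      apply/funext => N; rewrite -expRM_natl; congr expR; rewrite eps2 -natr1.
      by have := N0 N; rewrite -natr1 => NN; field; rewrite dR0 gt_eqF.
    apply: continuous_cvg; first exact: continuous_expR.
    apply: (@cvg_harmonic_bound _ _ _ (eta * omega2 k / (2 * d%:R))) => N.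
    rewrite addrC addKr ger0_norm // divr_ge0 ?ler0n //.
    by rewrite divr_ge0 ?mulr_ge0 ?ler0n // ltW.
  have c2 : (fun N : nat => rw_char (eps N) k ^+ N - expR (- (eps N ^+ 2 * omega2 k / (2 * d%:R))) ^+ N) @ \oo --> 0.
    apply: (@cvg_harmonic_bound _ _ _ (eta ^+ 2 * (\sum_i wave k i ^+ 4 + omega2 k ^+ 2))) => N.
    have hb : `|expR (- (eps N ^+ 2 * omega2 k / (2 * d%:R)))| <= 1.
      rewrite ger0_norm ?expR_ge0 // expR_le1 oppr_le0.
      by apply: divr_ge0; apply: mulr_ge0 => //; exact: sqr_ge0.
    rewrite subr0; apply: (le_trans (norm_exprB_le N (rw_char_norm _ _) hb)).
    apply: le_trans (ler_wpM2l (ler0n _ _) (rw_char_expansion _ _)) _.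
    rewrite eps4; set S := \sum_i _ + _.
    have S0 : 0 <= S by rewrite addr_ge0 ?sqr_ge0 // sumr_ge0 // => i _; rewrite (exprM _ 2 2) sqr_ge0.
    rewrite (_ : eta ^+ 2 * S / N.+1%:R = N.+1%:R * ((eta / N.+1%:R) ^+ 2 * S)); last first.
      by have := N0 N; move: (N.+1%:R) => M M0; field; rewrite gt_eqF.
    by apply: ler_wpM2r; [rewrite mulr_ge0 ?sqr_ge0|rewrite ler_nat].
  have c3 := cvgD c2 c1; rewrite add0r in c3.
  pose E N : R := expR (- (eps N ^+ 2 * omega2 k / (2 * d%:R))) ^+ N.
  rewrite (_ : (fun N => _) = fun N => rw_char (eps N) k ^+ N - E N + E N); first exact: c3.
  by apply/funext => N; rewrite subrK.
apply: (@cvg_harmonic_bound _ _ _ (eta ^+ 2 * `|wave k j| ^+ 3)) => N.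
have -> : N.+1%:R * (eps N / d%:R * sin (eps N * wave k j)) - eta / d%:R * wave k j
   = N.+1%:R * eps N / d%:R * (sin (eps N * wave k j) - eps N * wave k j).
  have -> : eta = eps N ^+ 2 * N.+1%:R by rewrite eps2 divfK // gt_eqF.
  by field; exact: dR0.
have e0 : 0 <= eps N by exact: sqrtr_ge0.
rewrite normrM ger0_norm; last by rewrite !mulr_ge0 ?invr_ge0 ?ler0n.
apply: le_trans (ler_wpM2l _ (norm_sin_sub _)) _; first by rewrite !mulr_ge0 ?invr_ge0 ?ler0n.
rewrite normrM (ger0_norm e0) exprMn mulrA.
have -> : eta ^+ 2 * `|wave k j| ^+ 3 / N.+1%:R = (N.+1%:R * eps N ^+ 4) * `|wave k j| ^+ 3.
  by rewrite eps4; have := N0 N; move: (N.+1%:R) => M M0; field; rewrite gt_eqF.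
apply: ler_wpM2r; first by rewrite exprn_ge0.
rewrite (_ : _ / _ * _ = N.+1%:R * eps N ^+ 4 * d%:R^-1); last by ring.
by rewrite ler_piMr ?mulr_ge0 ?ler0n ?exprn_ge0 // invf_le1 // ler1n.
Qed.

(** The walk is a positive operator, so the inequality may be averaged and evaluated at the origin.
    The right-hand side becomes [D * eta] and the left-hand side tends to [eta / d] times the heat
    sum; dividing by [eta / d] gives the factor [d]. *)
Lemma gaussian_average_bound (r : seq K) (C : 'I_d -> K -> R) (D : R) :
  (forall z : V, \sum_(k <- r) \sum_j C j k * (z 0 j * sin (phase k z)) <= D * dotp z z) ->
  forall tau, 0 <= tau ->
  \sum_(k <- r) (\sum_j C j k * wave k j) * expR (- (tau * omega2 k)) <= d%:R * D.
Proof.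
move=> H.
have dp : 0 < d%:R :> R by rewrite ltr0n.
have pos tau : 0 < tau -> \sum_(k <- r) (\sum_j C j k * wave k j) * expR (- (tau * omega2 k)) <= d%:R * D.
  (* Total second moment 2 d tau, that is 2 tau per coordinate: the limit symbol is then exactly
     e^(-tau |k|^2). *)
  move=> tau0; pose eta := tau * (2 * d%:R); have eta0 : 0 < eta by rewrite !mulr_gt0.
  pose eps N : R := Num.sqrt (eta / N.+1%:R).
  pose u N := \sum_(k <- r) \sum_j C j k * (N.+1%:R * rw_char (eps N) k ^+ N * (eps N / d%:R * sin (eps N * wave k j))).
  have uD N : u N <= D * eta.
    have := rw_le (eps N) N.+1 H 0; rewrite rwZ rw_sqr.
    have -> : dotp (0 : V) 0 = 0 by rewrite /dotp big1 // => i _; rewrite mxE mul0r.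
    have -> : 0 + N.+1%:R * eps N ^+ 2 = eta.
      rewrite add0r sqr_sqrtr; last by apply: divr_ge0; [exact: ltW|exact: ler0n].
      by rewrite mulrC divfK // pnatr_eq0.
    congr (_ <= _); rewrite rw_sum /u; apply: eq_bigr => k _.
    rewrite rw_sum; apply: eq_bigr => j _; rewrite rwZ rw_sin /=.
    by rewrite mxE mul0r mulr0 add0r phase0 cos0 mulr1.
  have uc : u @ \oo --> \sum_(k <- r) \sum_j C j k * (expR (- (eta * omega2 k / (2 * d%:R))) * (eta / d%:R * wave k j)).
    rewrite /u; elim: r {H u uD} => [|k r IH].
      by under eq_fun do rewrite big_nil; rewrite big_nil; exact: cvg_cst.
    under eq_fun do rewrite big_cons; rewrite big_cons; apply: cvgD; last exact: IH.
    elim: (index_enum _) => [|j s IH'].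
      by under eq_fun do rewrite big_nil; rewrite big_nil; exact: cvg_cst.
    under eq_fun do rewrite big_cons; rewrite big_cons; apply: cvgD; last exact: IH'.
    by apply: cvgMr; exact: rw_gaussian.
  have : \sum_(k <- r) \sum_j C j k * (expR (- (eta * omega2 k / (2 * d%:R))) * (eta / d%:R * wave k j)) <= D * eta.
    rewrite -(cvg_lim _ uc) //; apply: limr_le; first by apply/cvg_ex; eexists; exact: uc.
    by near=> N; exact: uD.
  rewrite (_ : \sum_(k <- r) _ = eta / d%:R * \sum_(k <- r) (\sum_j C j k * wave k j) * expR (- (tau * omega2 k))).
    by rewrite mulrC -ler_pdivlMr ?divr_gt0 // => h; apply: le_trans h _; rewrite le_eqVlt; apply/orP; left; apply/eqP; field; rewrite dR0 gt_eqF.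
  rewrite mulr_sumr; apply: eq_bigr => k _.
  have -> : eta * omega2 k / (2 * d%:R) = tau * omega2 k by rewrite /eta; field; exact: dR0.
  move: (expR _) => E; rewrite mulr_suml mulr_sumr; apply: eq_bigr => j _.
  by ring.
move=> tau; rewrite le_eqVlt => /predU1P[<-|]; last exact: pos.
(* At [tau = 0] the walk does not move and both sides vanish, so this case is recovered as a limit
   of positive times. *)
have uc : (fun n : nat => \sum_(k <- r) (\sum_j C j k * wave k j) * expR (- (n.+1%:R^-1 * omega2 k))) @ \oo -->
   \sum_(k <- r) (\sum_j C j k * wave k j) * expR (- (0 * omega2 k)).
  elim: r {H pos} => [|k r IH].
    by under eq_fun do rewrite big_nil; rewrite big_nil; exact: cvg_cst.
  under eq_fun do rewrite big_cons; rewrite big_cons; apply: cvgD; last exact: IH.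
  apply: cvgMr; apply: continuous_cvg; first exact: continuous_expR.
  apply: cvgN; apply: cvgMl; exact: cvg_harmonic.
rewrite -(cvg_lim _ uc) //; apply: limr_le; first by apply/cvg_ex; eexists; exact: uc.
by near=> n; apply: pos; rewrite invr_gt0 ltr0n.
Unshelve. all: by end_near. Qed.

End random_walk.

(** * The commutator estimate *)

Section symbols.
Context {R : realType} (d : nat).
Notation V := 'rV[R]_d.
Notation K := 'rV[int]_d.
Implicit Types (f g : V -> R) (k : K) (z : V).

Lemma Zperiodic_dx i f f' : Zperiodic f -> has_dx i f f' -> Zperiodic f'.
Proof.
move=> fp df x k; apply: is_derive_unique (df x).
rewrite (_ : f = fun y => f (y + lattice k)); last by apply/funext => y; rewrite fp.
exact: is_derive_translate.
Qed.

Lemma sum_CS (n : nat) (a b : 'I_n -> R) :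
  (\sum_i a i * b i) ^+ 2 <= (\sum_i a i ^+ 2) * (\sum_i b i ^+ 2).
Proof.
have A0 : 0 <= \sum_i a i ^+ 2 by apply: sumr_ge0 => i _; exact: sqr_ge0.
have B0 : 0 <= \sum_i b i ^+ 2 by apply: sumr_ge0 => i _; exact: sqr_ge0.
rewrite -real_normK ?num_real // -[X in X * _]sqr_sqrtr // -[X in _ * X]sqr_sqrtr // -exprMn.
rewrite ler_sqr ?nnegrE ?mulr_ge0 ?sqrtr_ge0 //.
apply: le_mul_of_amgm; rewrite ?sqrtr_ge0 // => dl dl0; rewrite !sqr_sqrtr //.
apply: le_trans (ler_wpM2l (ler0n _ 2) (ler_norm_sum _ _ _)) _.
rewrite !mulr_sumr -big_split; apply: ler_sum => i _ /=.
rewrite normrM -(real_normK (num_real (a i))) -(real_normK (num_real (b i))).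
move: `|a i| `|b i| => u v.
have dV : dl * dl^-1 = 1 by rewrite divff // lt0r_neq0.
rewrite -subr_ge0 (_ : _ - _ = dl * (u - dl^-1 * v) ^+ 2); first by rewrite mulr_ge0 ?sqr_ge0 // ltW.
rewrite (_ : dl * (u - dl^-1 * v) ^+ 2 = dl * u ^+ 2 + dl * dl^-1 * (dl^-1 * v ^+ 2) - dl * dl^-1 * (2 * (u * v))); last by ring.
by rewrite dV; ring.
Qed.

Lemma dotpE z : dotp z z = \sum_i z 0 i ^+ 2.
Proof. by apply: eq_bigr => i _; rewrite expr2. Qed.

Lemma dotp_ge0 z : 0 <= dotp z z.
Proof. by rewrite dotpE; apply: sumr_ge0 => i _; exact: sqr_ge0. Qed.

Lemma phase_sqr_le k z : phase k z ^+ 2 <= omega2 k * dotp z z.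
Proof. by rewrite phaseE dotpE; exact: sum_CS. Qed.

Lemma l1_sqr_le z : (\sum_i `|z 0 i|) ^+ 2 <= d%:R * dotp z z.
Proof.
have := sum_CS (fun=> 1 : R) (fun i : 'I_d => `|z 0 i|).
have -> : \sum_(i < d) 1 * `|z 0 i| = \sum_i `|z 0 i| by apply: eq_bigr => i _; rewrite mul1r.
have -> : \sum_(i < d) (1 : R) ^+ 2 = d%:R by rewrite (eq_bigr _ (fun i _ => expr1n _ _)) sumr_const card_ord.
by rewrite dotpE (eq_bigr _ (fun i _ => real_normK (num_real (z 0 i)))).
Qed.

Lemma wave0 i : wave (0 : K) i = 0 :> R.
Proof. by rewrite /wave mxE mulr0. Qed.

Lemma wave_sqr_le k i : wave k i ^+ 2 <= omega2 k :> R.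
Proof.
by rewrite /omega2 (bigD1 i) //= lerDl; apply: sumr_ge0 => j _; exact: sqr_ge0.
Qed.

Lemma omega2_ge1 k : k != 0 -> 1 <= omega2 k :> R.
Proof.
move=> k0; have [i ki] : exists i, k 0 i != 0.
  apply/existsP; apply: contraNT k0; rewrite negb_exists => /forallP H.
  by apply/eqP/rowP => i; rewrite mxE; apply/eqP; have := H i; rewrite negbK.
apply: le_trans (wave_sqr_le k i); rewrite /wave exprMn.
have p2 := pi_ge2 R; have h1 : 1 <= (2 * pi) ^+ 2 :> R by rewrite expr2; nra.
have h2 : 1 <= (k 0 i)%:~R ^+ 2 :> R.
  rewrite -rmorphXn (_ : 1 = 1%:~R) // ler_int.
  by move: ki; move: (k 0 i) => m; rewrite expr2; nia.
by rewrite -[leLHS]mulr1 ler_pM.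
Qed.

(* The value 1 at k = 0 is a convention that avoids dividing by zero. *)
Definition om k : R := if k == 0 then 1 else omega2 k.

Lemma om_ge1 k : 1 <= om k.
Proof. by rewrite /om; case: eqP => // /eqP; exact: omega2_ge1. Qed.

Lemma om_gt0 k : 0 < om k.
Proof. exact: lt_le_trans ltr01 (om_ge1 k). Qed.

Lemma wave_sqr_le_om k i : wave k i ^+ 2 <= om k.
Proof.
rewrite /om; case: eqP => [->|_]; first by rewrite wave0 expr0n.
exact: wave_sqr_le.
Qed.

Lemma phase_sqr_le_om k z : phase k z ^+ 2 <= om k * dotp z z.
Proof.
rewrite /om; case: eqP => [->|_]; last exact: phase_sqr_le.
by rewrite phase0l expr0n /= mul1r dotp_ge0.
Qed.

Lemma An_sum (I : Type) (r : seq I) (P : pred I) (F : I -> V -> R) f k :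
  (forall i, P i -> continuous (F i)) ->
  An (fun x => \sum_(i <- r | P i) F i x) f k = \sum_(i <- r | P i) An (F i) f k.
Proof. by move=> Fc; rewrite /An ca_sum // sa_sum // !mulr_suml sumrB. Qed.

Lemma Mop_lin S (I : Type) (r : seq I) (c : I -> K -> R) (e : I -> K -> R) f x :
  \sum_(i <- r) Mop S (c i) (e i) f x
  = Mop S (fun k => \sum_(i <- r) c i k) (fun k => \sum_(i <- r) e i k) f x.
Proof.
rewrite /Mop exchange_big /=; apply: eq_bigr => k _.
by rewrite big_split /= -!mulr_suml.
Qed.

Lemma MopZ S (a : R) c e f x : a * Mop S c e f x = Mop S (fun k => a * c k) (fun k => a * e k) f x.
Proof. by rewrite /Mop mulr_sumr; apply: eq_bigr => k _; ring. Qed.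

Lemma MopB S c e c' e' f x : Mop S c e f x - Mop S c' e' f x
  = Mop S (fun k => c k - c' k) (fun k => e k - e' k) f x.
Proof. by rewrite /Mop -sumrB; apply: eq_bigr => k _; ring. Qed.

Lemma eq_Mop S c e c' e' f : {in S, c =1 c'} -> {in S, e =1 e'} -> Mop S c e f = Mop S c' e' f.
Proof.
move=> cc ee; apply/funext => x; rewrite /Mop big_seq [RHS]big_seq.
by apply: eq_bigr => k kS; rewrite cc ?ee.
Qed.

End symbols.

Lemma weighted_sqr_le (R : realFieldType) (a t o Z : R) : 0 <= a <= 1 -> 0 < o ->
  t ^+ 2 <= o * Z -> (- (a * t / o)) ^+ 2 * o <= Z.
Proof.
move=> /andP[a0 a1] o0 tZ.
rewrite (_ : _ * o = a ^+ 2 * t ^+ 2 / o); last by field; rewrite gt_eqF.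
rewrite ler_pdivrMr // [leRHS]mulrC; apply: le_trans tZ.
by rewrite ler_piMl ?sqr_ge0 // exprn_ile1.
Qed.

(** * From the shift bound to heat operators and to negative powers *)

Section commutator.
Context {R : realType} (d : nat) (d0 : (0 < d)%N).
Notation V := 'rV[R]_d.
Notation K := 'rV[int]_d.
Variables (S : seq K) (w : K -> R) (sS : symmetric_freq S) (w01 : forall k, 0 <= w k <= 1).
Variables (f : V -> R) (f' : 'I_d -> V -> R) (B : R).
Hypotheses (fp : cper f) (df : forall i, has_dx i f (f' i)) (fc' : forall i, continuous (f' i)).
Hypotheses (B0 : 0 <= B) (fB : forall x, `|f x| <= B).

(* The gradient of Psi, where Delta Psi = f up to the truncation weight w. *)
Definition gradPsi (j : 'I_d) : V -> R := Mop S (fun=> 0) (fun k => - (w k * wave k j / om k)) f.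

Let F := Num.sqrt (torus_int (fun x => f x ^+ 2)).
Let fc : continuous f := fp.1.

Let F2 : torus_int (fun x => f x ^+ 2) = F ^+ 2.
Proof.
by rewrite sqr_sqrtr // torus_int_ge0 // => [|x]; [exact: contX|exact: sqr_ge0].
Qed.

Let F0 : 0 <= F. Proof. exact: sqrtr_ge0. Qed.

Let gp j : cper (gradPsi j). Proof. exact: cper_Mop. Qed.

Lemma gradPsi_norm j : torus_int (fun x => gradPsi j x ^+ 2) <= F ^+ 2.
Proof.
have := @Mop_norm R d S (fun=> 0) (fun k => - (w k * wave k j / om k)) f 1 sS fc ler01.
rewrite expr1n mul1r F2; apply => k _; rewrite expr0n add0r sqrrN.
have /andP[w0 w1] := w01 k; have o1 := @om_ge1 R d k; have o0 := @om_gt0 R d k.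
have := @wave_sqr_le_om R d k j; move: (wave k j) (om k) (w k) w0 w1 o1 o0 => v o a a0 a1 o1 o0 vo.
have o2 : 0 < o ^+ 2 by exact: exprn_gt0.
rewrite !exprMn exprVn ler_pdivrMr // mul1r.
apply: (@le_trans _ _ (1 * o)); last by rewrite expr2 ler_pM2r.
by apply: ler_pM; rewrite ?sqr_ge0 // exprn_ile1.
Qed.

(** The symbol is [e k] times one minus a phase, of squared modulus 2 (1 - cos t) e^2 <= e^2 t^2
    with t = z . k. Both e^2 |k|^2 and t^2 / |k|^2 are at most |z|^2, so two derivatives are
    absorbed by the inverse Laplacian. *)
Lemma gradPsi_shift_norm (z : V) :
  torus_int (fun x => (\sum_j z 0 j * (gradPsi j x - gradPsi j (x + z))) ^+ 2)
  <= (dotp z z * F) ^+ 2.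
Proof.
pose e k := - (w k * phase k z / om k).
have -> : (fun x => (\sum_j z 0 j * (gradPsi j x - gradPsi j (x + z))) ^+ 2)
   = fun x => Mop S (fun k => e k * sin (phase k z)) (fun k => e k * (1 - cos (phase k z))) f x ^+ 2.
  apply/funext => x; congr (_ ^+ 2).
  rewrite (eq_bigr (fun j => Mop S (fun k => z 0 j * (0 - (0 * cos (phase k z) - - (w k * wave k j / om k) * sin (phase k z))))
     (fun k => z 0 j * (- (w k * wave k j / om k) - (0 * sin (phase k z) + - (w k * wave k j / om k) * cos (phase k z)))) f x)); last first.
    by move=> j _; rewrite /gradPsi Mop_shift MopB MopZ.
  rewrite Mop_lin; congr (_ x); apply: eq_Mop => k _.
    rewrite /e phaseE mulr_sumr !mulr_suml -sumrN mulr_suml; apply: eq_bigr => j _; ring.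
  rewrite /e phaseE mulr_sumr !mulr_suml -sumrN mulr_suml; apply: eq_bigr => j _; ring.
rewrite exprMn -F2; apply: Mop_norm => //; first exact: dotp_ge0.
move=> k _; set t := phase k z.
have /andP[w0 w1] := w01 k; have o1 := @om_ge1 R d k; have o0 := @om_gt0 R d k.
have -> : (e k * sin t) ^+ 2 + (e k * (1 - cos t)) ^+ 2 = 2 * e k ^+ 2 * (1 - cos t).
  by have := cos2Dsin2 t => h; rewrite !exprMn sin2cos2; ring.
have ct := cos_ge_quad t.
have e2 : 0 <= e k ^+ 2 by exact: sqr_ge0.
apply: (@le_trans _ _ (e k ^+ 2 * t ^+ 2)).
  by rewrite -mulrA mulrCA; apply: ler_wpM2l => //; lra.
have tz : t ^+ 2 <= om k * dotp z z by exact: phase_sqr_le_om.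
have t2 : 0 <= t ^+ 2 by exact: sqr_ge0.
have ez : e k ^+ 2 * om k <= dotp z z.
  by apply: weighted_sqr_le => //; exact: w01.
have zz := dotp_ge0 z.
apply: (@le_trans _ _ (e k ^+ 2 * (om k * dotp z z))); first by rewrite ler_wpM2l.
by rewrite mulrA expr2 ler_wpM2r.
Qed.

Let fg_p j : cper (fun x => f x * gradPsi j x). Proof. exact: cperM. Qed.

Definition fg_dx (j i : 'I_d) (x : V) : R := f' i x * gradPsi j x + f x *
  Mop S (fun k => - wave k i * - (w k * wave k j / om k)) (fun k => wave k i * 0) f x.

Lemma has_dx_fg j i : has_dx i (fun x => f x * gradPsi j x) (fg_dx j i).
Proof. by move=> x; apply: deriM; [exact: df|exact: Mop_dx]. Qed.

Lemma cper_dx i : cper (f' i).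
Proof. by split => //; exact: Zperiodic_dx fp.2 (df i). Qed.

Lemma cper_fg_dx j i : cper (fg_dx j i).
Proof.
apply: cperD; apply: cperM => //; [exact: cper_dx|exact: cper_Mop].
Qed.

Lemma shift_commutator (z : V) :
  `|\sum_j z 0 j * torus_int (fun x => f x * gradPsi j x * (f (x + z) - f (x - z)))|
  <= B * F ^+ 2 * dotp z z.
Proof.
have fz := cper_shift z fp; have fz' := cper_shift (- z) fp.
pose G x := \sum_j z 0 j * (gradPsi j x - gradPsi j (x + z)).
have Gp : cper G by apply: cper_sum => j _; apply: cperZ; apply: cperB => //; exact: cper_shift.
have -> : \sum_j z 0 j * torus_int (fun x => f x * gradPsi j x * (f (x + z) - f (x - z)))
  = torus_int (fun x => (f x * f (x + z)) * G x).
  have sw j : torus_int (fun x => f x * gradPsi j x * f (x - z))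
      = torus_int (fun x => f x * f (x + z) * gradPsi j (x + z)).
    have h : cper (fun x => f x * gradPsi j x * f (x - z)) by apply: cperM.
    rewrite -(torus_int_shift z h.1 h.2); congr torus_int; apply/funext => x.
    by rewrite addrK; ring.
  rewrite (eq_bigr (fun j => torus_int (fun x => z 0 j * (f x * f (x + z) * (gradPsi j x - gradPsi j (x + z)))))).
    rewrite -torus_int_sum; first by congr torus_int; apply/funext => x; rewrite /G mulr_sumr; apply: eq_bigr => j _; ring.
    move=> j _; apply: (cperZ _ _).1; apply: cperM; first exact: cperM.
    by apply: cperB => //; exact: cper_shift.
  move=> j _; have g1 := cper_shift z (gp j).
  rewrite torus_intZ; last by apply: (cperM _ _).1; [exact: cperM|exact: cperB].
  congr (_ * _); rewrite (_ : (fun x => f x * gradPsi j x * (f (x + z) - f (x - z)))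
     = fun x => f x * f (x + z) * gradPsi j x - f x * gradPsi j x * f (x - z)); last by apply/funext => x; ring.
  rewrite (_ : (fun x => f x * f (x + z) * (gradPsi j x - gradPsi j (x + z)))
     = fun x => f x * f (x + z) * gradPsi j x - f x * f (x + z) * gradPsi j (x + z)); last by apply/funext => x; ring.
  by rewrite !torus_intB ?sw //; (apply: (cperM _ _).1 => //; exact: cperM).
have zz := dotp_ge0 z.
have := @torus_int_CS R d (fun x => f x * f (x + z)) G (B * F) (dotp z z * F).
rewrite (_ : B * F * (dotp z z * F) = B * F ^+ 2 * dotp z z); last by ring.
apply; [exact: (cperM fp fz).1|exact: Gp.1|exact: mulr_ge0|exact: mulr_ge0| |exact: gradPsi_shift_norm].
rewrite exprMn -F2 -torus_intZ; last exact: contX.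
apply: torus_int_le; [by apply: contX; exact: (cperM fp fz).1|by apply: contZ; exact: contX|].
move=> x; rewrite exprMn mulrC ler_wpM2r ?sqr_ge0 //.
by rewrite -real_normK ?num_real // ler_sqr ?nnegrE.
Qed.

Lemma Qn_shift_diff n (z : V) x :
  Qn n f (x + z) - Qn n f (x - z)
  = Mop (box d n) (fun=> 0) (fun k => 2 * (wt n k * sin (phase k z))) f x.
Proof.
rewrite /Qn !Mop_shift MopB; congr (_ x); apply: eq_Mop => k _.
  by rewrite phaseN cosN sinN; ring.
by rewrite phaseN cosN sinN; ring.
Qed.

(** Puts the shift average into the form of a finite combination of [z_j sin(phase k z)], which is
    the form the random walk accepts. The factor 2 comes from sin(a) - sin(- a). *)
Lemma sum_An_shift n (z : V) :
  2 * \sum_(k <- box d n) \sum_j wt n k * An (fun x => f x * gradPsi j x) f k * (z 0 j * sin (phase k z))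
  = \sum_j z 0 j * torus_int (fun x => f x * gradPsi j x * (Qn n f (x + z) - Qn n f (x - z))).
Proof.
rewrite exchange_big /= mulr_sumr; apply: eq_bigr => j _.
rewrite (_ : (fun x => f x * gradPsi j x * _) = fun x => f x * gradPsi j x *
   Mop (box d n) (fun=> 0) (fun k => 2 * (wt n k * sin (phase k z))) f x); last first.
  by apply/funext => x; rewrite Qn_shift_diff.
rewrite torus_int_Mop; last exact: (fg_p j).1.
by rewrite !mulr_sumr; apply: eq_bigr => k _; ring.
Qed.

(** A uniform error [e] alone would give first order in [z], useless against a second moment. The
    shift is therefore transferred from the remainder to the product of [f] and [gradPsi], whose
    Lipschitz bound supplies the second power of [z]. *)
Lemma shift_error n (z : V) (e L : R) : 0 <= e -> (forall x, `|f x - Qn n f x| <= e) ->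
  0 <= L -> (forall j i x, `|fg_dx j i x| <= L) ->
  `|\sum_j z 0 j * torus_int (fun x => f x * gradPsi j x * (Qn n f (x + z) - Qn n f (x - z)))
    - \sum_j z 0 j * torus_int (fun x => f x * gradPsi j x * (f (x + z) - f (x - z)))|
  <= 2 * e * L * d%:R * dotp z z.
Proof.
move=> e0 He L0 HL.
pose r x := Qn n f x - f x.
have Qp : cper (Qn n f) by exact: cper_Mop.
have rp : cper r by exact: cperB.
have rz := cper_shift z rp; have rz' := cper_shift (- z) rp.
have hj j : `|torus_int (fun x => f x * gradPsi j x * (r (x + z) - r (x - z)))|
    <= 2 * e * L * \sum_i `|z 0 i|.
  set G := fun x => f x * gradPsi j x.
  have Gp : cper G by exact: fg_p.
  have Gz := cper_shift z Gp; have Gz' := cper_shift (- z) Gp.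
  have -> : torus_int (fun x => G x * (r (x + z) - r (x - z)))
     = torus_int (fun x => (G (x - z) - G (x + z)) * r x).
    rewrite (_ : (fun x => G x * _) = fun x => G x * r (x + z) - G x * r (x - z)); last by apply/funext => x; ring.
    rewrite (_ : (fun x => _ * r x) = fun x => G (x - z) * r x - G (x + z) * r x); last by apply/funext => x; ring.
    have p1 := cperM Gp rz; have p2 := cperM Gp rz'.
    have p3 := cperM Gz rp; have p4 := cperM Gz' rp.
    rewrite !torus_intB ?(p1.1, p2.1, p3.1, p4.1) //; [|exact: p4.1|exact: p3.1|exact: p1.1|exact: p2.1].
    congr (_ - _).
      rewrite -(torus_int_shift (- z) p1.1 p1.2); congr torus_int; apply/funext => x.
      by rewrite subrK.
    rewrite -(torus_int_shift z p2.1 p2.2); congr torus_int; apply/funext => x.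
    by rewrite addrK.
  have Gd := cperB Gz' Gz.
  apply: (@le_trans _ _ (torus_int (fun=> 2 * e * L * \sum_i `|z 0 i|))); last by rewrite torus_int_cst.
  apply: torus_int_norm_le; [exact: (cperM Gd rp).1|exact: cont_cst|].
  move=> x; rewrite normrM.
  have h1 : `|G (x - z) - G (x + z)| <= L * (2 * \sum_i `|z 0 i|).
    have := @lipschitz_coord R d G (fg_dx j) L (has_dx_fg j) (HL j) (x + z) (- (z + z)).
    rewrite (_ : x + z - (z + z) = x - z); last by rewrite opprD addrA addrK.
    move=> h; apply: le_trans h _; rewrite ler_wpM2l // mulr_sumr; apply: ler_sum => i _.
    by rewrite !mxE normrN -mulr2n normrMn mulr_natl.
  have h2 : `|r x| <= e by rewrite /r distrC.
  by rewrite (_ : 2 * e * L * _ = L * (2 * \sum_i `|z 0 i|) * e); [exact: ler_pM|ring].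
rewrite -sumrB.
rewrite (eq_bigr (fun j => z 0 j * torus_int (fun x => f x * gradPsi j x * (r (x + z) - r (x - z))))); last first.
  move=> j _; rewrite -mulrBr -torus_intB.
  - by congr (_ * torus_int _); apply/funext => x; rewrite /r; ring.
  - exact: (cperM (fg_p j) (cperB (cper_shift z Qp) (cper_shift (- z) Qp))).1.
  - exact: (cperM (fg_p j) (cperB (cper_shift z fp) (cper_shift (- z) fp))).1.
apply: le_trans (ler_norm_sum _ _ _) _.
apply: (@le_trans _ _ (2 * e * L * (\sum_i `|z 0 i|) ^+ 2)).
  have -> : 2 * e * L * (\sum_i `|z 0 i|) ^+ 2 = \sum_j `|z 0 j| * (2 * e * L * \sum_i `|z 0 i|).
    by rewrite -mulr_suml; ring.
  by apply: ler_sum => j _; rewrite normrM; exact: ler_wpM2l.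
rewrite -[leRHS]mulrA; apply: ler_wpM2l; last exact: l1_sqr_le.
by rewrite !mulr_ge0.
Qed.

(** [s] is a sign, +1 or -1: upper bounds for both signs give the absolute value at the end. *)
Let sumAn n (s tau : R) := \sum_(k <- box d n) (\sum_j (s * wt n k * An (fun x => f x * gradPsi j x) f k) * wave k j)
   * expR (- (tau * om k)).

Lemma sumAn_small n (s e L : R) : s ^+ 2 = 1 -> 0 <= e -> (forall x, `|f x - Qn n f x| <= e) ->
  0 <= L -> (forall j i x, `|fg_dx j i x| <= L) ->
  forall tau, 0 <= tau -> sumAn n s tau <= d%:R * (B * F ^+ 2 + 2 * e * L * d%:R).
Proof.
move=> s2 e0 He L0 HL tau tau0.
have nD : 0 <= B * F ^+ 2 + 2 * e * L * d%:R by rewrite addr_ge0 ?mulr_ge0 ?sqr_ge0 ?ler0n.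
have := @gaussian_average_bound R d d0 (box d n) (fun j k => s * wt n k * An (fun x => f x * gradPsi j x) f k)
  (B * F ^+ 2 + 2 * e * L * d%:R) _ tau tau0.
(* Replacing [omega2] by [om] changes only k = 0, where the factor [wave] vanishes. *)
have E : sumAn n s tau = \sum_(k <- box d n) (\sum_j s * wt n k * An (fun x => f x * gradPsi j x) f k * wave k j) * expR (- (tau * omega2 k)).
  rewrite /sumAn; apply: eq_bigr => k _; rewrite /om; case: eqP => [->|//].
  by rewrite big1 ?mul0r // => j _; rewrite wave0 mulr0.
rewrite E; apply => z.
have h1 := shift_error z e0 He L0 HL; have h2 := shift_commutator z.
have h3 := sum_An_shift n z.
set X := \sum_(k <- _) _ in h3 *; set Y := \sum_j _ in h1 h3; set Z := \sum_j _ in h1 h2.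
have -> : \sum_(k <- box d n) \sum_j s * wt n k * An (fun x => f x * gradPsi j x) f k * (z 0 j * sin (phase k z)) = s * X.
  by rewrite /X mulr_sumr; apply: eq_bigr => k _; rewrite mulr_sumr; apply: eq_bigr => j _; ring.
have s1 : `|s| = 1 by apply/eqP; rewrite -sqrp_eq1 // real_normK ?num_real // s2.
apply: le_trans (ler_norm _) _; rewrite normrM s1 mul1r mulrDl.
have h4 : 2 * `|X| <= B * F ^+ 2 * dotp z z + 2 * e * L * d%:R * dotp z z.
  rewrite -[X in X * _](ger0_norm (ler0n R 2)) -normrM h3 -[Y](subrK Z) addrC.
  by apply: le_trans (ler_normD _ _) _; apply: lerD.
by apply: le_trans h4; have := normr_ge0 X; lra.
Qed.

(** For [tau >= 1] one has om <= 1 + tau (om - 1) <= e^(tau (om - 1)), so the heat factor pays for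
    one derivative and still leaves e^(-tau). *)
Lemma expR_om_le (k : K) (tau : R) i : 1 <= tau -> `|wave k i| * expR (- (tau * om k)) <= expR (- tau).
Proof.
move=> t1; have o1 := @om_ge1 R d k; have := @wave_sqr_le_om R d k i.
move: (wave k i) (om k) o1 => v o o1 vo.
have v1 : `|v| <= o.
  have o0 : 0 <= o by lra.
  rewrite -ler_sqr ?nnegrE // real_normK ?num_real //.
  by apply: le_trans vo _; rewrite expr2 ler_peMl.
have h : o <= expR (tau * (o - 1)).
  by apply: le_trans (expR_ge1Dx _); nra.
rewrite (_ : - (tau * o) = - tau - tau * (o - 1)); last by ring.
rewrite expRB mulrCA ler_piMr ?expR_ge0 // ler_pdivrMr ?expR_gt0 // mul1r.
exact: le_trans v1 h.
Qed.

Lemma sumAn_large n (s tau : R) : s ^+ 2 = 1 -> 1 <= tau ->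
  sumAn n s tau <= d%:R * (B * F ^+ 2) * expR (- tau).
Proof.
move=> s2 t1.
have E : sumAn n s tau = \sum_j (\sum_(k <- box d n) (0 * Sy (fun x => f x * gradPsi j x) f k
    + (s * wt n k * wave k j * expR (- (tau * om k))) * An (fun x => f x * gradPsi j x) f k)).
  rewrite exchange_big /sumAn /=; apply: eq_bigr => k _.
  by rewrite mulr_suml; apply: eq_bigr => j _; ring.
rewrite E.
have -> : d%:R * (B * F ^+ 2) * expR (- tau) = \sum_(j < d) (expR (- tau) * ((B * F) * F)).
  by rewrite sumr_const card_ord -[_ *+ d]mulr_natr; ring.
apply: ler_sum => j _; apply: le_trans (ler_norm _) _.
apply: sum_SyAn_le => //.
- exact: box_symmetric.
- exact: (fg_p j).1.
- by rewrite mulr_ge0.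
- move=> k _; rewrite expr0n add0r -mulrA -mulrA exprMn s2 mul1r.
  rewrite -real_normK ?num_real // ler_sqr ?nnegrE ?expR_ge0 //.
  rewrite normrM [X in _ * X]normrM (ger0_norm (expR_ge0 _)) (ger0_norm (wt_ge0 n k)).
  apply: le_trans (expR_om_le k j t1).
  by rewrite ler_piMl ?mulr_ge0 ?expR_ge0 ?wt_le1.
- rewrite exprMn; apply: (@le_trans _ _ (torus_int (fun x => B ^+ 2 * gradPsi j x ^+ 2))).
    apply: torus_int_le; [by apply: contX; exact: (fg_p j).1|by apply: contZ; apply: contX; exact: (gp j).1|].
    move=> x; rewrite exprMn ler_wpM2r ?sqr_ge0 //.
    by rewrite -real_normK ?num_real // ler_sqr ?nnegrE.
  rewrite torus_intZ; last by apply: contX; exact: (gp j).1.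
  by rewrite ler_wpM2l ?sqr_ge0 // gradPsi_norm.
- by rewrite F2.
Qed.

(** For [tau <= 1] the bound without decay is used together with 1 <= e * e^(-tau), the origin of
    the factor [expR 1]; for [tau >= 1] the decaying bound is used. *)
Lemma sumAn_power n (s e L p : R) : s ^+ 2 = 1 -> 0 <= e -> (forall x, `|f x - Qn n f x| <= e) ->
  0 <= L -> (forall j i x, `|fg_dx j i x| <= L) -> 0 < p ->
  \sum_(k <- box d n) (\sum_j (s * wt n k * An (fun x => f x * gradPsi j x) f k) * wave k j) * om k `^ (- p)
  <= d%:R * (B * F ^+ 2 + 2 * e * L * d%:R) * expR 1.
Proof.
move=> s2 e0 He L0 HL p0; apply: laplace_power_bound => //; first by move=> k; exact: om_gt0.
have nE : 0 <= 2 * e * L * d%:R by rewrite !mulr_ge0.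
have nD : 0 <= B * F ^+ 2 + 2 * e * L * d%:R by rewrite addr_ge0 ?mulr_ge0 ?sqr_ge0.
move=> tau tau0; rewrite -/(sumAn n s tau); have [t1|/ltW t1] := leP tau 1.
  apply: le_trans (sumAn_small s2 e0 He L0 HL tau0) _.
  rewrite -[leRHS]mulrA -expRD; apply: ler_peMr; first exact: mulr_ge0.
  by rewrite -[leLHS]expR0 ler_expR; lra.
apply: le_trans (sumAn_large n s2 t1) _; apply: ler_wpM2r; first exact: expR_ge0.
apply: (@le_trans _ _ (d%:R * (B * F ^+ 2 + 2 * e * L * d%:R))).
  by apply: ler_wpM2l => //; rewrite lerDl.
by apply: ler_peMr; [exact: mulr_ge0|rewrite -[leLHS]expR0 ler_expR].
Qed.

(** Two truncations coexist: [S] and [w] inside [gradPsi] stay fixed, while [n] approximates [f] and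
    [phi]. The constants [L1], [L2], [L3] involve derivatives, but they only multiply [eta], which
    tends to 0. The final constant depends neither on [S], [w] nor on [p]. *)
Lemma commutator_bound (phi : V -> R) (g : 'I_d -> V -> R) (p : R) : 0 < p ->
  cper phi -> (forall i, has_dx i phi (g i)) -> (forall i, continuous (g i)) ->
  (forall k, ca phi k = om k `^ (- p) * ca f k) -> (forall k, sa phi k = om k `^ (- p) * sa f k) ->
  `|\sum_j torus_int (fun x => f x * gradPsi j x * g j x)|
  <= d%:R * expR 1 * B * torus_int (fun x => f x ^+ 2).
Proof.
move=> p0 php dph gc hca hsa.
have gper i : cper (g i) by split => //; exact: Zperiodic_dx php.2 (dph i).
have bnd (I : finType) (H : I -> V -> R) : (forall i, cper (H i)) ->
    exists2 L, 0 <= L & forall i x, `|H i x| <= L.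
  move=> Hp; have Hi i := cper_bounded (Hp i).
  pose b i := projT1 (cid2 (Hi i)).
  have b0 i : 0 <= b i by rewrite /b; case: cid2.
  exists (\sum_i b i); first by apply: sumr_ge0.
  move=> i x; rewrite (bigD1 i) //=; apply: (@le_trans _ _ (b i)); last by rewrite lerDl sumr_ge0.
  by rewrite /b; case: cid2 => c c0 /= ->.
have [L1 L10 HL1] := bnd _ f' (fun i => cper_dx i).
have [L2 L20 HL2] := bnd _ g gper.
have [L3 L30 HL3'] := bnd _ (fun ji : 'I_d * 'I_d => fg_dx ji.1 ji.2) (fun ji => cper_fg_dx ji.1 ji.2).
have HL3 j i x : `|fg_dx j i x| <= L3 by exact: (HL3' (j, i)).
apply/ler_addgt0Pl => e e0.
pose M := d%:R * (2 * L1 * L3 * d%:R) * expR 1 + d%:R * (L3 * L2) + 1.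
have M0 : 0 < M by rewrite ltr_wpDl // addr_ge0 ?mulr_ge0 ?expR_ge0.
pose eta := e / M; have eta0 : 0 < eta by rewrite divr_gt0.
have [n Hn] := @Qn_approx R d eta eta0.
have Hf := Hn f f' L1 fp df HL1 L10; have Hphi := Hn phi g L2 php dph HL2 L20.
have Qp : cper (Qn n phi) by exact: cper_Mop.
pose Qg j := Mop (box d n) (fun k => - wave k j * 0) (fun k => wave k j * wt n k) phi.
have dQ j : has_dx j (Qn n phi) (Qg j) by exact: Mop_dx.
have QgE j : torus_int (fun x => f x * gradPsi j x * Qg j x)
   = \sum_(k <- box d n) (wt n k * An (fun x => f x * gradPsi j x) f k) * wave k j * om k `^ (- p).
  rewrite /Qg torus_int_Mop; last exact: (fg_p j).1.
  by apply: eq_bigr => k _; rewrite /An hca hsa; ring.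
have err j : `|torus_int (fun x => f x * gradPsi j x * g j x) - torus_int (fun x => f x * gradPsi j x * Qg j x)|
    <= L3 * (L2 * eta).
  have Qgp : cper (Qg j) by exact: cper_Mop.
  rewrite -torus_intB; [|exact: (cperM (fg_p j) (gper j)).1|exact: (cperM (fg_p j) Qgp).1].
  (* Only [phi], not its gradient, is approximated uniformly, so the derivative is moved onto the
     other factor. *)
  have -> : torus_int (fun x => f x * gradPsi j x * g j x - f x * gradPsi j x * Qg j x)
    = - torus_int (fun x => fg_dx j j x * (phi x - Qn n phi x)).
    rewrite (torus_int_by_parts (fg_p j) (cperB php Qp) (cper_fg_dx j j).1 _ (has_dx_fg j j)
       (fun x => deriB (dph j x) (dQ j x))); last exact: (cperB (gper j) Qgp).1.
    by rewrite opprK; congr torus_int; apply/funext => x; ring.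
  rewrite normrN -[leRHS](@torus_int_cst R d); apply: torus_int_norm_le.
  - exact: (cperM (cper_fg_dx j j) (cperB php Qp)).1.
  - exact: cont_cst.
  - by move=> x; rewrite normrM; exact: ler_pM.
have main : `|\sum_j torus_int (fun x => f x * gradPsi j x * Qg j x)|
    <= d%:R * (B * F ^+ 2 + 2 * (L1 * eta) * L3 * d%:R) * expR 1.
  have e1 : 0 <= L1 * eta by rewrite mulr_ge0 // ltW.
  have P s : s ^+ 2 = 1 -> s * \sum_j torus_int (fun x => f x * gradPsi j x * Qg j x)
    <= d%:R * (B * F ^+ 2 + 2 * (L1 * eta) * L3 * d%:R) * expR 1.
    move=> s2; apply: le_trans (sumAn_power s2 e1 Hf L30 HL3 p0).
    rewrite le_eqVlt; apply/orP; left; apply/eqP.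
    rewrite (eq_bigr _ (fun j _ => QgE j)) exchange_big /= mulr_sumr; apply: eq_bigr => k _.
    by rewrite mulr_suml mulr_sumr; apply: eq_bigr => j _; ring.
  have := P 1 (expr1n _ _); have := P (-1) (sqrr_sign _ 1).
  by rewrite mulN1r mul1r ler_norml lerNl => -> ->.
rewrite F2.
have -> : \sum_j torus_int (fun x => f x * gradPsi j x * g j x)
  = \sum_j torus_int (fun x => f x * gradPsi j x * Qg j x)
  + \sum_j (torus_int (fun x => f x * gradPsi j x * g j x) - torus_int (fun x => f x * gradPsi j x * Qg j x)).
  by rewrite sumrB addrCA subrr addr0.
apply: le_trans (ler_normD _ _) _.
have errs : `|\sum_j (torus_int (fun x => f x * gradPsi j x * g j x) - torus_int (fun x => f x * gradPsi j x * Qg j x))|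
   <= d%:R * (L3 * (L2 * eta)).
  apply: le_trans (ler_norm_sum _ _ _) _.
  have -> : d%:R * (L3 * (L2 * eta)) = \sum_(j < d) L3 * (L2 * eta).
    by rewrite sumr_const card_ord -[RHS]mulr_natr mulrC.
  by apply: ler_sum => j _; exact: err.
apply: le_trans (lerD main errs) _.
have eM : eta * M = e by rewrite divfK // gt_eqF.
rewrite -[in leRHS]eM /M.
rewrite (_ : d%:R * (B * F ^+ 2 + 2 * (L1 * eta) * L3 * d%:R) * expR 1 + d%:R * (L3 * (L2 * eta))
  = eta * (d%:R * (2 * L1 * L3 * d%:R) * expR 1 + d%:R * (L3 * L2)) + d%:R * expR 1 * B * F ^+ 2); last by ring.
by rewrite lerD2r ler_pM2l // lerDl.
Qed.

End commutator.

(** * The Lyapunov functional *)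

Section static_estimates.
Context {R : realType} (d : nat) (d0 : (0 < d)%N) (n : nat).
Notation V := 'rV[R]_d.
Notation K := 'rV[int]_d.
Implicit Types (f g h : V -> R) (k : K).

(** [i * gsym] is the truncated symbol of the i-th component of grad Delta^(-1): a derivative
    contributes [i * wave], the Laplacian [- om]. *)
Definition gsym (i : 'I_d) k : R := - (wt n k * wave k i / om k).

Lemma gsym_sqr_le1 i k : gsym i k ^+ 2 <= 1.
Proof.
have o1 := @om_ge1 R d k; have := @wave_sqr_le_om R d k i.
have w0 := @wt_ge0 R d n k; have w1 := @wt_le1 R d n k.
rewrite /gsym; move: (wave k i) (om k) (wt n k) w0 w1 o1 => v o a a0 a1 o1 vo.
have o0 : 0 < o by lra.
have h : (- (a * v / o)) ^+ 2 * o <= 1.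
  by apply: weighted_sqr_le; rewrite ?a0 ?mulr1.
apply: le_trans h; rewrite ler_peMr ?sqr_ge0 //.
Qed.

Lemma wave2_sym_sqr_le1 (i j : 'I_d) k (s : R) : s ^+ 2 = 1 ->
  (s * (wt n k * (wave k i * wave k j) / om k)) ^+ 2 <= 1.
Proof.
move=> s2; have o1 := @om_ge1 R d k; have := @wave_sqr_le_om R d k i; have := @wave_sqr_le_om R d k j.
have w0 := @wt_ge0 R d n k; have w1 := @wt_le1 R d n k.
move: (wave k i) (wave k j) (om k) (wt n k) w0 w1 o1 => v v' o a a0 a1 o1 vo' vo.
have o0 : 0 < o by lra.
rewrite exprMn s2 mul1r !exprMn exprVn ler_pdivrMr ?exprn_gt0 // mul1r.
have h1 : a ^+ 2 <= 1 by exact: exprn_ile1.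
have h2 : v ^+ 2 * v' ^+ 2 <= o ^+ 2 by rewrite (expr2 o); apply: ler_pM => //; exact: sqr_ge0.
by rewrite -[leRHS]mul1r; apply: ler_pM => //; [exact: sqr_ge0|apply: mulr_ge0; exact: sqr_ge0].
Qed.

Lemma An_dx_l i h h' f k : cper h -> continuous h' -> has_dx i h h' ->
  An h' f k = wave k i * Sy h f k.
Proof. by move=> hp hc dh; rewrite /An /Sy (ca_dx k hp hc dh) (sa_dx k hp hc dh); ring. Qed.

Lemma An_dx_r i h h' f k : cper h -> continuous h' -> has_dx i h h' ->
  An f h' k = - wave k i * Sy f h k.
Proof. by move=> hp hc dh; rewrite /An /Sy (ca_dx k hp hc dh) (sa_dx k hp hc dh); ring. Qed.

Lemma AnDl f g h k : continuous f -> continuous g -> An (fun x => f x + g x) h k = An f h k + An g h k.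
Proof. by move=> fc gc; rewrite /An caD // saD //; ring. Qed.

Lemma AnZl c f h k : continuous f -> An (fun x => c * f x) h k = c * An f h k.
Proof. by move=> fc; rewrite /An caZ // saZ //; ring. Qed.

Lemma AnZr c f h k : continuous f -> An h (fun x => c * f x) k = c * An h f k.
Proof. by move=> fc; rewrite /An caZ // saZ //; ring. Qed.

Lemma An_sumr (I : Type) (r : seq I) (P : pred I) (G : I -> V -> R) h k :
  (forall i, P i -> continuous (G i)) ->
  An h (fun x => \sum_(i <- r | P i) G i x) k = \sum_(i <- r | P i) An h (G i) k.
Proof. by move=> Fc; rewrite /An ca_sum // sa_sum // !mulr_sumr sumrB. Qed.

Lemma sum_gsym_wave k : \sum_i gsym i k * wave k i = - (wt n k * (k != 0)%:R).
Proof.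
have [->|k0] /= := eqVneq k 0.
  by rewrite mulr0 oppr0 big1 // => i _; rewrite wave0 mulr0.
rewrite mulr1 (eq_bigr (fun i => - (wt n k / om k) * wave k i ^+ 2)); last first.
  by move=> i _; rewrite /gsym; ring.
rewrite -mulr_sumr -/(omega2 k) mulNr; congr (- _).
have := @om_gt0 R d k; rewrite /om (negPf k0) => o0.
by rewrite divfK // gt_eqF.
Qed.

Lemma sum_le_CS (c e : K -> R) f g (A C : R) : continuous f -> continuous g ->
  0 <= A -> 0 <= C -> (forall k, c k ^+ 2 + e k ^+ 2 <= 1) ->
  torus_int (fun x => g x ^+ 2) <= A ^+ 2 -> torus_int (fun x => f x ^+ 2) <= C ^+ 2 ->
  - (A * C) <= \sum_(k <- box d n) (c k * Sy g f k + e k * An g f k).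
Proof.
move=> fc gc A0 C0 ce gA fC.
have := @sum_SyAn_le R d (box d n) c e f g 1 A C (box_symmetric d n) fc gc A0 ler01 C0.
rewrite mul1r expr1n => /(_ (fun k _ => ce k) gA fC).
by rewrite ler_norml => /andP[].
Qed.

(** * Estimates at a fixed time *)

Section time_slice.
Variables (f ft P : V -> R) (m mt : 'I_d -> V -> R) (md FL FLd : 'I_d -> 'I_d -> V -> R).
Variables (Pd fd g : 'I_d -> V -> R) (phi : V -> R) (nu lam p B eta Pb U F : R).
Hypotheses (fp : cper f) (dfx : forall i, has_dx i f (fd i)) (fdc : forall i, continuous (fd i)).
Hypotheses (mp : forall i, cper (m i)) (dm : forall i j, has_dx j (m i) (md i j))
  (mdc : forall i j, continuous (md i j)).
Hypotheses (FLp : forall i j, cper (FL i j)) (dFL : forall i j, has_dx j (FL i j) (FLd i j))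
  (FLdc : forall i j, continuous (FLd i j)).
Hypotheses (Pp : cper P) (dP : forall i, has_dx i P (Pd i)) (Pdc : forall i, continuous (Pd i)).
Hypotheses (phip : cper phi) (dphi : forall i, has_dx i phi (g i)) (gc : forall i, continuous (g i)).
Hypotheses (p0 : 0 < p) (hca : forall k, ca phi k = om k `^ (- p) * ca f k)
  (hsa : forall k, sa phi k = om k `^ (- p) * sa f k).
Hypotheses (f0 : torus_int f = 0).
Hypotheses (eqf : forall x, ft x = - \sum_j md j j x).
Hypotheses (eqm : forall i x, mt i x
  = - \sum_j FLd i j x - Pd i x - nu * m i x + lam * ((1 + f x) * g i x)).
Hypotheses (B0 : 0 <= B) (fB : forall x, `|f x| <= B).
Hypotheses (lam0 : 0 <= lam) (nu0 : 0 <= nu) (U0 : 0 <= U) (F0 : 0 <= F).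
Hypotheses (mU : forall i, torus_int (fun x => m i x ^+ 2) <= U ^+ 2).
Hypotheses (FLU : forall i j, torus_int (fun x => FL i j x ^+ 2) <= U ^+ 2).
Hypotheses (fF : torus_int (fun x => f x ^+ 2) = F ^+ 2).

Let fc : continuous f := fp.1.

Let Sy0 h : Sy h f 0 = 0.
Proof.
have c0 : ca f 0 = 0.
  by rewrite /ca -[RHS]f0; congr torus_int; apply/funext => x; rewrite phase0l cos0 mulr1.
have s0 : sa f 0 = 0.
  rewrite /sa -[RHS](torus_int_cst d); congr torus_int; apply/funext => x.
  by rewrite phase0l sin0 mulr0.
by rewrite /Sy c0 s0 !mulr0 addr0.
Qed.

(** The mean of [f] vanishes, so the frequency 0, where [om] is only a convention, contributes
    nothing. *)
Let dropk0 h (c : K -> R) : \sum_(k <- box d n) c k * (k != 0)%:R * Sy h f k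
  = \sum_(k <- box d n) c k * Sy h f k.
Proof.
apply: eq_bigr => k _; case: eqP => [->|_] /=; last by rewrite mulr1.
by rewrite Sy0 !mulr0.
Qed.

Lemma gradPsi_pair i h : continuous h ->
  torus_int (fun x => h x * gradPsi (box d n) (wt n) f i x) = \sum_(k <- box d n) gsym i k * An h f k.
Proof.
by move=> hc; rewrite torus_int_Mop //; apply: eq_bigr => k _; rewrite mul0r add0r.
Qed.

Let ftc : continuous ft.
Proof.
rewrite (_ : ft = fun x => - \sum_j md j j x); last exact/funext.
by apply: contN; apply: cont_sum => j _; exact: mdc.
Qed.

(** The contributions to the derivative of the cross term: convection [T1], pressure [T2], damping
    [T3], linear and quadratic parts of the Riesz force [T4] and [T5], and the motion of the density
    [T6]. *)
Let T1 := \sum_i \sum_(k <- box d n) gsym i k * An (fun x => - \sum_j FLd i j x) f k.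
Let T2 := \sum_i \sum_(k <- box d n) gsym i k * An (fun x => - Pd i x) f k.
Let T3 := \sum_i \sum_(k <- box d n) gsym i k * An (fun x => - nu * m i x) f k.
Let T4 := \sum_i \sum_(k <- box d n) gsym i k * An (fun x => lam * g i x) f k.
Let T5 := \sum_i \sum_(k <- box d n) gsym i k * An (fun x => lam * (f x * g i x)) f k.
Let T6 := \sum_i \sum_(k <- box d n) gsym i k * An (m i) ft k.

Let ge_sum_cst (I : finType) (G : I -> R) (C : R) : (forall i, - C <= G i) ->
  - (#|I|%:R * C) <= \sum_i G i.
Proof.
move=> H; apply: (@le_trans _ _ (\sum_(i : I) - C)); last by apply: ler_sum.
by rewrite sumr_const -[leRHS]mulr_natl mulrN.
Qed.

(** The divergence of the flux and the gradient in front of the inverse Laplacian combine to a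
    symbol of order 0, so no derivative of the velocity appears. *)
Let T1_ge : - (d%:R * (d%:R * (U * F))) <= T1.
Proof.
rewrite -{1}(card_ord d); apply: ge_sum_cst => i.
rewrite (_ : \sum_(k <- _) _ = \sum_j \sum_(k <- box d n)
   (1 * (wt n k * (wave k i * wave k j) / om k) * Sy (FL i j) f k + 0 * An (FL i j) f k)).
  rewrite -{1}(card_ord d); apply: ge_sum_cst => j; apply: sum_le_CS => //.
  - exact: (FLp i j).1.
  - by move=> k; rewrite expr0n addr0; apply: wave2_sym_sqr_le1; rewrite expr1n.
  - by rewrite fF.
rewrite exchange_big /=; apply: eq_bigr => k _.
rewrite (_ : (fun x => - \sum_j FLd i j x) = fun x => (-1) * \sum_j FLd i j x); last first.
  by apply/funext => x; rewrite mulN1r.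
rewrite AnZl; last by apply: cont_sum => j _; exact: FLdc.
rewrite An_sum; last by move=> j _; exact: FLdc.
rewrite !mulr_sumr; apply: eq_bigr => j _.
by rewrite (An_dx_l f k (FLp i j) (@FLdc i j) (@dFL i j)) /gsym; ring.
Qed.

Let T2_E : T2 = torus_int (fun x => P x * Qn n f x).
Proof.
rewrite /Qn torus_int_Mop; last exact: Pp.1.
rewrite [RHS](eq_bigr (fun k => wt n k * Sy P f k)); last by move=> k _; rewrite mul0r addr0.
rewrite -dropk0 /T2 exchange_big /=; apply: eq_bigr => k _.
rewrite (eq_bigr (fun i => - (gsym i k * wave k i) * Sy P f k)).
  by rewrite -mulr_suml sumrN sum_gsym_wave opprK.
move=> i _.
rewrite (_ : (fun x => - Pd i x) = fun x => (-1) * Pd i x); last first.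
  by apply/funext => x; rewrite mulN1r.
rewrite AnZl //.
by rewrite (An_dx_l f k Pp (@Pdc i) (@dP i)); ring.
Qed.

Let T3_ge : - (d%:R * (nu * (U * F))) <= T3.
Proof.
rewrite -{1}(card_ord d); apply: ge_sum_cst => i.
rewrite (_ : \sum_(k <- _) _ = nu * \sum_(k <- box d n) (0 * Sy (m i) f k + - gsym i k * An (m i) f k)).
  rewrite -mulrN; apply: ler_wpM2l => //; apply: sum_le_CS => //.
  - exact: (mp i).1.
  - by move=> k; rewrite expr0n add0r sqrrN; exact: gsym_sqr_le1.
  - by rewrite fF.
rewrite mulr_sumr; apply: eq_bigr => k _; rewrite AnZl; last exact: (mp i).1.
by ring.
Qed.

Let ombp k : 0 <= (om k : R) `^ (- p) <= 1.
Proof.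
rewrite powR_ge0 /= powRN invf_le1 ?powR_gt0 ?om_gt0 //.
by rewrite -[leLHS](powRr0 (om k)); apply: ler_powR; [exact: om_ge1|exact: ltW].
Qed.

Let T4_ge : - (lam * F ^+ 2) <= T4.
Proof.
have -> : T4 = lam * \sum_(k <- box d n) (- (wt n k * om k `^ (- p)) * Sy f f k + 0 * An f f k).
  rewrite /T4 exchange_big mulr_sumr /=.
  rewrite [RHS](eq_bigr (fun k => (- lam * (wt n k * om k `^ (- p))) * Sy f f k)); last first.
    by move=> k _; ring.
  rewrite -dropk0; apply: eq_bigr => k _.
  rewrite (eq_bigr (fun i => (gsym i k * wave k i) * (lam * Sy phi f k))).
    by rewrite -mulr_suml sum_gsym_wave /Sy hca hsa; ring.
  by move=> i _; rewrite AnZl // (An_dx_l f k phip (@gc i) (@dphi i)); ring.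
rewrite -mulrN expr2; apply: ler_wpM2l => //; apply: sum_le_CS; rewrite ?fF //.
move=> k; rewrite expr0n addr0 sqrrN exprn_ile1 //.
  by rewrite mulr_ge0 ?wt_ge0 //; have /andP[] := ombp k.
by rewrite mulr_ile1 ?wt_ge0 ?wt_le1 //; have /andP[] := ombp k.
Qed.

Let T5_ge : - (lam * (d%:R * expR 1 * B * F ^+ 2)) <= T5.
Proof.
have -> : T5 = lam * \sum_j torus_int (fun x => f x * gradPsi (box d n) (wt n) f j x * g j x).
  rewrite mulr_sumr; apply: eq_bigr => j _.
  have fgc : continuous (fun x => f x * g j x) by apply: contM => //; exact: gc.
  rewrite (eq_bigr (fun k => lam * (gsym j k * An (fun x => f x * g j x) f k))).
    rewrite -mulr_sumr; congr (_ * _); rewrite -gradPsi_pair //.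
    by congr torus_int; apply/funext => x; ring.
  by move=> k _; rewrite AnZl //; ring.
rewrite -mulrN; apply: ler_wpM2l => //.
have w01 (k : K) : 0 <= (wt n k : R) <= 1 by rewrite wt_ge0 wt_le1.
have := @commutator_bound R d d0 (box d n) (wt n) (box_symmetric d n) w01 f fd B fp dfx fdc B0 fB
  phi g p p0 phip dphi gc hca hsa.
by rewrite fF ler_norml => /andP[].
Qed.

Let T6_ge : - (d%:R * (d%:R * (U * U))) <= T6.
Proof.
rewrite -{1}(card_ord d); apply: ge_sum_cst => i.
rewrite (_ : \sum_(k <- _) _ = \sum_j \sum_(k <- box d n)
   ((-1) * (wt n k * (wave k i * wave k j) / om k) * Sy (m i) (m j) k + 0 * An (m i) (m j) k)).
  rewrite -{1}(card_ord d); apply: ge_sum_cst => j; apply: sum_le_CS => //.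
  - exact: (mp j).1.
  - exact: (mp i).1.
  - by move=> k; rewrite expr0n addr0; apply: wave2_sym_sqr_le1; rewrite sqrrN expr1n.
rewrite exchange_big /=; apply: eq_bigr => k _.
rewrite (_ : ft = fun x => (-1) * \sum_j md j j x); last first.
  by apply/funext => x; rewrite mulN1r eqf.
rewrite AnZr; last by apply: cont_sum => j _; exact: mdc.
rewrite An_sumr; last by move=> j _; exact: mdc.
rewrite !mulr_sumr; apply: eq_bigr => j _.
by rewrite (An_dx_r (m i) k (mp j) (@mdc j j) (@dm j j)) /gsym; ring.
Qed.

(** [T2] is the coercive term. It involves [Qn n f] because the kernel weight enters [gsym] once.
    [T5] is the commutator; the others follow from Cauchy-Schwarz with symbols of modulus at most
    1. *)
Lemma cross_term_dissipation :
  torus_int (fun x => P x * Qn n f x) - lam * (1 + d%:R * expR 1 * B) * F ^+ 2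
   - (d%:R ^+ 2 + d%:R * nu) * (U * F) - d%:R ^+ 2 * U ^+ 2
  <= \sum_i \sum_(k <- box d n) gsym i k * (An (mt i) f k + An (m i) ft k).
Proof.
have -> : \sum_i \sum_(k <- box d n) gsym i k * (An (mt i) f k + An (m i) ft k)
   = T1 + T2 + T3 + T4 + T5 + T6.
  rewrite /T1 /T2 /T3 /T4 /T5 /T6 -!big_split /=; apply: eq_bigr => i _.
  rewrite -!big_split /=; apply: eq_bigr => k _.
  have c1 : continuous (fun x => - \sum_j FLd i j x).
    by apply: contN; apply: cont_sum => j _; exact: FLdc.
  have c2 : continuous (fun x => - Pd i x) by apply: contN; exact: Pdc.
  have c3 : continuous (fun x => - nu * m i x) by apply: contZ; exact: (mp i).1.
  have c4 : continuous (fun x => lam * g i x) by apply: contZ; exact: gc.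
  have c5 : continuous (fun x => lam * (f x * g i x)) by apply: contZ; apply: contM => //; exact: gc.
  have -> : mt i = fun x => - \sum_j FLd i j x + - Pd i x + - nu * m i x + lam * g i x + lam * (f x * g i x).
    by apply/funext => x; rewrite eqm; ring.
  rewrite !AnDl //; do ?by [do !(apply: contD)].
  by ring.
have := T1_ge; have := T3_ge; have := T4_ge; have := T5_ge; have := T6_ge.
by rewrite T2_E; lra.
Qed.

Lemma cross_term_bound :
  `|\sum_i \sum_(k <- box d n) gsym i k * An (m i) f k| <= d%:R * (U * F).
Proof.
apply: le_trans (ler_norm_sum _ _ _) _.
have -> : d%:R * (U * F) = \sum_(i < d) U * F by rewrite sumr_const card_ord -[RHS]mulr_natl.
apply: ler_sum => i _.
rewrite (eq_bigr (fun k => 0 * Sy (m i) f k + gsym i k * An (m i) f k)); last first.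
  by move=> k _; rewrite mul0r add0r.
rewrite -[leRHS]mul1r; apply: sum_SyAn_le => //.
- exact: box_symmetric.
- exact: (mp i).1.
- by move=> k _; rewrite expr0n add0r expr1n; exact: gsym_sqr_le1.
- by rewrite fF.
Qed.

Lemma potential_energy_bound :
  0 <= \sum_(k <- box d n) wt n k * om k `^ (- p) * Sy f f k <= F ^+ 2.
Proof.
have S0 k : 0 <= Sy f f k by rewrite /Sy addr_ge0 // -expr2 sqr_ge0.
apply/andP; split.
  by apply: sumr_ge0 => k _; rewrite !mulr_ge0 ?wt_ge0 ?powR_ge0.
rewrite -fF; apply: le_trans (bessel (box_symmetric d n) fc).
apply: ler_sum => k _; rewrite ler_piMl //.
by rewrite mulr_ile1 ?wt_ge0 ?wt_le1 ?powR_ge0 //; have /andP[] := ombp k.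
Qed.

(** Integration by parts and the mass equation turn the power of the force into int ft phi, whereas
    the truncated potential energy produces int ft (Qn phi). *)
Lemma potential_energy_rate (e L : R) : (forall x, `|phi x - Qn n phi x| <= e) ->
  (forall x, `|ft x| <= L) -> 0 <= L ->
  `|\sum_i torus_int (fun x => m i x * g i x)
    - \sum_(k <- box d n) wt n k * om k `^ (- p) * Sy f ft k| <= L * e.
Proof.
move=> He HL L0; have Qp : cper (Qn n phi) by exact: cper_Mop.
have -> : \sum_i torus_int (fun x => m i x * g i x) = torus_int (fun x => ft x * phi x).
  rewrite (eq_bigr (fun i => torus_int (fun x => - (md i i x * phi x)))).
    rewrite -torus_int_sum; last by move=> i _; apply: contN; apply: contM; [exact: mdc|exact: phip.1].
    congr torus_int; apply/funext => x; rewrite eqf mulNr mulr_suml -sumrN.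
    by [].
  move=> i _; rewrite torus_intN; last by apply: contM; [exact: mdc|exact: phip.1].
  by rewrite (torus_int_by_parts (mp i) phip (@mdc i i) (@gc i) (@dm i i) (@dphi i)) opprK.
have -> : \sum_(k <- box d n) wt n k * om k `^ (- p) * Sy f ft k = torus_int (fun x => ft x * Qn n phi x).
  rewrite torus_int_Mop //; apply: eq_bigr => k _.
  by rewrite mul0r addr0 /Sy hca hsa; ring.
rewrite -torus_intB; [|by apply: contM => //; exact: phip.1|by apply: contM => //; exact: Qp.1].
rewrite -[leRHS](@torus_int_cst R d); apply: torus_int_norm_le; [|exact: cont_cst|].
  by apply: contB; apply: contM => //; [exact: phip.1|exact: Qp.1].
by move=> x; rewrite -mulrBr normrM; exact: ler_pM.
Qed.

End time_slice.

End static_estimates.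

(** * Functions of time and space *)

Section space_time.
Context {R : realType} (d : nat).
Notation V := 'rV[R]_d.
Implicit Types (f ft : R -> V -> R).

Definition jcont f := continuous (fun q : R * V => f q.1 q.2).

Lemma jcont_slice f t : jcont f -> continuous (f t).
Proof.
move=> fc; apply: (continuous_comp2 fc); first exact: cst_continuous.
by move=> x; exact: cvg_id.
Qed.

Lemma jcont_const (h : V -> R) : continuous h -> jcont (fun=> h).
Proof.
by move=> hc q; apply: (@continuous_comp _ V R (@snd R V) h q); [exact: cvg_snd|exact: hc].
Qed.

Lemma continuous_int_jcont f : jcont f -> continuous (fun t => torus_int (f t)).
Proof. exact: continuous_torus_int. Qed.

Lemma is_derive_int_jcont f ft : jcont f -> jcont ft ->
  (forall (t : R) (x : V), 0 < t -> is_derive t 1 (f ^~ x) (ft t x)) ->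
  forall t : R, 0 < t -> is_derive t 1 (fun s => torus_int (f s)) (torus_int (ft t)).
Proof.
move=> fc ftc df t t0; apply: (@torus_int_derive R d f ft t t) => //.
- by move=> s x; rewrite ltr_norml => /andP[h _]; apply: df; lra.
- by move=> s _; exact: jcont_slice.
- by move=> x; exact: ftc.
Qed.

Lemma is_derive_ca_jcont f ft k : jcont f -> jcont ft ->
  (forall (t : R) (x : V), 0 < t -> is_derive t 1 (f ^~ x) (ft t x)) ->
  forall t : R, 0 < t -> is_derive t 1 (fun s => ca (f s) k) (ca (ft t) k).
Proof.
move=> fc ftc df; have cc := jcont_const (@cper_cos R d k).1.
apply: (@is_derive_int_jcont (fun t x => f t x * cos (phase k x)) (fun t x => ft t x * cos (phase k x))).
- exact: contM.
- exact: contM.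
- move=> t x t0; have h := df t x t0.
  by have := deriM h (deri_cst (cos (phase k x)) t 1); rewrite mulr0 addr0.
Qed.

Lemma is_derive_sa_jcont f ft k : jcont f -> jcont ft ->
  (forall (t : R) (x : V), 0 < t -> is_derive t 1 (f ^~ x) (ft t x)) ->
  forall t : R, 0 < t -> is_derive t 1 (fun s => sa (f s) k) (sa (ft t) k).
Proof.
move=> fc ftc df; have cc := jcont_const (@cper_sin R d k).1.
apply: (@is_derive_int_jcont (fun t x => f t x * sin (phase k x)) (fun t x => ft t x * sin (phase k x))).
- exact: contM.
- exact: contM.
- move=> t x t0; have h := df t x t0.
  by have := deriM h (deri_cst (sin (phase k x)) t 1); rewrite mulr0 addr0.
Qed.

Lemma continuous_ca_jcont f k : jcont f -> continuous (fun t => ca (f t) k).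
Proof.
move=> fc; have cc := jcont_const (@cper_cos R d k).1.
by apply: (@continuous_int_jcont (fun t x => f t x * cos (phase k x))); exact: contM.
Qed.

Lemma continuous_sa_jcont f k : jcont f -> continuous (fun t => sa (f t) k).
Proof.
move=> fc; have cc := jcont_const (@cper_sin R d k).1.
by apply: (@continuous_int_jcont (fun t x => f t x * sin (phase k x))); exact: contM.
Qed.

(** Periodicity is asked only after [L] is fixed and time by time: for some of the functions it
    follows from equations that hold at positive times only. *)
Lemma jcont_bounded f T : jcont f ->
  exists2 L, 0 <= L & forall t, 0 <= t <= T -> Zperiodic (f t) -> forall x, `|f t x| <= L.
Proof.
move=> fc; pose A := (`[0, T]%classic : set R) `*` [set x : V | forall i, 0 <= x 0 i <= 1].
have cA : compact A by apply: compact_setX; [exact: segment_compact|exact: compact_cube].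
have fw : {within A, continuous (fun q : R * V => f q.1 q.2)} by exact: continuous_subspaceT.
have /compact_bounded[L [_ LP]] := continuous_compact fw cA.
exists (`|L| + 1) => // t tT fp x; have [k kx] := periodic_reduce x.
rewrite -(fp x k); apply: (LP (`|L| + 1)); last by exists (t, x + lattice k) => //; split; rewrite //= in_itv.
by rewrite (le_lt_trans (ler_norm L))// ltrDl.
Qed.

Lemma jcont_bounded_fin (I : finType) (f : I -> R -> V -> R) T : (forall i, jcont (f i)) ->
  exists2 L, 0 <= L & forall i t, 0 <= t <= T -> Zperiodic (f i t) -> forall x, `|f i t x| <= L.
Proof.
move=> fc; have Hi i := jcont_bounded T (fc i).
pose b i := projT1 (cid2 (Hi i)).
have b0 i : 0 <= b i by rewrite /b; case: cid2.
exists (\sum_i b i); first by apply: sumr_ge0.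
move=> i t tT fp x; rewrite (bigD1 i) //=; apply: (@le_trans _ _ (b i)); last by rewrite lerDl sumr_ge0.
by rewrite /b; case: cid2 => c c0 /= ->.
Qed.

End space_time.

(** e^(mu t) (L - eta / mu) is nonincreasing. Differentiability is required at positive times only;
    continuity covers t = 0 through the mean value theorem. *)
Lemma gronwall (R : realType) (L dL : R -> R) (mu eta T : R) : 0 < mu -> 0 <= eta -> 0 <= T ->
  continuous L -> (forall t : R, 0 < t -> is_derive t 1 L (dL t)) ->
  (forall t, 0 < t <= T -> dL t <= - mu * L t + eta) ->
  L T <= expR (- (mu * T)) * L 0 + eta / mu.
Proof.
move=> mu0 eta0 T0 Lc dLt H.
pose Phi t := expR (mu * t) * (L t - eta / mu).
have dPhi (t : R) : 0 < t -> is_derive t 1 Phi (expR (mu * t) * mu * (L t - eta / mu) + expR (mu * t) * (dL t - 0)).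
  move=> t0; have dE : is_derive t (1 : R) (fun s => expR (mu * s)) (expR (mu * t) * mu).
    by have := is_derive_chain (is_derive_expR (mu * t)) (deriZ mu (is_derive_id t (1 : R))); rewrite mulr1.
  exact: (deriM dE (deriB (dLt t t0) (deri_cst (eta / mu) t 1))).
have Pc : continuous Phi.
  apply: contM; last by apply: contB => //; exact: cont_cst.
  by apply: cont_comp; [exact: continuous_expR|apply: contZ => x; exact: cvg_id].
move: T0; rewrite le_eqVlt => /predU1P[<-|T0].
  by rewrite mulr0 oppr0 expR0 mul1r lerDl divr_ge0 // ltW.
have [||c] := @MVT R Phi (fun t => expR (mu * t) * mu * (L t - eta / mu) + expR (mu * t) * (dL t - 0)) 0 T T0.
- by move=> x; rewrite in_itv /= => /andP[x0 _]; exact: dPhi.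
- exact: continuous_subspaceT.
rewrite in_itv /= => /andP[c0 cT] e.
have : Phi T - Phi 0 <= 0.
  rewrite e pmulr_lle0; last by rewrite subr_gt0.
  rewrite (_ : _ + _ = expR (mu * c) * (dL c - (- mu * L c + eta))); last by field; rewrite gt_eqF.
  by rewrite pmulr_rle0 ?expR_gt0 // subr_le0 H // c0 ltW.
rewrite subr_le0 /Phi mulr0 expR0 mul1r => h.
have := ler_wpM2l (expR_ge0 (- (mu * T))) h.
rewrite mulrA -expRD addNr expR0 mul1r mulrBr => h'.
have : 0 <= expR (- (mu * T)) * (eta / mu) by rewrite mulr_ge0 ?expR_ge0 // divr_ge0 // ltW.
by lra.
Qed.

(** * The Lyapunov argument for an abstract conservation law *)

Section lyapunov.
Context {R : realType} (d : nat) (d0 : (0 < d)%N).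
Notation V := 'rV[R]_d.
Notation K := 'rV[int]_d.

(** In the application [en] is the kinetic plus internal energy density, [W] is |u|^2, [FL i j] is
    the momentum flux m_i u_j, [g] is the gradient of the potential and [r0] is the damping rate.
    Time derivatives are called [ft], [mt], [ent], space derivatives [fd], [md], [Pd], [FLd]. *)
Variables (f ft en ent P W : R -> V -> R) (m mt fd Pd g : 'I_d -> R -> V -> R)
  (md FL FLd : 'I_d -> 'I_d -> R -> V -> R).
Variables (nu lam p B c1 c2 c3 c4 r0 : R).
Hypotheses (fj : jcont f) (ftj : jcont ft) (enj : jcont en) (entj : jcont ent)
  (Pj : jcont P) (Wj : jcont W) (mj : forall i, jcont (m i)) (mtj : forall i, jcont (mt i))
  (fdj : forall i, jcont (fd i)) (Pdj : forall i, jcont (Pd i)) (gj : forall i, jcont (g i))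
  (mdj : forall i j, jcont (md i j)) (FLj : forall i j, jcont (FL i j))
  (FLdj : forall i j, jcont (FLd i j)).
Hypotheses (fper : forall t, Zperiodic (f t)) (Pper : forall t, Zperiodic (P t))
  (mper : forall i t, Zperiodic (m i t)) (FLper : forall i j t, Zperiodic (FL i j t)).
Hypotheses (dft : forall (t : R) x, 0 < t -> is_derive t 1 (f ^~ x) (ft t x))
  (dmt : forall i (t : R) x, 0 < t -> is_derive t 1 (m i ^~ x) (mt i t x))
  (dent : forall (t : R) x, 0 < t -> is_derive t 1 (en ^~ x) (ent t x)).
Hypotheses (dfx : forall i t, has_dx i (f t) (fd i t)) (dPx : forall i t, has_dx i (P t) (Pd i t))
  (dmx : forall i j t, has_dx j (m i t) (md i j t)) (dFLx : forall i j t, has_dx j (FL i j t) (FLd i j t)).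
Hypotheses (mass : forall t x, 0 < t -> ft t x = - \sum_j md j j t x)
  (momentum : forall i t x, 0 < t -> mt i t x = - \sum_j FLd i j t x - Pd i t x
     - nu * m i t x + lam * ((1 + f t x) * g i t x))
  (energy : forall t, 0 < t -> torus_int (ent t)
     <= - r0 * torus_int (W t) + lam * \sum_i torus_int (fun x => m i t x * g i t x)).
Hypotheses (potential : forall t, 0 < t -> exists phi : V -> R,
  [/\ cper phi, forall i, has_dx i phi (g i t),
      forall k, ca phi k = om k `^ (- p) * ca (f t) k
    & forall k, sa phi k = om k `^ (- p) * sa (f t) k]).
Hypotheses (f_mean0 : forall t, torus_int (f t) = 0).
Hypotheses (p0 : 0 < p) (nu0 : 0 <= nu) (lam0 : 0 <= lam) (B0 : 0 <= B)
  (c10 : 0 < c1) (c20 : 0 < c2) (c30 : 0 < c3) (c40 : 0 <= c4) (r00 : 0 < r0).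
Hypotheses (lam_small : lam * (1 + d%:R * expR 1 * B) <= c1 / 4) (lam_c2 : lam <= c2 / 2).
Hypotheses (fB : forall (t : R) (x : V), `|f t x| <= B) (W0 : forall (t : R) (x : V), 0 <= W t x)
  (Pf : forall (t : R) (x : V), c1 * f t x ^+ 2 <= P t x * f t x)
  (en_lo : forall t x, c2 * (f t x ^+ 2 + W t x) <= en t x)
  (en_hi : forall t x, en t x <= c3 * (f t x ^+ 2 + W t x))
  (mW : forall i t x, m i t x ^+ 2 <= c4 ^+ 2 * W t x)
  (FLW : forall i j t x, FL i j t x ^+ 2 <= c4 ^+ 2 * W t x).

Let sl (h : R -> V -> R) t : jcont h -> continuous (h t). Proof. exact: jcont_slice. Qed.
Let y t := torus_int (W t).
Let z t := torus_int (fun x => f t x ^+ 2).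
Let F t := Num.sqrt (z t).
Let U t := c4 * Num.sqrt (y t).

Let y0 t : 0 <= y t. Proof. by apply: torus_int_ge0 => //; exact: sl. Qed.
Let z0 t : 0 <= z t.
Proof. by apply: torus_int_ge0 => [|x]; [apply: contX; exact: sl|exact: sqr_ge0]. Qed.
Let F2 t : F t ^+ 2 = z t. Proof. by rewrite sqr_sqrtr. Qed.
Let U2 t : U t ^+ 2 = c4 ^+ 2 * y t. Proof. by rewrite exprMn sqr_sqrtr. Qed.
Let F0 t : 0 <= F t. Proof. exact: sqrtr_ge0. Qed.
Let U0 t : 0 <= U t. Proof. by rewrite mulr_ge0 ?sqrtr_ge0. Qed.

Let sqr_le_U (h : R -> V -> R) t : jcont h -> (forall x, h t x ^+ 2 <= c4 ^+ 2 * W t x) ->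
  torus_int (fun x => h t x ^+ 2) <= U t ^+ 2.
Proof.
move=> hj H; rewrite U2 /y -torus_intZ; last exact: sl.
by apply: torus_int_le => //; [apply: contX; exact: sl|apply: contZ; exact: sl].
Qed.

(** Being finite sums over [box d n], these quantities can be differentiated term by term in time.
    The quadratic form [Epot] has derivative [2 * dEpot], which explains [lam / 2] in [E] against
    [lam] in [dE]. *)
Let X n t := \sum_i \sum_(k <- box d n) gsym n i k * An (m i t) (f t) k.
Let dX n t := \sum_i \sum_(k <- box d n) gsym n i k * (An (mt i t) (f t) k + An (m i t) (ft t) k).
Let Epot n t := \sum_(k <- box d n) wt n k * om k `^ (- p) * Sy (f t) (f t) k.
Let dEpot n t := \sum_(k <- box d n) wt n k * om k `^ (- p) * Sy (f t) (ft t) k.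
Let E n t := torus_int (en t) - lam / 2 * Epot n t.
Let dE n t := torus_int (ent t) - lam * dEpot n t.

Let is_derive_X n (t : R) : 0 < t -> is_derive t 1 (X n) (dX n t).
Proof.
move=> t0; apply: deri_sum => i _; apply: deri_sum => k _; apply: deriZ.
have dcf := is_derive_ca_jcont k fj ftj dft t0; have dsf := is_derive_sa_jcont k fj ftj dft t0.
have dcm := is_derive_ca_jcont k (@mj i) (@mtj i) (dmt i) t0.
have dsm := is_derive_sa_jcont k (@mj i) (@mtj i) (dmt i) t0.
move: (deriB (deriM dcm dsf) (deriM dsm dcf)) => h; apply: (is_derive_eq h).
by rewrite /An; ring.
Qed.

Let is_derive_E n (t : R) : 0 < t -> is_derive t 1 (E n) (dE n t).
Proof.
move=> t0.
have dpot : is_derive t 1 (Epot n) (2 * dEpot n t).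
  rewrite /dEpot mulr_sumr; apply: deri_sum => k _.
  have dcf := is_derive_ca_jcont k fj ftj dft t0; have dsf := is_derive_sa_jcont k fj ftj dft t0.
  move: (deriZ (wt n k * om k `^ (- p)) (deriD (deriM dcf dcf) (deriM dsf dsf))) => h.
  by apply: (is_derive_eq h); rewrite /Sy; ring.
move: (deriB (is_derive_int_jcont enj entj dent t0) (deriZ (lam / 2) dpot)) => h.
by apply: (is_derive_eq h); rewrite /dE; field.
Qed.

Let continuous_X n : continuous (X n).
Proof.
apply: cont_sum => i _; apply: cont_sum => k _; apply: contZ.
by apply: contB; apply: contM; (exact: continuous_ca_jcont || exact: continuous_sa_jcont).
Qed.

Let continuous_E n : continuous (E n).
Proof.
apply: contB; first exact: continuous_int_jcont.
apply: contZ; apply: cont_sum => k _; apply: contZ.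
by apply: contD; apply: contM; (exact: continuous_ca_jcont || exact: continuous_sa_jcont).
Qed.

Let X_bound n t : `|X n t| <= d%:R * (U t * F t).
Proof.
apply: cross_term_bound => //.
- by split; [exact: sl|exact: fper].
- by move=> i; split; [exact: sl|exact: mper].
- by move=> i; apply: sqr_le_U => // x; exact: mW.
Qed.

Let Epot_bound n t : 0 <= Epot n t <= z t.
Proof.
rewrite -F2; apply: potential_energy_bound => //.
by split; [exact: sl|exact: fper].
Qed.

(** [C5] is the coefficient of U F in the cross-term estimate. Young's inequality trades it for c1 /
    4 F^2 and C5^2 / c1 U^2, and [C7] collects all multiples of |u|^2. [A] controls the size of the
    cross term. Adding up the quotients in [eps] enforces [eps * C7 <= r0 / 2] and
    [eps * A <= c2 / 2] together; nothing here depends on [n]. *)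
Let C5 := d%:R ^+ 2 + d%:R * nu.
Let C7 := (C5 ^+ 2 / c1 + d%:R ^+ 2) * c4 ^+ 2.
Let A := d%:R * (c4 ^+ 2 + 1).
Let eps := (2 * C7 / r0 + 2 * A / c2 + 1)^-1.

Let C70 : 0 <= C7.
Proof. by rewrite mulr_ge0 ?addr_ge0 ?divr_ge0 ?sqr_ge0 ?(ltW c10). Qed.
Let A0 : 0 <= A. Proof. by rewrite mulr_ge0 ?addr_ge0 ?sqr_ge0. Qed.
Let q1 : 0 <= 2 * C7 / r0. Proof. by apply: divr_ge0; [exact: mulr_ge0|exact: ltW]. Qed.
Let q2 : 0 <= 2 * A / c2. Proof. by apply: divr_ge0; [exact: mulr_ge0|exact: ltW]. Qed.
Let den0 : 0 < 2 * C7 / r0 + 2 * A / c2 + 1.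
Proof. by apply: ltr_wpDl => //; exact: addr_ge0. Qed.
Let eps0 : 0 < eps. Proof. by rewrite invr_gt0. Qed.
Let eps_C7 : eps * C7 <= r0 / 2.
Proof.
have : eps * (2 * C7 / r0) <= 1.
  by rewrite /eps mulrC ler_pdivrMr // mul1r -addrA lerDl addr_ge0.
by rewrite mulrA ler_pdivrMr // mul1r mulrA; lra.
Qed.
Let eps_A : eps * A <= c2 / 2.
Proof.
have : eps * (2 * A / c2) <= 1.
  by rewrite /eps mulrC ler_pdivrMr // mul1r (addrC (2 * C7 / r0)) -addrA lerDl addr_ge0.
by rewrite mulrA ler_pdivrMr // mul1r mulrA; lra.
Qed.

Let Lyap n t := E n t - eps * X n t.
Let dLyap n t := dE n t - eps * dX n t.
Let G t := z t + y t.

Let UF_le t : d%:R * (U t * F t) <= A / 2 * G t.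
Proof.
have h : 2 * (U t * F t) <= (c4 ^+ 2 + 1) * G t.
  apply: (@le_trans _ _ (U t ^+ 2 + F t ^+ 2)).
    by rewrite -subr_ge0 (_ : _ - _ = (U t - F t) ^+ 2) ?sqr_ge0 //; ring.
  rewrite U2 F2 /G; have := y0 t; have := z0 t; have := sqr_ge0 c4; nra.
by rewrite /A; have := ler_wpM2l (ler0n R d) h; lra.
Qed.

Let en_int t : c2 * G t <= torus_int (en t) <= c3 * G t.
Proof.
have fc2 : continuous (fun x => f t x ^+ 2) by apply: contX; exact: sl.
have Wc : continuous (W t) by exact: sl.
have enc : continuous (en t) by exact: sl.
rewrite /G /y /z -torus_intD // -!torus_intZ //; try exact: contD.
by apply/andP; split; apply: torus_int_le => //; apply: contZ; exact: contD.
Qed.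

(** Of the coercivity [c2], one quarter is spent on the potential energy, since [lam <= c2 / 2], and
    one quarter on the cross term, by the choice of [eps]. *)
Let Lyap_bounds n t : c2 / 2 * G t <= Lyap n t <= (c3 + c2) * G t.
Proof.
have /andP[e1 e2] := en_int t; have /andP[p1 p2] := Epot_bound n t.
have := le_trans (X_bound n t) (UF_le t); rewrite ler_norml => /andP[x1 x2].
have Gz : z t <= G t by rewrite lerDl.
have G0 : 0 <= G t by rewrite addr_ge0.
have ex1 : eps * X n t <= c2 / 4 * G t.
  apply: le_trans (ler_wpM2l (ltW eps0) x2) _; rewrite mulrA ler_wpM2r //.
  by rewrite mulrA ler_pdivrMr //; apply: le_trans eps_A _; lra.
have ex2 : - (c2 / 4 * G t) <= eps * X n t.
  apply: le_trans (ler_wpM2l (ltW eps0) x1); rewrite mulrN lerN2 mulrA ler_wpM2r //.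
  by rewrite mulrA ler_pdivrMr //; apply: le_trans eps_A _; lra.
have lp1 : 0 <= lam / 2 * Epot n t by rewrite mulr_ge0 // divr_ge0.
have lp2 : lam / 2 * Epot n t <= c2 / 4 * G t.
  have l2 : lam / 2 <= c2 / 4 by move: lam_c2; lra.
  have l0 : 0 <= lam / 2 by rewrite divr_ge0.
  by apply: ler_pM => //; exact: le_trans Gz.
rewrite /Lyap /E mulrDl; apply/andP; split; first by lra.
by have : 0 <= c2 * G t; [rewrite mulr_ge0 // ltW|lra].
Qed.

(** The degree [n] depends on [T] and [eta], the rate does not. Half of the damping pays for the
    |u|^2 terms created by the cross term. *)
Let dLyap_bound (T eta : R) : 0 <= T -> 0 < eta -> exists n, forall t, 0 < t <= T ->
  dLyap n t <= - Num.min (r0 / 2) (eps * c1 / 2) * G t + eta.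
Proof.
move=> T0 eta0.
have [L1 L10 HL1] := jcont_bounded_fin T (fun i => @fdj i).
have [L2 L20 HL2] := jcont_bounded_fin T (fun i => @gj i).
have [L3 L30 HL3] := jcont_bounded T ftj.
have [L4 L40 HL4] := jcont_bounded T Pj.
(* Total prefactor of the two truncation errors: pressure times the gradient of [f], and [ft] times
   the gradient of the potential. The summand 1 keeps it positive. *)
pose Ct := eps * (L4 * L1) + lam * (L3 * L2) + 1.
have Ct0 : 0 < Ct by rewrite ltr_wpDl // addr_ge0 // !mulr_ge0 // ltW.
have [n Hn] := @Qn_approx R d (eta / Ct) (divr_gt0 eta0 Ct0); exists n => t /andP[t0 tT].
have tI : 0 <= t <= T by rewrite tT ltW.
have [phi [phip dphi hca hsa]] := potential t0.
have fp : cper (f t) by split; [exact: sl|exact: fper].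
have mp i : cper (m i t) by split; [exact: sl|exact: mper].
have mdp i j : Zperiodic (md i j t) by exact: Zperiodic_dx (mper i t) (dmx i j t).
have ftp : Zperiodic (ft t).
  by move=> x k; rewrite !mass //; congr (- _); apply: eq_bigr => j _; exact: mdp.
have Hf := Hn (f t) (fun i => fd i t) L1 fp (dfx ^~ t)
  (fun i => HL1 i t tI (Zperiodic_dx (fper t) (dfx i t))) L10.
have Hphi := Hn phi (fun i => g i t) L2 phip dphi (fun i => HL2 i t tI (Zperiodic_dx phip.2 (dphi i))) L20.
have HP := HL4 t tI (Pper t).
have Hft := HL3 t tI ftp.
have hE : dE n t <= - r0 * y t + lam * (L3 * (L2 * (eta / Ct))).
  have := @potential_energy_rate R d n (f t) (ft t) (fun i => m i t) (fun i j => md i j t)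
    (fun i => g i t) phi p mp (fun i j => dmx i j t) (fun i j => @jcont_slice R d _ t (@mdj i j)) phip dphi
    (fun i => @jcont_slice R d _ t (@gj i)) hca hsa (fun x => mass x t0) _ L3 Hphi Hft L30.
  rewrite ler_norml => /andP[_ h].
  have := energy t0; rewrite /dE -/(y t) /dEpot; have := ler_wpM2l lam0 h.
  by rewrite mulrBr; lra.
(* From the pressure term [c1 * z], a quarter goes to the Riesz force by smallness of [lam] and a
   quarter to Young's inequality. *)
have hX : c1 / 2 * z t - C7 * y t - L4 * (L1 * (eta / Ct)) <= dX n t.
  have := @cross_term_dissipation R d d0 n (f t) (ft t) (P t) (fun i => m i t) (fun i => mt i t)
    (fun i j => md i j t) (fun i j => FL i j t) (fun i j => FLd i j t) (fun i => Pd i t)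
    (fun i => fd i t) (fun i => g i t) phi nu lam p B (U t) (F t) fp (dfx ^~ t)
    (fun i => @jcont_slice R d _ t (@fdj i)) mp (fun i j => dmx i j t) (fun i j => @jcont_slice R d _ t (@mdj i j))
    (fun i j => conj (@jcont_slice R d _ t (@FLj i j)) (@FLper i j t)) (fun i j => dFLx i j t) (fun i j => @jcont_slice R d _ t (@FLdj i j))
    (conj (@jcont_slice R d _ t Pj) (@Pper t)) (dPx ^~ t) (fun i => @jcont_slice R d _ t (@Pdj i)) phip dphi (fun i => @jcont_slice R d _ t (@gj i))
    p0 hca hsa (f_mean0 t) (fun x => mass x t0) (fun i x => momentum i x t0) B0 (fB t) lam0 nu0 (U0 t) (F0 t)
    (fun i => sqr_le_U (@mj i) (mW i t)) (fun i j => sqr_le_U (@FLj i j) (FLW i j t)) (esym (F2 t)).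
  apply: le_trans.
  have Pc : continuous (P t) by exact: sl.
  have Qc : continuous (Qn n (f t)) by case: (cper_Mop (box d n) (@wt R d n) (fun=> 0) (f t)).
  have hPf : c1 * z t - L4 * (L1 * (eta / Ct)) <= torus_int (fun x => P t x * Qn n (f t) x).
    have fc2 : continuous (fun x => f t x ^+ 2) by apply: contX; exact: fp.1.
    rewrite -(torus_int_cst d (L4 * _)) /z -torus_intZ // -torus_intB; [|exact: contZ|exact: cont_cst].
    apply: torus_int_le; [by apply: contB; [exact: contZ|exact: cont_cst]|exact: contM|].
    move=> x; have := Pf t x.
    have : `|P t x * (f t x - Qn n (f t) x)| <= L4 * (L1 * (eta / Ct)) by rewrite normrM; exact: ler_pM.
    by rewrite ler_norml mulrBr => /andP[_]; lra.
  have hl : lam * (1 + d%:R * expR 1 * B) * F t ^+ 2 <= c1 / 4 * z t.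
    by rewrite F2; exact: ler_wpM2r.
  have hUF : C5 * (U t * F t) <= c1 / 4 * z t + C5 ^+ 2 / c1 * U t ^+ 2.
    rewrite -F2 -subr_ge0 (_ : _ - _ = c1 / 4 * (F t - 2 * C5 / c1 * U t) ^+ 2).
      by rewrite mulr_ge0 ?sqr_ge0 // divr_ge0 // ltW.
    by field; rewrite gt_eqF.
  have -> : C7 * y t = C5 ^+ 2 / c1 * U t ^+ 2 + d%:R ^+ 2 * U t ^+ 2 by rewrite U2 /C7; ring.
  move: hPf hl hUF; rewrite -/C5.
  move: (torus_int _) (lam * _ * _) (C5 * (U t * F t)) (C5 ^+ 2 / c1 * _) (d%:R ^+ 2 * _) (L4 * _) (z t).
  by move=> a1 a2 a3 a4 a5 a6 a7; lra.
have mG : Num.min (r0 / 2) (eps * c1 / 2) * G t <= r0 / 2 * y t + eps * c1 / 2 * z t.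
  rewrite /G mulrDr addrC; apply: lerD; apply: ler_wpM2r => //; by rewrite ge_min lexx ?orbT.
have hXe := ler_wpM2l (ltW eps0) hX.
have hy : eps * C7 * y t <= r0 / 2 * y t by apply: ler_wpM2r.
have eC : Ct * (eta / Ct) = eta by rewrite mulrC divfK // gt_eqF.
have hC : eps * (L4 * (L1 * (eta / Ct))) + lam * (L3 * (L2 * (eta / Ct))) <= eta.
  rewrite -[leRHS]eC /Ct (_ : _ + _ = (eps * (L4 * L1) + lam * (L3 * L2)) * (eta / Ct)); last by rewrite /Ct; ring.
  by apply: ler_wpM2r; [rewrite divr_ge0 // ltW|rewrite lerDl].
rewrite /dLyap mulNr; move: hXe; rewrite !mulrBr !mulrA; move: hE mG hy hC; rewrite !mulrA; lra.
Qed.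

Lemma lyapunov_decay : exists C mu : R, [/\ 0 <= C, 0 < mu &
  forall t, 0 <= t -> torus_int (fun x => f t x ^+ 2) + torus_int (W t) <= C * expR (- (mu * t))].
Proof.
pose kap := Num.min (r0 / 2) (eps * c1 / 2).
have kap0 : 0 < kap by rewrite lt_min !divr_gt0 ?mulr_gt0.
have c32 : 0 < c3 + c2 by rewrite addr_gt0.
pose mu := kap / (c3 + c2); have mu0 : 0 < mu by rewrite divr_gt0.
have G0 t : 0 <= G t by rewrite addr_ge0.
exists (2 / c2 * ((c3 + c2) * G 0)), mu; split => //.
  by apply: mulr_ge0; [apply: divr_ge0 => //; exact: ltW|apply: mulr_ge0 => //; exact: ltW].
move=> T T0; rewrite -/(z T) -/(y T) -/(G T).
have c2h : 0 < c2 / 2 by rewrite divr_gt0.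
suff : c2 / 2 * G T <= expR (- (mu * T)) * ((c3 + c2) * G 0).
  move=> h; rewrite -(ler_pM2l c2h); apply: le_trans h _.
  by rewrite le_eqVlt; apply/orP; left; apply/eqP; field; rewrite gt_eqF.
(* The time [T] is fixed and the truncation chosen so that Gronwall's remainder is exactly [e].
   Neither side mentions [n], so [e] may tend to 0. *)
apply/ler_addgt0Pr => e e0.
have em0 : 0 < e * mu by rewrite mulr_gt0.
have [n Hn] := dLyap_bound T0 em0.
have /andP[b1 _] := Lyap_bounds n T; have /andP[_ b2] := Lyap_bounds n 0.
apply: le_trans b1 _.
have := @gronwall R (Lyap n) (dLyap n) mu (e * mu) T mu0 (ltW em0) T0.
rewrite mulfK ?gt_eqF // => H; apply: le_trans (H _ _ _) _.
- by apply: contB => //; exact: contZ.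
- by move=> t t0; apply: deriB; [exact: is_derive_E|apply: deriZ; exact: is_derive_X].
- move=> t tI; apply: le_trans (Hn t tI) _; rewrite lerD2r -/kap.
  have /andP[_ b3] := Lyap_bounds n t.
  by rewrite !mulNr lerN2 /mu mulrAC ler_pdivrMr // -mulrA ler_pM2l // mulrC.
by rewrite lerD2r; apply: ler_wpM2l; [exact: expR_ge0|].
Qed.

End lyapunov.

(** * The Euler-Riesz systems *)

Section extension.
Context {R : realType} (d : nat).
Notation V := 'rV[R]_d.

(* Constant extension to negative times: makes a function that is continuous
   on t >= 0 continuous everywhere. *)
Definition ext (f : R -> V -> R) (t : R) (x : V) : R := f (Num.max 0 t) x.

Lemma continuous_max0 : continuous (fun t : R => Num.max 0 t).
Proof.
move=> t; apply: (@continuous_max R R (fun=> 0) id t); first exact: cst_continuous.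
exact: cvg_id.
Qed.

Lemma jcont_ext (f : R -> V -> R) : continuous_t_ge0 f -> jcont (ext f).
Proof.
move=> /subspace_continuousP fc q.
pose c (q : R * V) : R * V := (Num.max 0 q.1, q.2).
have cc : continuous c.
  apply: continuous_pair; last exact: snd_continuous.
  by move=> r; apply: (continuous_comp (@fst_continuous _ _ r)); exact: continuous_max0.
have cA r : 0 <= (c r).1 by rewrite /= le_max lexx.
have H := fc (c q) (cA q) => A hA.
have K : nbhs q (fun r => 0 <= (c r).1 -> A (f (c r).1 (c r).2)) by exact: (cc q _ (H A hA)).
suff : nbhs q (fun r => A (ext f r.1 r.2)) by [].
by apply: filterS K => r hr; exact: (hr (cA r)).
Qed.

Lemma is_derive_ext (f ft : R -> V -> R) (x : V) (t : R) : 0 < t ->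
  (forall (t : R) x, 0 < t -> is_derive t 1 (fun s => f s x) (ft t x)) ->
  is_derive t 1 (ext f ^~ x) (ext ft t x).
Proof.
move=> t0 df; rewrite /ext max_r ?ltW //.
apply: near_eq_is_derive (df t x t0).
near=> s; rewrite max_r //; apply: ltW; near: s; exact: lt_nbhsr.
Unshelve. all: by end_near. Qed.

Lemma continuous_t_ge0_slice (f : R -> V -> R) t : continuous_t_ge0 f -> 0 <= t -> continuous (f t).
Proof.
move=> fc t0; have -> : f t = ext f t by rewrite /ext max_r.
by apply: jcont_slice; exact: jcont_ext.
Qed.

End extension.

Section sign_lemmas.
Context {R : realType}.
Variables (lo hi : R).
Hypotheses (lo0 : lo <= 0) (hi0 : 0 <= hi).

(** By the mean value theorem g x * x = g'(c) x^2. The product form says that [g] has the sign of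
    [x], on both sides of 0 at once. *)
Lemma mul_self_ge0 (g g' : R -> R) : g 0 = 0 ->
  (forall x : R, lo <= x <= hi -> is_derive x 1 g (g' x)) -> (forall x, lo <= x <= hi -> 0 <= g' x) ->
  forall x, lo <= x <= hi -> 0 <= g x * x.
Proof.
move=> g0 dg g'0 x /andP[xl xh].
have I z : Num.min 0 x <= z <= Num.max 0 x -> lo <= z <= hi.
  move=> /andP[a b]; apply/andP; split.
    by apply: le_trans a; rewrite le_min lo0 xl.
  by apply: le_trans b _; rewrite ge_max hi0 xh.
have [|c cI] := @MVT_any R g g' 0 x; first by move=> z /I; exact: dg.
rewrite g0 !subr0 => ->; rewrite -mulrA -expr2 mulr_ge0 ?sqr_ge0 //.
by apply: g'0; exact: I.
Qed.

(** The intermediate point lies on the same side of 0 as [x], so [D'] there and [x] have the same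
    sign. *)
Lemma ge0_of_derive_sign (D D' : R -> R) : D 0 = 0 -> D' 0 = 0 ->
  (forall x : R, lo <= x <= hi -> is_derive x 1 D (D' x)) -> (forall x, lo <= x <= hi -> 0 <= D' x * x) ->
  forall x, lo <= x <= hi -> 0 <= D x.
Proof.
move=> D0 D'0 dD D's x /andP[xl xh].
have I z : Num.min 0 x <= z <= Num.max 0 x -> lo <= z <= hi.
  move=> /andP[a b]; apply/andP; split.
    by apply: le_trans a; rewrite le_min lo0 xl.
  by apply: le_trans b _; rewrite ge_max hi0 xh.
have [|c cI] := @MVT_any R D D' 0 x; first by move=> z /I; exact: dD.
rewrite D0 !subr0 => ->; have := D's c (I c cI).
have [->|c0] := eqVneq c 0; first by move=> _; rewrite D'0 mul0r.
case: (leP 0 x) cI => [x0|/ltW x0] /andP[h1 h2] h.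
  have cp : 0 < c by rewrite lt_def c0.
  by apply: mulr_ge0 => //; rewrite -(pmulr_lge0 _ cp).
have cn : c < 0 by rewrite lt_neqAle c0.
by apply: mulr_le0 => //; rewrite -(nmulr_lge0 _ cn).
Qed.

End sign_lemmas.

(** * Pressure and internal energy of a barotropic law *)

Section constitutive.
Context {R : realType}.
(** [kap] is the logarithmic derivative of the density in h. As dPr / drho = kap^(-2), its inverse
    is the sound speed, which is the coefficient of both coupling terms in the symmetric systems:
    [kap] is 1 for gamma = 1 and N / (h + sigma) for gamma > 1. [lo] and [hi] bound the range of
    h. *)
Variables (kap rho Q Pr : R -> R) (lo hi k0 k1 rl rh : R).
Hypotheses (lo0 : lo <= 0) (hi0 : 0 <= hi) (k00 : 0 < k0) (rl0 : 0 < rl).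
Let J x := lo <= x <= hi.
Hypotheses (drho : forall x : R, J x -> is_derive x 1 rho (kap x * rho x))
  (dQ : forall x : R, J x -> is_derive x 1 Q (kap x)^-1)
  (dPr : forall x : R, J x -> is_derive x 1 Pr (rho x / kap x)).
Hypotheses (kapb : forall x, J x -> k0 <= kap x <= k1) (rhob : forall x, J x -> rl <= rho x <= rh).
Hypotheses (rho0 : rho 0 = 1) (Q0 : Q 0 = 0) (Pr0 : Pr 0 = 0).

Let J0 : J 0. Proof. by rewrite /J lo0 hi0. Qed.
Let k10 : 0 < k1. Proof. have /andP[a b] := kapb J0; exact: lt_le_trans k00 (le_trans a b). Qed.
Let rh0 : 0 < rh. Proof. have /andP[a b] := rhob J0; exact: lt_le_trans rl0 (le_trans a b). Qed.
Let kx0 x : J x -> 0 < kap x. Proof. by move=> /kapb/andP[a b]; exact: lt_le_trans a. Qed.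
Let rx0 x : J x -> 0 < rho x. Proof. by move=> /rhob/andP[a b]; exact: lt_le_trans a. Qed.

Let f x := rho x - 1.
Let Ener x := rho x * Q x - Pr x.

Let df x : J x -> is_derive x 1 f (kap x * rho x).
Proof. by move=> Jx; rewrite -[_ * _]subr0; exact: (deriB (drho Jx) (deri_cst 1 x 1)). Qed.

(** The terms [rho * Q'] and [Pr'] cancel, so [Q] is the derivative of the internal energy with
    respect to the density. *)
Let dEner x : J x -> is_derive x 1 Ener (kap x * rho x * Q x).
Proof.
move=> Jx; move: (deriB (deriM (drho Jx) (dQ Jx)) (dPr Jx)) => h; apply: (is_derive_eq h).
by rewrite addrK.
Qed.

Let kk x : J x -> k0 ^+ 2 * rl <= kap x ^+ 2 * rho x <= k1 ^+ 2 * rh.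
Proof.
move=> Jx; have /andP[a1 a2] := kapb Jx; have /andP[b1 b2] := rhob Jx.
have := ltW k00; have := ltW rl0; have := ltW (kx0 Jx); have := ltW (rx0 Jx) => *.
apply/andP; split; apply: ler_pM; rewrite ?sqr_ge0 //.
  by rewrite ler_sqr ?nnegrE.
by rewrite ler_sqr ?nnegrE // ltW.
Qed.

(** The constant is the lower bound k1^(-2) for dPr / drho: hence [Pr - c * f] is monotone and has
    the same sign as [f], namely that of [x]. *)
Lemma pressure_coercive x : J x -> (k1 ^+ 2)^-1 * f x ^+ 2 <= Pr x * f x.
Proof.
move=> Jx; pose c := (k1 ^+ 2)^-1; have c0 : 0 < c by rewrite invr_gt0 exprn_gt0.
have h1 : 0 <= (Pr x - c * f x) * x.
  apply: (@mul_self_ge0 _ lo hi lo0 hi0 (fun x => Pr x - c * f x) (fun x => rho x / kap x - c * (kap x * rho x))) => //.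
  - by rewrite /f rho0 Pr0 subrr mulr0 subr0.
  - by move=> y Jy; exact: (deriB (dPr Jy) (deriZ c (df Jy))).
  - move=> y Jy; have ky := kx0 Jy; have /andP[a b] := kapb Jy.
    rewrite (_ : _ - _ = rho y / kap y * (1 - c * kap y ^+ 2)); last by field; rewrite gt_eqF.
    rewrite mulr_ge0 ?divr_ge0 ?(ltW ky) ?(ltW (rx0 Jy)) // subr_ge0 /c mulrC ler_pdivrMr ?exprn_gt0 // mul1r.
    have k1p := ltW k10; have kyp := ltW ky.
    by rewrite ler_sqr ?nnegrE.
have h2 : 0 <= f x * x.
  apply: (@mul_self_ge0 _ lo hi lo0 hi0 f (fun x => kap x * rho x)) => //; first by rewrite /f rho0 subrr.
  by move=> y Jy; rewrite mulr_ge0 // ltW ?kx0 ?rx0.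
have [->|x0] := eqVneq x 0; first by rewrite /f rho0 subrr expr0n !mulr0.
have x2 : 0 < x ^+ 2 by rewrite exprn_even_gt0 //= x0.
have : 0 <= (Pr x - c * f x) * f x.
  rewrite -(pmulr_lge0 _ x2) (_ : (Pr x - c * f x) * f x * x ^+ 2 = ((Pr x - c * f x) * x) * (f x * x)); last by ring.
  exact: mulr_ge0.
by rewrite mulrBl subr_ge0 -/c expr2 mulrA.
Qed.

(** The constant is the lower bound for the derivative of [Q] with respect to the density, 1 /
    (kap^2 rho). It makes [Q - c * f] follow the sign of [x], and a second integration in the
    density gives the half square. *)
Lemma energy_lower x : J x -> (k1 ^+ 2 * rh)^-1 / 2 * f x ^+ 2 <= Ener x.
Proof.
move=> Jx; pose c := (k1 ^+ 2 * rh)^-1.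
have cp : 0 < k1 ^+ 2 * rh by rewrite mulr_gt0 ?exprn_gt0.
have h y : J y -> 0 <= (Q y - c * f y) * y.
  apply: (@mul_self_ge0 _ lo hi lo0 hi0 (fun x => Q x - c * f x) (fun x => (kap x)^-1 - c * (kap x * rho x))) => //.
  - by rewrite /f rho0 Q0 subrr mulr0 subr0.
  - by move=> z Jz; exact: (deriB (dQ Jz) (deriZ c (df Jz))).
  - move=> z Jz; have kz := kx0 Jz; have /andP[_ b] := kk Jz.
    rewrite (_ : _ - _ = (kap z)^-1 * (1 - c * (kap z ^+ 2 * rho z))); last by field; rewrite gt_eqF.
    by rewrite mulr_ge0 ?invr_ge0 ?(ltW kz) // subr_ge0 /c mulrC ler_pdivrMr // mul1r.
rewrite -subr_ge0.
apply: (@ge0_of_derive_sign _ lo hi lo0 hi0 (fun x => Ener x - c / 2 * f x ^+ 2)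
   (fun x => kap x * rho x * (Q x - c * f x))) => //.
- by rewrite /Ener /f rho0 Q0 Pr0 subrr expr0n /=; ring.
- by rewrite /f Q0 rho0 subrr mulr0 subrr mulr0.
- move=> y Jy.
  move: (deriB (dEner Jy) (deriZ (c / 2) (deriM (df Jy) (df Jy)))) => h'.
  rewrite (_ : (fun x => _) = fun x => Ener x - c / 2 * (f x * f x)); last by apply/funext => z; rewrite expr2.
  by apply: (is_derive_eq h'); field.
- move=> y Jy; rewrite -mulrA mulr_ge0 ?h // mulr_ge0 // ltW ?kx0 ?rx0 //.
Qed.

Lemma energy_upper x : J x -> Ener x <= (k0 ^+ 2 * rl)^-1 / 2 * f x ^+ 2.
Proof.
move=> Jx; pose c := (k0 ^+ 2 * rl)^-1.
have cp : 0 < k0 ^+ 2 * rl by rewrite mulr_gt0 ?exprn_gt0.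
have h y : J y -> 0 <= (c * f y - Q y) * y.
  apply: (@mul_self_ge0 _ lo hi lo0 hi0 (fun x => c * f x - Q x) (fun x => c * (kap x * rho x) - (kap x)^-1)) => //.
  - by rewrite /f rho0 Q0 subrr mulr0 subr0.
  - by move=> z Jz; exact: (deriB (deriZ c (df Jz)) (dQ Jz)).
  - move=> z Jz; have kz := kx0 Jz; have /andP[a _] := kk Jz.
    rewrite (_ : _ - _ = (kap z)^-1 * (c * (kap z ^+ 2 * rho z) - 1)); last by field; rewrite gt_eqF.
    by rewrite mulr_ge0 ?invr_ge0 ?(ltW kz) // subr_ge0 /c mulrC ler_pdivlMr // mul1r.
rewrite -subr_ge0.
apply: (@ge0_of_derive_sign _ lo hi lo0 hi0 (fun x => c / 2 * f x ^+ 2 - Ener x)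
   (fun x => kap x * rho x * (c * f x - Q x))) => //.
- by rewrite /Ener /f rho0 Q0 Pr0 subrr expr0n /=; ring.
- by rewrite /f Q0 rho0 subrr mulr0 subrr mulr0.
- move=> y Jy.
  move: (deriB (deriZ (c / 2) (deriM (df Jy) (df Jy))) (dEner Jy)) => h'.
  rewrite (_ : (fun x => _) = fun x => c / 2 * (f x * f x) - Ener x); last by apply/funext => z; rewrite expr2.
  by apply: (is_derive_eq h'); field.
- move=> y Jy; rewrite -mulrA mulr_ge0 ?h // mulr_ge0 // ltW ?kx0 ?rx0 //.
Qed.

Lemma sqr_le_density x : J x -> x ^+ 2 <= (k0 * rl) ^- 2 * f x ^+ 2.
Proof.
move=> Jx; pose c := k0 * rl; have c0 : 0 < c by rewrite mulr_gt0.
have h : 0 <= (f x - c * x) * x.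
  apply: (@mul_self_ge0 _ lo hi lo0 hi0 (fun x => f x - c * x) (fun x => kap x * rho x - c * 1)) => //.
  - by rewrite /f rho0 subrr mulr0 subr0.
  - by move=> z Jz; exact: (deriB (df Jz) (deriZ c (is_derive_id z 1))).
  - move=> z Jz; have /andP[a1 _] := kapb Jz; have /andP[b1 _] := rhob Jz.
    by rewrite mulr1 subr_ge0; apply: ler_pM => //; exact: ltW.
rewrite -/c mulrC -exprVn -exprMn.
have h' : x ^+ 2 <= (f x / c) * x.
  by rewrite -(ler_pM2l c0) (_ : c * (f x / c * x) = f x * x); [nra|field; rewrite gt_eqF].
have : 0 <= (f x / c - x) ^+ 2 by exact: sqr_ge0.
by nra.
Qed.

End constitutive.

(** The local energy balance. The last sum is the divergence, written out by the product rule, of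
    the energy flux u_j rho (|u|^2 / 2 + q); it disappears after integration. *)
Lemma energy_identity (R : realFieldType) (n : nat) (u ut g hx : 'I_n -> R) (ux : 'I_n -> 'I_n -> R)
    (k r q nu lam ht : R) : k != 0 ->
  ht = - (\sum_i u i * hx i) - k^-1 * \sum_i ux i i ->
  (forall i, ut i = - (\sum_j u j * ux i j) - k^-1 * hx i - nu * u i + lam * g i) ->
  2^-1 * (k * r * ht * \sum_i u i * u i + r * \sum_i (ut i * u i + u i * ut i)) + k * r * q * ht =
  - nu * (r * \sum_i u i * u i) + lam * \sum_i (r * u i) * g i
  - \sum_j (ux j j * (r * (2^-1 * (\sum_i u i * u i) + q))
     + u j * ((k * r * hx j) * (2^-1 * (\sum_i u i * u i) + q)
              + r * (2^-1 * (\sum_i (ux i j * u i + u i * ux i j)) + k^-1 * hx j))).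
Proof.
move=> k0 -> hut.
set S := \sum_i u i * u i; set a := \sum_i u i * hx i; set b := \sum_i ux i i.
pose c := \sum_i \sum_j u i * u j * ux i j; pose q' := \sum_i u i * g i.
have e1 : \sum_i (ut i * u i + u i * ut i) = 2 * (- c - k^-1 * a - nu * S + lam * q').
  rewrite /c /a /S /q' mulrDr mulrBr mulrBr mulrN !mulr_sumr -sumrN -!sumrB -big_split /=.
  apply: eq_bigr => i _; rewrite hut.
  rewrite (_ : \sum_j u i * u j * ux i j = u i * \sum_j u j * ux i j); first by ring.
  by rewrite mulr_sumr; apply: eq_bigr => j _; ring.
have e2 : \sum_i (r * u i) * g i = r * q' by rewrite mulr_sumr; apply: eq_bigr => i _; rewrite mulrA.
have e3 : \sum_j (ux j j * (r * (2^-1 * S + q))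
     + u j * ((k * r * hx j) * (2^-1 * S + q)
              + r * (2^-1 * (\sum_i (ux i j * u i + u i * ux i j)) + k^-1 * hx j)))
  = r * (2^-1 * S + q) * b + k * r * (2^-1 * S + q) * a + r * c + r * k^-1 * a.
  have -> : c = \sum_j u j * (2^-1 * \sum_i (ux i j * u i + u i * ux i j)).
    rewrite /c exchange_big /=; apply: eq_bigr => j _; rewrite !mulr_sumr; apply: eq_bigr => i _.
    by field.
  rewrite /a /b !mulr_sumr -!big_split /=; apply: eq_bigr => j _; ring.
by rewrite e1 e2 e3; field.
Qed.

(** * Solutions of a barotropic system as data for the Lyapunov argument *)

Section barotropic.
Context {R : realType} (d : nat) (d0 : (0 < d)%N).
Notation V := 'rV[R]_d.
Notation K := 'rV[int]_d.
Variables (kap rho Q Pr : R -> R) (lo hi k0 k1 rl rh : R).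
(* [rho] is the density as a function of h and [Q] its enthalpy, both normalised at
   h = 0; [Pr] is the pressure minus its value at h = 0, and the potential energy
   density is [rho * Q - Pr]. *)
Hypotheses (lo0 : lo <= 0) (hi0 : 0 <= hi) (k00 : 0 < k0) (rl0 : 0 < rl).
Hypotheses (ckap : forall x : R, lo <= x <= hi -> {for x, continuous kap})
  (drho : forall x : R, lo <= x <= hi -> is_derive x 1 rho (kap x * rho x))
  (dQ : forall x : R, lo <= x <= hi -> is_derive x 1 Q (kap x)^-1)
  (dPr : forall x : R, lo <= x <= hi -> is_derive x 1 Pr (rho x / kap x)).
Hypotheses (kapb : forall x, lo <= x <= hi -> k0 <= kap x <= k1)
  (rhob : forall x, lo <= x <= hi -> rl <= rho x <= rh).
Hypotheses (rho0 : rho 0 = 1) (Q0 : Q 0 = 0) (Pr0 : Pr 0 = 0).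
Variables (nu p M : R).
Hypotheses (nu0 : 0 < nu) (p0 : 0 < p) (M0 : 0 <= M).

Let J0 : lo <= 0 <= hi. Proof. by rewrite lo0 hi0. Qed.
Let k10 : 0 < k1. Proof. have /andP[a b] := kapb J0; exact: lt_le_trans k00 (le_trans a b). Qed.
Let rh0 : 0 < rh. Proof. have /andP[a b] := rhob J0; exact: lt_le_trans rl0 (le_trans a b). Qed.

(** [c1] is the coercivity of the pressure, [B] bounds |rho - 1|, and [c2], [c3] compare the energy
    density with f^2 + |u|^2. The factor [1 + M] in [c4] lets one constant serve both the momentum,
    bounded by rh |u|, and the flux, bounded by rh M |u|. *)
Let c1 := (k1 ^+ 2)^-1.
Let B := rh + 1.
Let c2 := Num.min ((k1 ^+ 2 * rh)^-1 / 2) (rl / 2).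
Let c3 := (k0 ^+ 2 * rl)^-1 / 2 + rh / 2.
Let c4 := rh * (1 + M).

Let c10 : 0 < c1. Proof. by rewrite invr_gt0 exprn_gt0. Qed.
Let B0 : 0 <= B. Proof. by rewrite addr_ge0 // ltW. Qed.
Let c20 : 0 < c2.
Proof. by rewrite lt_min !divr_gt0 ?invr_gt0 ?mulr_gt0 ?exprn_gt0. Qed.
Let c3a : 0 < (k0 ^+ 2 * rl)^-1 / 2.
Proof. by rewrite divr_gt0 ?invr_gt0 ?mulr_gt0 ?exprn_gt0. Qed.
Let c30 : 0 < c3. Proof. by rewrite addr_gt0 // divr_gt0. Qed.
Let c40 : 0 <= c4. Proof. by rewrite mulr_ge0 ?addr_ge0 // ltW. Qed.

Section solution.
Variables (lam : R) (h ht : R -> V -> R) (u : R -> V -> V) (hx : 'I_d -> R -> V -> R)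
  (ut : 'I_d -> R -> V -> R) (ux : 'I_d -> 'I_d -> R -> V -> R).
Hypotheses (lam0 : 0 < lam) (lam_small : lam * (1 + d%:R * expR 1 * B) <= c1 / 4) (lam_c2 : lam <= c2 / 2).
Hypotheses (per : forall t : R, 0 <= t -> Zperiodic (h t) /\ Zperiodic (u t)).
Hypotheses (hc : continuous_t_ge0 h) (htc : continuous_t_ge0 ht) (hxc : forall i, continuous_t_ge0 (hx i))
  (dht : forall (t : R) x, 0 < t -> is_derive t 1 (fun s => h s x) (ht t x))
  (dhx : forall (i : 'I_d) (t : R) (x : V), 0 <= t -> is_derive x (delta_mx 0 i) (h t) (hx i t x)).
Hypotheses (uc : forall i, continuous_t_ge0 (fun t x => u t x 0 i)) (utc : forall i, continuous_t_ge0 (ut i))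
  (uxc : forall i j, continuous_t_ge0 (ux i j))
  (dut : forall i (t : R) x, 0 < t -> is_derive t 1 (fun s => u s x 0 i) (ut i t x))
  (dux : forall (i j : 'I_d) (t : R) (x : V), 0 <= t ->
     is_derive x (delta_mx 0 j) (fun x => u t x 0 i) (ux i j t x)).
Hypotheses (hJ : forall t x, 0 <= t -> lo <= h t x <= hi)
  (uM : forall t x, 0 <= t -> dotp (u t x) (u t x) <= M ^+ 2)
  (mean1 : forall t, 0 <= t -> torus_int (fun x => rho (h t x)) = 1).
Hypothesis (eqs : forall t : R, 0 < t -> exists phi : V -> R,
  [/\ cper phi, forall (x : V) (i : 'I_d), derivable phi x (delta_mx 0 i),
      forall k, ca phi k = om k `^ (- p) * ca (fun x => rho (h t x) - 1) k
             /\ sa phi k = om k `^ (- p) * sa (fun x => rho (h t x) - 1) k,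
      forall x, ht t x + \sum_i u t x 0 i * hx i t x + (kap (h t x))^-1 * \sum_i ux i i t x = 0
    & forall x i, ut i t x + \sum_j u t x 0 j * ux i j t x + (kap (h t x))^-1 * hx i t x
        = - nu * u t x 0 i + lam * dx i phi x]).

Let H := ext h.
Let Ht := ext ht.
Let Hx i := ext (hx i).
Let Um i := ext (fun t x => u t x 0 i).
Let Ut i := ext (ut i).
Let Ux i j := ext (ux i j).

Let max0 (t : R) : 0 <= Num.max 0 t. Proof. by rewrite le_max lexx. Qed.
Let HJ t x : lo <= H t x <= hi. Proof. exact: hJ. Qed.
Let jH : jcont H. Proof. exact: jcont_ext. Qed.
Let jHt : jcont Ht. Proof. exact: jcont_ext. Qed.
Let jHx i : jcont (Hx i). Proof. by apply: jcont_ext; exact: hxc. Qed.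
Let jU i : jcont (Um i). Proof. by apply: jcont_ext; exact: uc. Qed.
Let jUt i : jcont (Ut i). Proof. by apply: jcont_ext; exact: utc. Qed.
Let jUx i j : jcont (Ux i j). Proof. by apply: jcont_ext; exact: uxc. Qed.
Let perH t : Zperiodic (H t). Proof. by have [] := per (max0 t). Qed.
Let perU i t : Zperiodic (Um i t).
Proof. by have [_ up] := per (max0 t); move=> x k; rewrite /Um /ext up. Qed.
Let dHt (t : R) x : 0 < t -> is_derive t 1 (H ^~ x) (Ht t x).
Proof. by move=> t0; exact: is_derive_ext. Qed.
Let dUt i (t : R) x : 0 < t -> is_derive t 1 (Um i ^~ x) (Ut i t x).
Proof.
by move=> t0; apply: (@is_derive_ext R d (fun t x => u t x 0 i) (ut i)) => // s z s0; exact: dut.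
Qed.
Let dHx i t : has_dx i (H t) (Hx i t). Proof. by move=> x; exact: dhx. Qed.
Let dUx i j t : has_dx j (Um i t) (Ux i j t). Proof. by move=> x; exact: dux. Qed.

Let kx0 t x : 0 < kap (H t x).
Proof. by have /andP[a _] := kapb (HJ t x); exact: lt_le_trans a. Qed.
Let rx0 t x : 0 < rho (H t x).
Proof. by have /andP[a _] := rhob (HJ t x); exact: lt_le_trans a. Qed.

Let jcomp (g : R -> R) : (forall x, lo <= x <= hi -> {for x, continuous g}) ->
  jcont (fun t x => g (H t x)).
Proof.
move=> gc q; apply: (@continuous_comp _ R R (fun q : R * V => H q.1 q.2) g q); first exact: jH.
by apply: gc; exact: HJ.
Qed.

Let deri_cont (g g' : R -> R) : (forall x : R, lo <= x <= hi -> is_derive x 1 g (g' x)) ->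
  forall x, lo <= x <= hi -> {for x, continuous g}.
Proof.
move=> dg x /dg [D _]; apply: differentiable_continuous; exact/derivable1_diffP.
Qed.

Let jrho : jcont (fun t x => rho (H t x)). Proof. by apply: jcomp; exact: deri_cont drho. Qed.
Let jQ : jcont (fun t x => Q (H t x)). Proof. by apply: jcomp; exact: deri_cont dQ. Qed.
Let jPr : jcont (fun t x => Pr (H t x)). Proof. by apply: jcomp; exact: deri_cont dPr. Qed.
Let jkap : jcont (fun t x => kap (H t x)). Proof. exact: jcomp. Qed.
Let jkapV : jcont (fun t x => (kap (H t x))^-1).
Proof.
apply: (jcomp (g := fun x => (kap x)^-1)) => x xJ; apply: cvgV; last exact: ckap.
by rewrite gt_eqF //; have /andP[a _] := kapb xJ; exact: lt_le_trans a.
Qed.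

Let W t x := \sum_i Um i t x * Um i t x.
Let Wt t x := \sum_i (Ut i t x * Um i t x + Um i t x * Ut i t x).
Let Wx j t x := \sum_i (Ux i j t x * Um i t x + Um i t x * Ux i j t x).
Let jW : jcont W. Proof. by apply: cont_sum => i _; apply: contM; exact: jU. Qed.

Let f t x := rho (H t x) - 1.
Let ft t x := kap (H t x) * rho (H t x) * Ht t x.
Let fd i t x := kap (H t x) * rho (H t x) * Hx i t x.
Let P t x := Pr (H t x).
Let Pd i t x := rho (H t x) / kap (H t x) * Hx i t x.
Let m i t x := rho (H t x) * Um i t x.
Let mt i t x := ft t x * Um i t x + rho (H t x) * Ut i t x.
Let md i j t x := fd j t x * Um i t x + rho (H t x) * Ux i j t x.
Let FL i j t x := m i t x * Um j t x.
Let FLd i j t x := md i j t x * Um j t x + m i t x * Ux j j t x.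
Let en t x := 2^-1 * (rho (H t x) * W t x) + (rho (H t x) * Q (H t x) - P t x).
Let ent t x := 2^-1 * (ft t x * W t x + rho (H t x) * Wt t x) + kap (H t x) * rho (H t x) * Q (H t x) * Ht t x.
(** The gradient of the potential, solved for in the momentum equation. In this form it is
    continuous in (t, x) jointly and up to t = 0, which cannot be read off a potential given
    separately at each positive time. The momentum equation becomes a tautology, and the equation of
    the system is used to identify [g] with the gradient. *)
Let g i t x := lam^-1 * (Ut i t x + \sum_j Um j t x * Ux i j t x + (kap (H t x))^-1 * Hx i t x + nu * Um i t x).
Let Gf j t x := Um j t x * (rho (H t x) * (2^-1 * W t x + Q (H t x))).
Let Gfd j t x := Ux j j t x * (rho (H t x) * (2^-1 * W t x + Q (H t x)))
  + Um j t x * (fd j t x * (2^-1 * W t x + Q (H t x)) + rho (H t x) * (2^-1 * Wx j t x + (kap (H t x))^-1 * Hx j t x)).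

Let jf : jcont f. Proof. by apply: contB => //; exact: cont_cst. Qed.
Let jft : jcont ft. Proof. by apply: contM => //; exact: contM. Qed.
Let jfd i : jcont (fd i). Proof. by apply: contM; [exact: contM|exact: jHx]. Qed.
Let jPd i : jcont (Pd i). Proof. by apply: contM; [exact: contM|exact: jHx]. Qed.
Let jm i : jcont (m i). Proof. by apply: contM => //; exact: jU. Qed.
Let jmt i : jcont (mt i). Proof. by apply: contD; apply: contM => //; (exact: jU || exact: jUt). Qed.
Let jmd i j : jcont (md i j).
Proof. by apply: contD; apply: contM => //; (exact: jU || exact: jUx || exact: jfd). Qed.
Let jFL i j : jcont (FL i j). Proof. by apply: contM; (exact: jm || exact: jU). Qed.
Let jFLd i j : jcont (FLd i j).
Proof. by apply: contD; apply: contM; (exact: jm || exact: jU || exact: jUx || exact: jmd). Qed.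
Let jWt : jcont Wt.
Proof. by apply: cont_sum => i _; apply: contD; apply: contM; (exact: jU || exact: jUt). Qed.
Let jWx j : jcont (Wx j).
Proof. by apply: cont_sum => i _; apply: contD; apply: contM; (exact: jU || exact: jUx). Qed.
Let jen : jcont en.
Proof. by apply: contD; [apply: contZ; exact: contM|apply: contB => //; exact: contM]. Qed.
Let jent : jcont ent.
Proof.
apply: contD; first by apply: contZ; apply: contD; exact: contM.
by apply: contM => //; apply: contM => //; exact: contM.
Qed.
Let jg i : jcont (g i).
Proof.
apply: contZ; apply: contD; last by apply: contZ; exact: jU.
apply: contD; last by apply: contM => //; exact: jHx.
apply: contD; first exact: jUt.
by apply: cont_sum => j _; apply: contM; (exact: jU || exact: jUx).
Qed.
Let jGfd j : jcont (Gfd j).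
Proof.
have jE : jcont (fun t x => 2^-1 * W t x + Q (H t x)) by apply: contD => //; exact: contZ.
apply: contD; first by apply: contM; [exact: jUx|exact: contM].
apply: contM; first exact: jU.
apply: contD; apply: contM => //; first exact: jfd.
by apply: contD; [apply: contZ; exact: jWx|apply: contM => //; exact: jHx].
Qed.
Let jGf j : jcont (Gf j).
Proof.
by apply: contM; [exact: jU|apply: contM => //; apply: contD => //; exact: contZ].
Qed.

Let chain_t (F F' : R -> R) (t : R) x : 0 < t ->
  (forall x : R, lo <= x <= hi -> is_derive x 1 F (F' x)) ->
  is_derive t 1 (fun s => F (H s x)) (F' (H t x) * Ht t x).
Proof. by move=> t0 dF; apply: (@is_derive_chain R R F (fun s => H s x)); [exact: (dF _ (HJ t x))|exact: dHt]. Qed.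

Let chain_x (F F' : R -> R) t x i :
  (forall x : R, lo <= x <= hi -> is_derive x 1 F (F' x)) ->
  is_derive x (delta_mx 0 i) (fun y => F (H t y)) (F' (H t x) * Hx i t x).
Proof. by move=> dF; apply: (@is_derive_chain R V F (H t)); [exact: (dF _ (HJ t x))|exact: dHx]. Qed.

Let dft (t : R) x : 0 < t -> is_derive t 1 (f ^~ x) (ft t x).
Proof. by move=> t0; have := deriB (chain_t x t0 drho) (deri_cst 1 t 1); rewrite subr0. Qed.
Let dfx i t : has_dx i (f t) (fd i t).
Proof. by move=> x; have := deriB (chain_x t x i drho) (deri_cst 1 x _); rewrite subr0. Qed.
Let dPx i t : has_dx i (P t) (Pd i t).
Proof. by move=> x; exact: chain_x t x i dPr. Qed.
Let dmt i (t : R) x : 0 < t -> is_derive t 1 (m i ^~ x) (mt i t x).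
Proof. by move=> t0; exact: (deriM (chain_t x t0 drho) (dUt i x t0)). Qed.
Let dmx i j t : has_dx j (m i t) (md i j t).
Proof. by move=> x; exact: (deriM (chain_x t x j drho) (@dUx i j t x)). Qed.
Let dFLx i j t : has_dx j (FL i j t) (FLd i j t).
Proof. by move=> x; exact: (deriM (@dmx i j t x) (@dUx j j t x)). Qed.
Let dWt (t : R) x : 0 < t -> is_derive t 1 (W ^~ x) (Wt t x).
Proof. by move=> t0; apply: deri_sum => i _; exact: (deriM (dUt i x t0) (dUt i x t0)). Qed.
Let dWx j t : has_dx j (W t) (Wx j t).
Proof. by move=> x; apply: deri_sum => i _; exact: (deriM (@dUx i j t x) (@dUx i j t x)). Qed.
Let dent (t : R) x : 0 < t -> is_derive t 1 (en ^~ x) (ent t x).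
Proof.
move=> t0; move: (deriD (deriZ 2^-1 (deriM (chain_t x t0 drho) (dWt x t0)))
  (deriB (deriM (chain_t x t0 drho) (chain_t x t0 dQ)) (chain_t x t0 dPr))) => hd.
by apply: (is_derive_eq hd); rewrite /ent /ft; ring.
Qed.
Let dGf j t : has_dx j (Gf j t) (Gfd j t).
Proof.
move=> x; exact: (deriM (@dUx j j t x) (deriM (chain_x t x j drho)
  (deriD (deriZ 2^-1 (@dWx j t x)) (chain_x t x j dQ)))).
Qed.

Let H_pos t : 0 < t -> H t = h t.
Proof. by move=> t0; rewrite /H /ext max_r // ltW. Qed.

Let eq_mass t x : 0 < t -> Ht t x = - (\sum_i Um i t x * Hx i t x) - (kap (H t x))^-1 * \sum_i Ux i i t x.
Proof.
move=> t0; have [phi [_ _ _ em _]] := eqs t0; have := em x.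
rewrite H_pos // /Ht /Hx /Um /Ux /ext max_r ?ltW // => e.
by apply/eqP; rewrite -subr_eq0 !opprD !opprK addrA e.
Qed.

Let eq_momentum i t x : Ut i t x = - (\sum_j Um j t x * Ux i j t x) - (kap (H t x))^-1 * Hx i t x
  - nu * Um i t x + lam * g i t x.
Proof. by rewrite /g mulVKf ?gt_eqF //; ring. Qed.

Let g_phi : forall t, 0 < t -> exists phi : V -> R,
  [/\ cper phi, forall i, has_dx i phi (g i t),
      forall k, ca phi k = om k `^ (- p) * ca (f t) k
    & forall k, sa phi k = om k `^ (- p) * sa (f t) k].
Proof.
move=> t t0; have [phi [phip dphi hk _ eu]] := eqs t0; exists phi; split => //.
- move=> i x; have -> : g i t x = dx i phi x.
    apply: (@mulfI _ lam); first by rewrite gt_eqF.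
    rewrite /g mulVKf ?gt_eqF // H_pos // /Hx /Um /Ux /Ut /ext max_r ?ltW //.
    by rewrite eu; ring.
  by split; [exact: dphi|].
- by move=> k; have [-> _] := hk k; rewrite /f H_pos.
- by move=> k; have [_ ->] := hk k; rewrite /f H_pos.
Qed.

Let perF (F : R -> R) t : Zperiodic (fun x => F (H t x)).
Proof. by move=> x k; rewrite perH. Qed.

(** The energy fluxes [Gf] are periodic, so their derivatives integrate to zero; the lower bound
    [rl] of the density converts the damping into a multiple of |u|^2. *)
Let energy_rate t : 0 < t -> torus_int (ent t)
  <= - (nu * rl) * torus_int (W t) + lam * \sum_i torus_int (fun x => m i t x * g i t x).
Proof.
move=> t0.
have sl := @jcont_slice R d.
have mgc i : continuous (fun x => m i t x * g i t x).
  by apply: contM; [exact: (sl _ t (@jm i))|exact: (sl _ t (@jg i))].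
have rWc : continuous (fun x => rho (H t x) * W t x) by apply: contM; [exact: (sl _ t jrho)|exact: (sl _ t jW)].
have Gc j : continuous (Gfd j t) by exact: (sl _ t (@jGfd j)).
have G0 j : torus_int (Gfd j t) = 0.
  apply: (@torus_int_dx0 _ _ j (Gf j t)) => //.
  split; first by exact: (sl _ t (@jGf j)).
  move=> x k; rewrite /Gf /W perH perU; congr (_ * (_ * (_ * _ + _))).
  by apply: eq_bigr => i _; rewrite perU.
have -> : torus_int (ent t) = - nu * torus_int (fun x => rho (H t x) * W t x)
    + lam * \sum_i torus_int (fun x => m i t x * g i t x).
  have mgs : continuous (fun x => \sum_i m i t x * g i t x) by apply: cont_sum => i _; exact: mgc.
  have Gs : continuous (fun x => \sum_j Gfd j t x) by apply: cont_sum => j _; exact: Gc.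
  have s0 : torus_int (fun x => \sum_j Gfd j t x) = 0.
    by rewrite torus_int_sum ?big1 // => j _; exact: Gc.
  rewrite -torus_int_sum; last by move=> i _; exact: mgc.
  have ac : continuous (fun x => - nu * (rho (H t x) * W t x)) by exact: contZ.
  have bc : continuous (fun x => lam * \sum_i m i t x * g i t x) by exact: contZ.
  have abc : continuous (fun x => - nu * (rho (H t x) * W t x) + lam * \sum_i m i t x * g i t x) by exact: contD.
  transitivity (torus_int (fun x => - nu * (rho (H t x) * W t x) + lam * \sum_i m i t x * g i t x)
      - torus_int (fun x => \sum_j Gfd j t x)).
    rewrite -torus_intB //; congr torus_int; apply/funext => x; rewrite /ent /ft /Gfd /fd /m.
    by apply: energy_identity; [rewrite gt_eqF|exact: eq_mass|move=> i; exact: eq_momentum].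
  by rewrite s0 subr0 torus_intD // !torus_intZ.
rewrite lerD2r -mulNr -mulrA mulNr mulNr lerN2 ler_wpM2l ?(ltW nu0) //.
rewrite -torus_intZ; last exact: sl.
apply: torus_int_le => //; first by apply: contZ; exact: sl.
move=> x; apply: ler_wpM2r; last by have /andP[] := rhob (HJ t x).
by apply: sumr_ge0 => i _; rewrite -expr2 sqr_ge0.
Qed.

Let W_ge0 t x : 0 <= W t x.
Proof. by apply: sumr_ge0 => i _; rewrite -expr2 sqr_ge0. Qed.

Let U2_le i t x : Um i t x ^+ 2 <= W t x.
Proof.
by rewrite /W (bigD1 i) //= -expr2 lerDl; apply: sumr_ge0 => j _; rewrite -expr2 sqr_ge0.
Qed.

Let W_le t x : W t x <= M ^+ 2.
Proof. exact: uM. Qed.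

Let rho2_le t x : rho (H t x) ^+ 2 <= rh ^+ 2.
Proof.
have /andP[_ b] := rhob (HJ t x).
by rewrite ler_sqr ?nnegrE // ltW.
Qed.

Lemma barotropic_lyapunov : exists C mu : R, [/\ 0 <= C, 0 < mu &
  forall t, 0 <= t -> torus_int (fun x => h t x ^+ 2) + torus_int (fun x => enorm (u t x) ^+ 2)
    <= C * expR (- (mu * t))].
Proof.
have [|||||||||||C [mu [C0 mu0 H1]]] := @lyapunov_decay R d d0 f ft en ent P W m mt fd Pd g md FL FLd nu lam p B c1 c2 c3 c4 (nu * rl)
  jf jft jen jent jPr jW jm jmt jfd jPd jg jmd jFL jFLd
  (@perF (fun y => rho y - 1)) (@perF Pr) _ _ dft dmt dent dfx dPx dmx dFLx
  _ _ energy_rate g_phi _ p0 (ltW nu0) (ltW lam0) B0 c10 c20 c30 c40 (mulr_gt0 nu0 rl0)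
  lam_small lam_c2 _ W_ge0 _ _ _ _ _.
- by move=> i t x k; rewrite /m perH perU.
- by move=> i j t x k; rewrite /FL /m perH !perU.
- move=> t x t0; have -> : \sum_j md j j t x =
      kap (H t x) * rho (H t x) * (\sum_j Um j t x * Hx j t x) + rho (H t x) * \sum_j Ux j j t x.
    by rewrite !mulr_sumr -big_split; apply: eq_bigr => j _; rewrite /= /md /fd; ring.
  by rewrite /ft eq_mass //; field; rewrite gt_eqF.
- move=> i t x t0; have -> : \sum_j FLd i j t x =
      Um i t x * (kap (H t x) * rho (H t x) * (\sum_j Um j t x * Hx j t x) + rho (H t x) * \sum_j Ux j j t x)
      + rho (H t x) * \sum_j Um j t x * Ux i j t x.
    rewrite !mulr_sumr -big_split mulr_sumr -big_split; apply: eq_bigr => j _.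
    by rewrite /= /FLd /md /fd /m; ring.
  by rewrite /mt eq_momentum /ft eq_mass // /Pd /m /f; field; rewrite gt_eqF.
- move=> t; rewrite torus_intB; [|exact: (@jcont_slice R d _ t jrho)|exact: cont_cst].
  by rewrite torus_int_cst (mean1 (max0 t)) subrr.
- move=> t x; have /andP[a b] := rhob (HJ t x); rewrite /f /B ler_norml; have := ltW (rx0 t x); lra.
- by move=> t x; exact: (pressure_coercive lo0 hi0 k00 rl0 drho dPr kapb rhob rho0 Pr0 (HJ t x)).
- move=> t x; rewrite mulrDr /en addrC; apply: lerD.
    rewrite mulrA; apply: ler_wpM2r => //; have /andP[a b] := rhob (HJ t x).
    by apply: (@le_trans _ _ (rl / 2)); [rewrite ge_min lexx orbT|lra].
  apply: le_trans (energy_lower lo0 hi0 k00 rl0 drho dQ dPr kapb rhob rho0 Q0 Pr0 (HJ t x)).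
  by apply: ler_wpM2r; [exact: sqr_ge0|rewrite ge_min lexx].
- move=> t x; rewrite mulrDr /en addrC; apply: lerD.
    apply: le_trans (energy_upper lo0 hi0 k00 rl0 drho dQ dPr kapb rhob rho0 Q0 Pr0 (HJ t x)) _.
    by apply: ler_wpM2r; [exact: sqr_ge0|rewrite lerDl divr_ge0 // ltW].
  rewrite mulrA; apply: ler_wpM2r => //; have /andP[a b] := rhob (HJ t x).
  by rewrite /c3; have := ltW c3a; lra.
- move=> i t x; rewrite /m exprMn; apply: ler_pM; rewrite ?sqr_ge0 //.
  apply: le_trans (rho2_le t x) _; rewrite ler_sqr ?nnegrE ?(ltW rh0) // /c4.
  by rewrite ler_peMr ?(ltW rh0) // lerDl.
- move=> i j t x; rewrite /FL /m !exprMn mulrAC; apply: ler_pM; rewrite ?sqr_ge0 ?(mulr_ge0 (sqr_ge0 _) (sqr_ge0 _)) //.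
  rewrite ?/c4 ?exprMn; apply: ler_pM; rewrite ?sqr_ge0 //.
  apply: le_trans (U2_le j t x) _; apply: le_trans (W_le t x) _.
  by rewrite ler_sqr ?nnegrE ?addr_ge0 // lerDr.
(* The decay is known for [f = rho - 1]; the density grows in h at rate at least [k0 * rl], so h is
   controlled by [f]. *)
pose c := (k0 * rl) ^- 2; have c0 : 0 <= c by rewrite invr_ge0 sqr_ge0.
exists ((c + 1) * C), mu; split; rewrite ?mulr_ge0 ?addr_ge0 // => t t0.
have Ht0 : h t = H t by rewrite /H /ext max_r.
have -> : torus_int (fun x => enorm (u t x) ^+ 2) = torus_int (W t).
  congr torus_int; apply/funext => x; rewrite /enorm sqr_sqrtr; last first.
    by apply: sumr_ge0 => i _; rewrite -expr2 sqr_ge0.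
  by rewrite /dotp /W /Um /ext max_r.
have fc : continuous (fun x => f t x ^+ 2) by apply: contX; exact: (@jcont_slice R d _ t jf).
have Hc : continuous (fun x => H t x ^+ 2) by apply: contX; exact: (@jcont_slice R d _ t jH).
have h1 : torus_int (fun x => h t x ^+ 2) <= c * torus_int (fun x => f t x ^+ 2).
  rewrite Ht0 -torus_intZ //; apply: torus_int_le => //; first exact: contZ.
  by move=> x; exact: (sqr_le_density lo0 hi0 k00 rl0 drho kapb rhob rho0 (HJ t x)).
have W0 : 0 <= torus_int (W t) by apply: torus_int_ge0 => //; exact: (@jcont_slice R d _ t jW).
have F0 : 0 <= torus_int (fun x => f t x ^+ 2) by apply: torus_int_ge0 => // x; exact: sqr_ge0.
rewrite -mulrA; apply: le_trans (ler_wpM2l _ (H1 t t0)); last by rewrite addr_ge0.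
apply: le_trans (lerD h1 (lexx _)) _.
by rewrite mulrDl mul1r mulrDr -addrA lerD2l -[leLHS]add0r lerD ?mulr_ge0 // lerDr.
Qed.

End solution.
End barotropic.

(** * The Riesz potential in terms of real Fourier coefficients *)

Section riesz_potential.
Context {R : realType} (d : nat).
Notation V := 'rV[R]_d.
Notation K := 'rV[int]_d.

Lemma enorm_latticeE (k : K) : 2 * pi * enorm (lattice k) = Num.sqrt (omega2 k) :> R.
Proof.
have p0 : 0 <= 2 * pi :> R by rewrite mulr_ge0 // pi_ge0.
rewrite -[2 * pi](ger0_norm p0) -sqrtr_sqr -sqrtrM ?sqr_ge0 //; congr Num.sqrt.
rewrite /dotp /omega2 mulr_sumr; apply: eq_bigr => i _.
by rewrite /wave mxE; ring.
Qed.

(** For nonzero [k] the two symbols coincide. At [k = 0] they differ, being 0 and 1, but [f] has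
    mean zero because [s < 0], and both sides vanish. *)
Lemma is_Lambda_coefs (s p : R) (f g : V -> R) : 0 < p -> s = - (2 * p) -> is_Lambda s f g ->
  forall k, ca g k = om k `^ (- p) * ca f k /\ sa g k = om k `^ (- p) * sa f k.
Proof.
move=> p0 sE [_ _ f0 Hg] k.
have s0 : s < 0 by rewrite sE oppr_lt0 mulr_gt0.
have caE h : ca h k = torus_int (fun x => h x * cos (2 * pi * dotp (lattice k) x)) by [].
have saE h : sa h k = torus_int (fun x => h x * sin (2 * pi * dotp (lattice k) x)) by [].
have := Hg k; rewrite /fourier_coef -!caE -!saE => -[].
rewrite !mul0r subr0 addr0 mulrN => h1 /oppr_inj h2.
have [k0|k0] := eqVneq k 0.
  have ca0 : ca f k = 0.
    rewrite -(f0 s0) /ca; congr torus_int; apply/funext => x.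
    by rewrite k0 phase0l cos0 mulr1.
  have sa0 : sa f k = 0.
    rewrite -[RHS](torus_int_cst d) /sa; congr torus_int; apply/funext => x.
    by rewrite k0 phase0l sin0 mulr0.
  by rewrite h1 h2 ca0 sa0 !mulr0.
have -> : om k = omega2 k by rewrite /om (negPf k0).
suff -> : omega2 k `^ (- p) = (2 * pi * enorm (lattice k)) `^ s by [].
rewrite enorm_latticeE -powR12_sqrt; last by apply: sumr_ge0 => i _; exact: sqr_ge0.
by rewrite -powRrM sE; congr (_ `^ _); field.
Qed.

End riesz_potential.

Section pointwise_bounds.
Context {R : realType} (d : nat).

Lemma Linfty_norm_le (f : R -> 'rV[R]_d -> R) (M : R) : (Linfty_norm f <= M%:E)%E ->
  forall t x, 0 <= t -> `|f t x| <= M.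
Proof.
move=> H t x t0; rewrite -lee_fin; apply: le_trans H.
by apply: ereal_sup_ubound; exists (t, x).
Qed.

Lemma inf_t_ge0_le (f : R -> 'rV[R]_d -> R) (a b : R) :
  (a%:E <= inf_t_ge0 f + b%:E)%E -> forall t x, 0 <= t -> a <= f t x + b.
Proof.
move=> H t x t0; rewrite -lee_fin; apply: le_trans H _.
rewrite EFinD leeD2r //.
by apply: ereal_inf_lbound; exists (t, x).
Qed.

End pointwise_bounds.

Section decay.
Context {R : realType} (d : nat) (d0 : (0 < d)%N).
Notation V := 'rV[R]_d.

Lemma barotropic_decay (kap rho Q Pr : R -> R) (lo hi k0 k1 rl rh nu p M : R) :
  lo <= 0 -> 0 <= hi -> 0 < k0 -> 0 < rl ->
  (forall x : R, lo <= x <= hi -> {for x, continuous kap}) ->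
  (forall x : R, lo <= x <= hi -> is_derive x 1 rho (kap x * rho x)) ->
  (forall x : R, lo <= x <= hi -> is_derive x 1 Q (kap x)^-1) ->
  (forall x : R, lo <= x <= hi -> is_derive x 1 Pr (rho x / kap x)) ->
  (forall x, lo <= x <= hi -> k0 <= kap x <= k1) ->
  (forall x, lo <= x <= hi -> rl <= rho x <= rh) ->
  rho 0 = 1 -> Q 0 = 0 -> Pr 0 = 0 -> 0 < nu -> 0 < p -> 0 <= M ->
  exists lam0 : R, 0 < lam0 < 1 /\ forall lam, 0 < lam < lam0 ->
  forall (h : R -> V -> R) (u : R -> V -> V),
  (forall t : R, 0 <= t -> Zperiodic (h t) /\ Zperiodic (u t)) ->
  C1_t_ge0 h -> (forall i, C1_t_ge0 (fun t x => u t x 0 i)) ->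
  (forall t x, 0 <= t -> lo <= h t x <= hi) ->
  (forall t x, 0 <= t -> enorm (u t x) <= M) ->
  (forall t, 0 <= t -> torus_int (fun x => rho (h t x)) = 1) ->
  (forall t : R, 0 < t -> exists phi : V -> R,
  [/\ cper phi, forall (x : V) (i : 'I_d), derivable phi x (delta_mx 0 i),
      forall k, ca phi k = om k `^ (- p) * ca (fun x => rho (h t x) - 1) k
             /\ sa phi k = om k `^ (- p) * sa (fun x => rho (h t x) - 1) k,
      forall x, dt h t x + advect (u t x) (h t) x + (kap (h t x))^-1 * divergence (u t) x = 0
    & forall x i, dt (fun s y => u s y 0 i) t x + advect (u t x) (fun y => u t y 0 i) x
            + (kap (h t x))^-1 * dx i (h t) x = - nu * u t x 0 i + lam * dx i phi x]) ->
  exists C mu : R, [/\ 0 < C, 0 < mu &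
    forall t : R, 0 <= t -> L2norm (h t) (u t) <= C * expR (- (C * mu * t))].
Proof.
move=> lo0 hi0 k00 rl0 ckap drho dQ dPr kapb rhob rho0 Q0 Pr0 nu0 p0 M0.
have J0 : lo <= 0 <= hi by rewrite lo0 hi0.
have k10 : 0 < k1 by have /andP[a b] := kapb 0 J0; lra.
have rh0 : 0 < rh by have /andP[a b] := rhob 0 J0; lra.
set c1 := (k1 ^+ 2)^-1; set B := rh + 1; set c2 := Num.min ((k1 ^+ 2 * rh)^-1 / 2) (rl / 2).
have c10 : 0 < c1 by rewrite invr_gt0 exprn_gt0.
have c20 : 0 < c2 by rewrite lt_min !divr_gt0 ?invr_gt0 ?mulr_gt0 ?exprn_gt0.
pose D := 1 + d%:R * expR 1 * B.
have D0 : 0 < D by rewrite ltr_pwDl // !mulr_ge0 ?expR_ge0 // addr_ge0 // ltW.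
(* The entry 1/2 keeps the threshold below 1; the other two are the smallness conditions of the
   commutator and of the potential energy. *)
exists (Num.min (2^-1) (Num.min (c1 / 4 / D) (c2 / 2))); split.
  rewrite !lt_min !gt_min invr_gt0 ltr0n !divr_gt0 //=.
  by apply/orP; left; lra.
move=> lam /andP[lam0]; rewrite !lt_min => /and3P[_ lam1 lam2] h u per.
move=> [ht [hx [hc htc hxc dht dhx]]] uC hJ uM mean1 eqs.
have [ut utP] := choice uC.
have [ux {utP} uP] := choice utP.
have uc i : continuous_t_ge0 (fun t x => u t x 0 i) by have [] := uP i.
have utc i : continuous_t_ge0 (ut i) by have [] := uP i.
have uxc i j : continuous_t_ge0 (ux i j) by have [_ _ H _ _] := uP i; exact: H.
have dut i (t : R) x : 0 < t -> is_derive t 1 (fun s => u s x 0 i) (ut i t x).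
  by have [_ _ _ H _] := uP i; exact: H.
have dux (i j : 'I_d) (t : R) (x : V) : 0 <= t ->
    is_derive x (delta_mx 0 j) (fun x => u t x 0 i) (ux i j t x).
  by have [_ _ _ _ H] := uP i; exact: H.
have [|||C [mu [C0 mu0 H]]] := @barotropic_lyapunov R d d0 kap rho Q Pr lo hi k0 k1 rl rh
  lo0 hi0 k00 rl0 ckap drho dQ dPr kapb rhob rho0 Q0 Pr0 nu p M nu0 p0 M0 lam h ht u hx ut ux
  lam0 _ (ltW lam2) per hc htc hxc dht dhx uc utc uxc dut dux hJ _ mean1 _.
- by rewrite -ler_pdivlMr ?ltW.
- move=> t x t0; have := uM t x t0 => h1.
  have s0 : 0 <= dotp (u t x) (u t x) by apply: sumr_ge0 => i _; rewrite -expr2 sqr_ge0.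
  by rewrite -(sqr_sqrtr s0) ler_sqr ?nnegrE ?sqrtr_ge0.
- move=> t t0; have [phi [phip dphi hk e1 e2]] := eqs t t0; exists phi.
  have t0' := ltW t0.
  have dxh i x : dx i (h t) x = hx i t x by have := dhx i t x t0' => hd; exact: derive_val.
  have dxu i j x : dx j (fun y => u t y 0 i) x = ux i j t x.
    by have := dux i j t x t0' => hd; exact: derive_val.
  split => // [x|x i].
    have -> : ht t x = dt h t x.
      by have := dht t x t0 => hd; rewrite /dt derive1E; symmetry; exact: derive_val.
    rewrite -[RHS](e1 x); congr (_ + _ + _ * _); rewrite ?/advect ?/divergence.
      by apply: eq_bigr => i _; rewrite dxh.
    by apply: eq_bigr => i _; rewrite dxu.
  have -> : ut i t x = dt (fun s y => u s y 0 i) t x.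
    by have := dut i t x t0 => hd; rewrite /dt derive1E; symmetry; exact: derive_val.
  by rewrite -e2 dxh; congr (_ + _ + _); apply: eq_bigr => j _; rewrite dxu.
(* The square root halves the rate. The summand 1 makes [C'] positive, and dividing [mu / 2] by [C']
   compensates the factor C in the exponent of the claim. *)
pose C' := Num.sqrt C + 1.
have C'0 : 0 < C' by rewrite ltr_wpDl ?sqrtr_ge0.
exists C', (mu / 2 / C'); split; rewrite ?divr_gt0 // => t t0.
rewrite (_ : C' * (mu / 2 / C') * t = mu / 2 * t); last by field; rewrite gt_eqF.
rewrite -[leRHS]ger0_norm ?mulr_ge0 ?expR_ge0 ?(ltW C'0) // -sqrtr_sqr ler_wsqrtr //.
apply: le_trans (H t t0) _; rewrite exprMn -expRM_natl.
apply: ler_pM; rewrite ?expR_ge0 //.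
  by rewrite -{1}(sqr_sqrtr C0) ler_sqr ?nnegrE ?sqrtr_ge0 ?(ltW C'0) // lerDl.
rewrite le_eqVlt (_ : - (mu * t) = 2%:R * - (mu / 2 * t)) ?eqxx //.
by field.
Qed.

End decay.

(** * The density law for gamma > 1 *)

Section power_law.
Context {R : realType}.
Variables (N s a M : R).
Hypotheses (N0 : 0 < N) (s0 : 0 < s) (a0 : 0 < a) (aM : a <= M + s).

Definition power_density (x : R) : R := s `^ (- N) * (x + s) `^ N.

Let sN0 : 0 < s `^ N. Proof. exact: powR_gt0. Qed.

Lemma power_density0 : power_density 0 = 1.
Proof. by rewrite /power_density add0r powRN mulVf // gt_eqF. Qed.

Lemma is_derive_power_density (x : R) : 0 < x + s ->
  is_derive x 1 power_density (N / (x + s) * power_density x).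
Proof.
move=> x0.
have dx : is_derive x 1 (fun y : R => y + s) 1.
  by have := deriD (is_derive_id x 1) (deri_cst s x 1); rewrite addr0.
have := deriZ (s `^ (- N)) (@is_derive_chain R R (fun y : R => y `^ N) (fun y => y + s) x 1 _ _
  (is_derive1_powR N x0) dx) => h.
apply: (is_derive_eq h); rewrite mulr1 /power_density.
have -> : (x + s) `^ (N - 1) = (x + s) `^ N / (x + s).
  rewrite powRB; first by rewrite powRr1 // ltW.
  by rewrite (gt_eqF x0) implybT.
by field; rewrite gt_eqF.
Qed.

Lemma is_derive_sqr_shift (x : R) : is_derive x 1 (fun y : R => (y + s) * (y + s)) (2 * (x + s)).
Proof.
have dx : is_derive x 1 (fun y : R => y + s) 1.
  by have := deriD (is_derive_id x 1) (deri_cst s x 1); rewrite addr0.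
by have := deriM dx dx => h; apply: (is_derive_eq h); ring.
Qed.

Lemma power_density_bounds x : a <= x + s <= M + s ->
  s `^ (- N) * a `^ N <= power_density x <= s `^ (- N) * (M + s) `^ N.
Proof.
move=> /andP[h1 h2]; have sN : 0 < s `^ (- N) by exact: powR_gt0.
by rewrite !ler_pM2l // !ge0_ler_powR ?nnegrE ?(ltW N0) ?(ltW a0) //; move: (a0) (aM) h1 h2; lra.
Qed.

End power_law.

Theorem theorem1p2 (R : realType) (d : nat) (alpha gamma nu : R)
    (hd : (2 <= d)%N) (halpha : Num.max (d%:R - 2) 0 <= alpha < d%:R)
    (hgamma : 1 <= gamma) (hnu : 0 < nu)
    (M hmin : R) (hM : 0 < M) (hhmin : 0 < hmin) :
  exists lambda0 : R, 0 < lambda0 < 1 /\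
    forall lambda : R, 0 < lambda < lambda0 ->
    forall (h : R -> 'rV[R]_d -> R) (u : R -> 'rV[R]_d -> 'rV[R]_d),
      global_classical_solution gamma alpha nu lambda h u ->
      neutral gamma h ->
      (1 < gamma -> (hmin%:E <= inf_t_ge0 h + (sigma gamma)%:E)%E) ->
      (Linfty_norm h <= M%:E)%E ->
      (Linfty_norm (fun t x => enorm (u t x)) <= M%:E)%E ->
      exists C mu : R, [/\ 0 < C, 0 < mu &
        forall t : R, 0 <= t -> L2norm (h t) (u t) <= C * expR (- (C * mu * t))].
Proof.
have d0 : (0 < d)%N by exact: ltnW.
have ad : alpha < d%:R by have /andP[] := halpha.
(* The potential has order alpha - d = - 2 p, that is, the power - p of minus the Laplacian. *)
pose p : R := (d%:R - alpha) / 2.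
have p0 : 0 < p by rewrite divr_gt0 // subr_gt0.
have pE : alpha - d%:R = - (2 * p) by rewrite /p; field.
have M0 := ltW hM.
have enM (u : R -> 'rV[R]_d -> 'rV[R]_d) : (Linfty_norm (fun t x => enorm (u t x)) <= M%:E)%E ->
    forall t x, 0 <= t -> enorm (u t x) <= M.
  by move=> uM t x t0; apply: le_trans (Linfty_norm_le uM x t0); exact: ler_norm.
case: (eqVneq gamma 1) => [g1|gn1].
  (* Isothermal law: unit sound speed, density e^h, enthalpy h, and pressure equal to the
     density. *)
  have [||||||||lam0 [lamI H]] := @barotropic_decay R d d0 (fun=> 1) expR id (fun x => expR x - 1) (- M) M 1 1
    (expR (- M)) (expR M) nu p M _ M0 ltr01 (expR_gt0 _) _ _ _ _ _ _ (expR0 R) erefl _ hnu p0 M0.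
  - by rewrite oppr_le0.
  - by move=> x _; exact: cst_continuous.
  - by move=> x _; rewrite mul1r; exact: is_derive_expR.
  - by move=> x _; rewrite invr1; exact: is_derive_id.
  - move=> x _; rewrite divr1; have := deriB (is_derive_expR x) (deri_cst 1 x 1).
    by rewrite subr0.
  - by move=> x _; rewrite lexx.
  - by move=> x /andP[h1 h2]; rewrite !ler_expR h1.
  - by rewrite expR0 subrr.
  exists lam0; split => // lam lamI' h u [per hC uC]; rewrite /euler_riesz_system /neutral g1 eqxx.
  move=> sys mean _ hb ub.
  apply: (H lam lamI' h u per hC uC) => //.
  - by move=> t x t0; rewrite -ler_norml; exact: (Linfty_norm_le hb).
  - exact: enM.
  move=> t t0; have [phi [phiL dphi e1 e2]] := sys t t0; exists phi; split => //.
  - by case: phiL.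
  - exact: (is_Lambda_coefs p0 pE phiL).
  - by move=> x; rewrite invr1 mul1r.
  - by move=> x i; rewrite invr1 mul1r.
have g1 : 1 < gamma by rewrite lt_neqAle eq_sym gn1.
set N := Nexp gamma; set s := sigma gamma.
have N0 : 0 < N by rewrite divr_gt0 // subr_gt0.
have s0 : 0 < s by rewrite mulr_gt0 // powR_gt0 //; lra.
(* [hmin] may exceed [sigma]; taking the minimum keeps the rest state h = 0 inside the interval
   [a - s, M]. *)
pose a := Num.min hmin s.
have a0 : 0 < a by rewrite lt_min hhmin.
have as_ : a <= s by rewrite ge_min lexx orbT.
have aM : a <= M + s by lra.
have J x : a - s <= x <= M -> a <= x + s <= M + s by move=> /andP[h1 h2]; apply/andP; split; lra.
have Jp x : a - s <= x <= M -> 0 < x + s by move=> /J/andP[h1 h2]; lra.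
pose rho := power_density N s.
have drho (x : R) : a - s <= x <= M -> is_derive x 1 rho (N / (x + s) * rho x).
  by move=> /Jp; exact: is_derive_power_density.
have dsq := @is_derive_sqr_shift R s.
(* With inverse sound speed N / (x + s), the enthalpy is an antiderivative of (x + s) / N. The
   pressure is one of (x + s) rho / N, a multiple of (x + s)^(N + 1), whence the factor 1 / (N (N +
   2)); both are normalised to vanish at 0. *)
have [||||||||||lam0 [lamI H]] := @barotropic_decay R d d0 (fun x => N / (x + s)) rho
    (fun x => (2 * N)^-1 * ((x + s) * (x + s) - s ^+ 2))
    (fun x => (N * (N + 2))^-1 * ((x + s) * (x + s) * rho x - s ^+ 2)) (a - s) M (N / (M + s)) (N / a)
    (s `^ (- N) * a `^ N) (s `^ (- N) * (M + s) `^ N) nu p M _ M0 _ _ _ drho _ _ _ _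
    (power_density0 N s0) _ _ hnu p0 M0.
- by rewrite subr_le0.
- by rewrite divr_gt0 //; lra.
- by rewrite mulr_gt0 // powR_gt0.
- move=> x /Jp x0; apply: cvgM; first exact: cvg_cst.
  apply: cvgV; first by rewrite gt_eqF.
  by apply: cvgD; [exact: cvg_id|exact: cvg_cst].
- move=> x /Jp x0; have := deriZ (2 * N)^-1 (deriB (dsq x) (deri_cst (s ^+ 2) x 1)) => der.
  by apply: (is_derive_eq der); field; rewrite !gt_eqF.
- move=> x xJ; have x0 := Jp x xJ.
  have := deriZ (N * (N + 2))^-1 (deriB (deriM (dsq x) (drho x xJ)) (deri_cst (s ^+ 2) x 1)) => der.
  have N2 : 0 < N + 2 by lra.
  by apply: (is_derive_eq der); field; rewrite !gt_eqF.
- move=> x /J/andP[h1 h2]; have x0 : 0 < x + s by lra.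
  by rewrite !ler_pM2l // !lef_pV2 ?posrE ?h1 ?h2 //; lra.
- by move=> x /J; exact: power_density_bounds.
- by rewrite add0r -expr2 subrr mulr0.
- by rewrite add0r /rho power_density0 // mulr1 -expr2 subrr mulr0.
exists lam0; split => // lam lamI' h u [per hC uC]; rewrite /euler_riesz_system /neutral (negPf gn1).
move=> sys mean hlow hb ub.
have hJ t x : 0 <= t -> a - s <= h t x <= M.
  move=> t0; have := inf_t_ge0_le (hlow g1) x t0; rewrite -/s => h1.
  have := Linfty_norm_le hb x t0; rewrite ler_norml => /andP[_ ->]; rewrite andbT lerBlDr.
  by apply: le_trans h1; rewrite ge_min lexx.
have sN0 : 0 < s `^ N by exact: powR_gt0.
have sNN : s `^ (- N) * s `^ N = 1 by rewrite powRN mulVf // gt_eqF.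
have hNc t : 0 <= t -> continuous (fun x => (h t x + s) `^ N).
  move=> t0 x; have hc : continuous (h t).
    by case: hC => ht [hx [hc _ _ _ _]]; exact: continuous_t_ge0_slice.
  apply: (@continuous_comp _ _ _ (fun y => h t y + s) (fun y : R => y `^ N)).
    by apply: contD => //; exact: cont_cst.
  apply: differentiable_continuous; apply/derivable1_diffP.
  by have [] := is_derive1_powR N (Jp _ (hJ t x t0)).
apply: (H lam lamI' h u per hC uC) => //.
- exact: enM.
- by move=> t t0; rewrite torus_intZ ?(mean t t0) //; exact: hNc.
move=> t t0; have [phi [phiL dphi e1 e2]] := sys t t0.
have [phip phic _ _] := phiL.
have fE : (fun x => rho (h t x) - 1) = fun x => s `^ (- N) * ((h t x + s) `^ N - s `^ N).
  by apply/funext => x; rewrite mulrBr sNN.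
have fc : continuous (fun x => (h t x + s) `^ N - s `^ N).
  by apply: contB; [exact: hNc (ltW t0)|exact: cont_cst].
(* The factor sigma^(-N) of the force is put into the potential, which becomes the Riesz potential
   of rho - 1. *)
exists (fun x => s `^ (- N) * phi x); split.
- by split; [exact: contZ|move=> x k; rewrite phip].
- by move=> x i; apply: derivableZ; exact: dphi.
- move=> k; have [h1 h2] := is_Lambda_coefs p0 pE phiL k.
  by rewrite fE !caZ // !saZ // h1 h2; split; ring.
- by move=> x; rewrite invf_div mulrC -/N; have := e1 x; rewrite -/N -/s => <-; congr (_ + _); ring.
- move=> x i; rewrite (_ : dx i (fun x => s `^ (- N) * phi x) x = s `^ (- N) * dx i phi x); last first.
    by have := deriZ (s `^ (- N)) (DeriveDef (dphi x i) erefl) => der; exact: derive_val.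
  rewrite invf_div; have := e2 x i; rewrite -/N -/s => e.
  rewrite mulrA [lam * _]mulrC -e; congr (_ + _); ring.
Qed.
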